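(* Let $G$ be a profinite group such that $c_*(G)$ is finite, and let $H$ be a (closed) subgroup of $G$. Then $H$ is Fitting-regular.
   Context: Profinite groups are regarded as topological groups: subgroups are required to be closed, homomorphisms continuous, and generation means topological generation. For a profinite group $G$ and a prime $p$, $d_p(G)$ denotes the size of a minimum (topological) generating set for a $p$-Sylow subgroup of $G$. For a finitely generated pro-$p$ group $S$ with Frattini subgroup $\Phi(S)$, the elementary abelian group $S/\Phi(S)$ has a finite $\mathrm{Aut}(S)$-invariant series in which each factor is irreducible as an $\mathrm{Aut}(S)$-module; $c(S)$ denotes the maximum rank (dimension over $\mathbb{F}_p$) of the factors, which is well defined by the Jordan–Hölder theorem. If $G$ has a finitely generated $p$-Sylow subgroup $S$, put $c_p(G) := c(S)$; otherwise put $c_p(G) := d_p(G)$ (which is infinite). $c_*(G)$ is the supremum of $c_p(G)$ over all primes $p$. For a profinite group $G$ and a prime $p$, $O_p(G)$ is the subgroup generated by all normal pro-$p$ subgroups of $G$; the Fitting subgroup $F(G)$ is the subgroup generated by the $O_p(G)$ for all primes $p$. A profinite group $Q$ is quasisimple if $Q$ is perfect and $Q/Z(Q)$ is simple. A component of $G$ is a subnormal quasisimple subgroup of $G$; the layer $E(G)$ is the subgroup generated by all components of $G$. The generalised Fitting subgroup $F^*(G)$ is the subgroup generated by $F(G)$ and $E(G)$. $G$ is Fitting-degenerate if $F^*(G)$ is trivial. $G$ is Fitting-regular if no non-trivial image (quotient by a closed normal subgroup) of $G$ is Fitting-degenerate. *)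

(* Defs.v *)
From HB Require Import structures.
From mathcomp Require Import all_boot all_order all_algebra.
From mathcomp Require Import all_classical all_reals all_analysis.

Set Implicit Arguments.
Unset Strict Implicit.
Unset Printing Implicit Defensive.

Local Open Scope quotient_scope.
Local Open Scope classical_set_scope.
Local Open Scope group_scope.

#[short(type="preTopGroupType")]
HB.structure Definition PreTopologicalGroup :=
  {G of Group G & Topological G}.

HB.mixin Record isTopologicalGroup G of PreTopologicalGroup G := {
  mulg_continuous : continuous (fun x : G * G => x.1 * x.2);
  invg_continuous : continuous (fun x : G => x^-1)
}.

#[short(type="topGroupType")]
HB.structure Definition TopologicalGroup :=
  {G of PreTopologicalGroup G & isTopologicalGroup G}.

Definition profinite (G : topGroupType) : Prop :=
  [/\ compact [set: G], hausdorff_space G & totally_disconnected [set: G]].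

(** Abstract subgroups. Closedness is always stated separately. *)
Record subgroup (G : groupType) := Subgroup {
  sgval :> set G;
  sg1 : sgval 1;
  sgM : forall x y, sgval x -> sgval y -> sgval (x * y);
  sgV : forall x, sgval x -> sgval x^-1
}.

HB.instance Definition _ (G : groupType) := gen_eqMixin (subgroup G).
HB.instance Definition _ (G : groupType) := gen_choiceMixin (subgroup G).

Definition trivsg (G : groupType) : subgroup G.
Proof.
exists [set 1] => //=.
- by move=> x y -> ->; rewrite mul1g.
- by move=> x ->; rewrite invg1.
Defined.

Definition is_normal (G : groupType) (N : set G) : Prop :=
  forall x y, N x -> N (x ^ y).

Record normalSubgroup (G : groupType) := NormalSubgroup {
  nsval :> subgroup G;
  nsJ : is_normal nsval
}.

(** A subgroup as a topological group in its own right, with the topology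
    induced by the inclusion. *)
Definition subgrp (G : topGroupType) (H : subgroup G) : Type := set_type H.

Section Subgrp.
Variables (G : topGroupType) (H : subgroup G).

Lemma subgroup_group_closed : group_closed (fun x : G => x \in (H : set G)).
Proof.
split=> [|x y]; first exact/mem_set/sg1.
move=> /set_mem Hx /set_mem Hy; apply/mem_set/sgM => //.
exact: sgV.
Qed.

HB.instance Definition _ := SubChoice.on (subgrp H).
HB.instance Definition _ :=
  SubChoice_isSubGroup.Build G (fun x : G => x \in (H : set G)) (subgrp H)
    subgroup_group_closed.
HB.instance Definition _ := Topological.copy (subgrp H) (set_type H).

Lemma subgrp_val_continuous : continuous (val : subgrp H -> G).
Proof. exact: initial_continuous. Qed.

Lemma continuous_subgrp (T : topologicalType) (f : T -> subgrp H) :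
  continuous (val \o f : T -> G) -> continuous f.
Proof.
move=> /continuousP cf; apply/continuousP => _ [A oA <-].
by rewrite -comp_preimage; exact: cf.
Qed.

Lemma subgrp_mul_continuous :
  continuous (fun x : subgrp H * subgrp H => x.1 * x.2).
Proof.
apply: continuous_subgrp => x.
apply: (@continuous_comp _ _ _
  (fun x : subgrp H * subgrp H => (val x.1 : G, val x.2 : G))
  (fun y => y.1 * y.2)); last exact: mulg_continuous.
apply: cvg_pair.
- by apply: continuous_comp; [exact: cvg_fst|exact: subgrp_val_continuous].
- by apply: continuous_comp; [exact: cvg_snd|exact: subgrp_val_continuous].
Qed.

Lemma subgrp_inv_continuous : continuous (fun x : subgrp H => x^-1).
Proof.
apply: continuous_subgrp => x.
apply: (@continuous_comp _ _ _ (val : subgrp H -> G) (fun y => y^-1)).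
- exact: subgrp_val_continuous.
- exact: invg_continuous.
Qed.

HB.instance Definition _ := isTopologicalGroup.Build (subgrp H)
  subgrp_mul_continuous subgrp_inv_continuous.

End Subgrp.

Section QuotientRel.
Variables (G : groupType) (N : subgroup G).

Definition coset_rel : rel G := fun x y => `[< sgval N (x^-1 * y) >].

Lemma coset_relP : equiv_class_of coset_rel.
Proof.
split=> [x|x y|y x z].
- by apply/asboolP; rewrite mulVg; exact: sg1.
- by apply/asboolP/asboolP => /sgV; rewrite invgM invgK.
- move=> /asboolP Nxy /asboolP Nyz; apply/asboolP.
  by have := sgM Nxy Nyz; rewrite mulgA mulgK.
Qed.

Canonical coset_equiv := EquivRelPack coset_relP.

End QuotientRel.

(** The quotient of [G] by a normal subgroup [N]: the left cosets of [N], with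
    the quotient topology. *)
Definition quotgrp (G : topGroupType) (N : normalSubgroup G) : Type :=
  quotient_topology {eq_quot (coset_equiv N)}.

Section Quotgrp.
Variables (G : topGroupType) (N : normalSubgroup G).
Local Notation Q := (quotgrp N).

HB.instance Definition _ :=
  Topological.copy Q (quotient_topology {eq_quot (coset_equiv N)}).
HB.instance Definition _ :=
  Quotient.copy Q (quotient_topology {eq_quot (coset_equiv N)}).

Definition coset (x : G) : Q := \pi_Q x.

Lemma coset_eqP (x y : G) : coset x = coset y <-> sgval N (x^-1 * y).
Proof.
rewrite /coset; split=> [/eqquotP/asboolP//|Nxy].
by apply/eqquotP/asboolP.
Qed.

Lemma coset_repr (a : Q) : coset (repr a) = a.
Proof. exact: reprK. Qed.

Lemma coset_ind (P : Q -> Prop) : (forall x, P (coset x)) -> forall a, P a.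
Proof. by move=> Px a; rewrite -(coset_repr a). Qed.

Definition quot_one : Q := coset 1.
Definition quot_mul (a b : Q) : Q := coset (repr a * repr b).
Definition quot_inv (a : Q) : Q := coset (repr a)^-1.

Lemma quot_mulE x y : quot_mul (coset x) (coset y) = coset (x * y).
Proof.
have Nrepr z : sgval N ((repr (coset z))^-1 * z).
  by apply/coset_eqP; rewrite coset_repr.
have Nx := Nrepr x; have Ny := Nrepr y.
apply/coset_eqP; move: (repr (coset x)) (repr (coset y)) Nx Ny.
move=> x' y' Nx Ny.
have := sgM (nsJ y' Nx) Ny.
by rewrite conjgE invgM !mulgA mulgK.
Qed.

Lemma quot_invE x : quot_inv (coset x) = coset x^-1.
Proof.
have Nx : sgval N ((repr (coset x))^-1 * x).
  by apply/coset_eqP; rewrite coset_repr.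
apply/coset_eqP; move: (repr _) Nx => x' Nx.
have := sgV (nsJ x^-1 Nx).
by rewrite conjgE invgK mulgK invgM.
Qed.

Lemma quot_mulA : associative quot_mul.
Proof.
elim/coset_ind=> x; elim/coset_ind=> y; elim/coset_ind=> z.
by rewrite !quot_mulE mulgA.
Qed.

Lemma quot_mul1 : left_id quot_one quot_mul.
Proof. by elim/coset_ind=> x; rewrite quot_mulE mul1g. Qed.

Lemma quot_1mul : right_id quot_one quot_mul.
Proof. by elim/coset_ind=> x; rewrite quot_mulE mulg1. Qed.

Lemma quot_mulV : left_inverse quot_one quot_inv quot_mul.
Proof. by elim/coset_ind=> x; rewrite quot_invE quot_mulE mulVg. Qed.

Lemma quot_Vmul : right_inverse quot_one quot_inv quot_mul.
Proof. by elim/coset_ind=> x; rewrite quot_invE quot_mulE mulgV. Qed.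

HB.instance Definition _ := isGroup.Build Q
  quot_mulA quot_mul1 quot_1mul quot_mulV quot_Vmul.

Lemma cosetM x y : coset (x * y) = coset x * coset y.
Proof. by rewrite -quot_mulE. Qed.

Lemma cosetV x : coset x^-1 = (coset x)^-1.
Proof. by rewrite -quot_invE. Qed.

Lemma coset_continuous : continuous coset.
Proof. exact: pi_continuous. Qed.

Lemma mulgr_continuous (y : G) : continuous (fun x : G => x * y).
Proof.
move=> x.
apply: (@continuous_comp _ _ _ (fun x : G => (x, y)) (fun z => z.1 * z.2)).
  by apply: cvg_pair => /=; [exact: cvg_id|exact: cvg_cst].
exact: mulg_continuous.
Qed.

Lemma coset_open (U : set G) : open U -> open (coset @` U).
Proof.
move=> oU; rewrite /open/= /quotient_open.
rewrite (_ : _ @^-1` _ = \bigcup_(n in N) ((fun x => x * n) @^-1` U)).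
  apply: bigcup_open => n _.
  by apply: open_comp => // x _; exact: mulgr_continuous.
apply/seteqP; split=> [x [u Uu /esym/coset_eqP Nxu]|x [n Nn Uxn]].
  by exists (x^-1 * u) => //=; rewrite mulgA mulgV mul1g.
exists (x * n) => //; apply/esym/coset_eqP.
by rewrite mulgA mulVg mul1g.
Qed.

Lemma quot_mul_continuous : continuous (fun x : Q * Q => x.1 * x.2).
Proof.
case; elim/coset_ind=> x; elim/coset_ind=> y A.
rewrite /= -cosetM => /coset_continuous /(mulg_continuous (x, y)).
case=> -[B C] [/= nB nC] BCA.
move: nB nC; rewrite (nbhsE x) (nbhsE y).
move=> -[B' [oB' B'x] B'B] [C' [oC' C'y] C'C].
exists (coset @` B', coset @` C') => /=.
  split; apply: open_nbhs_nbhs; split; try exact: coset_open.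
  - by exists x.
  - by exists y.
case=> _ _ [/= [b B'b <-] [c C'c <-]].
rewrite -cosetM; apply: (BCA (b, c)); split=> /=.
- exact: B'B.
- exact: C'C.
Qed.

Lemma quot_inv_continuous : continuous (fun x : Q => x^-1).
Proof.
apply/quotient_continuous => x.
rewrite (_ : _ \o _ = coset \o (fun x : G => x^-1)).
  by apply: continuous_comp; [exact: invg_continuous|exact: coset_continuous].
by apply/funext => y /=; rewrite cosetV.
Qed.

HB.instance Definition _ := isTopologicalGroup.Build Q
  quot_mul_continuous quot_inv_continuous.

End Quotgrp.

(** The closed subgroup topologically generated by [A]. *)
Definition generated (G : topGroupType) (A : set G) : subgroup G.
Proof.
exists (\bigcap_(K in [set K : subgroup G | closed K /\ A `<=` K]) K).
- by move=> K _; exact: sg1.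
- by move=> x y Kx Ky K hK; apply: sgM; [exact: Kx|exact: Ky].
- by move=> x Kx K hK; apply: sgV; exact: Kx.
Defined.

Definition centre (G : groupType) : normalSubgroup G.
Proof.
unshelve refine (@NormalSubgroup _
  (@Subgroup _ [set x : G | forall y, x * y = y * x] _ _ _) _) => /=.
- by move=> y; rewrite mul1g mulg1.
- by move=> x y cx cy z; rewrite -mulgA (cy z) mulgA (cx z) -mulgA.
- by move=> x cx y; apply: (mulgI x); rewrite !mulgA mulgV mul1g (cx y) mulgK.
- by move=> x y cx z; rewrite conjgE cx mulgA mulVg mul1g cx.
Defined.

Definition maximal_subgroup (G : topGroupType) (M : subgroup G) : Prop :=
  [/\ closed M, (M : set G) <> setT &
      forall K : subgroup G, closed K -> M `<=` K ->
        (K : set G) = M \/ (K : set G) = setT].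

Section Frattini.
Variable G : topGroupType.

Definition conjsg (M : subgroup G) (y : G) : subgroup G.
Proof.
exists [set x | sgval M (x ^ y)] => /=.
- by rewrite conj1g; exact: sg1.
- by move=> a b Ma Mb; rewrite conjMg; exact: sgM.
- by move=> a Ma; rewrite conjVg; exact: sgV.
Defined.

Lemma conjg_continuous (y : G) : continuous (fun x : G => x ^ y).
Proof.
move=> x.
apply: (@continuous_comp _ _ _ (fun x : G => (y^-1, x * y))
  (fun z => z.1 * z.2)).
  by apply: cvg_pair => /=; [exact: cvg_cst|exact: mulgr_continuous].
exact: mulg_continuous.
Qed.

Lemma closed_conjsg (M : subgroup G) (y : G) : closed M -> closed (conjsg M y).
Proof. by apply: preimage_closed => x _; exact: conjg_continuous. Qed.

Lemma maximal_conjsg (M : subgroup G) (y : G) :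
  maximal_subgroup M -> maximal_subgroup (conjsg M y).
Proof.
case=> clM nMT maxM; split; first exact: closed_conjsg.
  move=> MT; apply: nMT; apply/seteqP; split=> // x _.
  by have : [set: G] (x ^ y^-1) by []; rewrite -MT /= conjgKV.
move=> K clK MK; case: (maxM (conjsg K y^-1) (closed_conjsg clK)).
- by move=> x Mx /=; apply: MK => /=; rewrite conjgKV.
- move=> KM; left; apply/seteqP; split=> // x Kx /=.
  by rewrite -KM /= conjgK.
- move=> KT; right; apply/seteqP; split=> // x _.
  by have : [set: G] (x ^ y) by []; rewrite -KT /= conjgK.
Qed.

(** The Frattini subgroup: the intersection of the maximal closed subgroups. *)
Definition frattini : normalSubgroup G.
Proof.
unshelve refine (@NormalSubgroup _ (@Subgroup _
  (\bigcap_(M in [set M : subgroup G | maximal_subgroup M]) M) _ _ _) _) => /=.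
- by move=> M _; exact: sg1.
- by move=> x y hx hy M hM; apply: sgM; [exact: hx|exact: hy].
- by move=> x hx M hM; apply: sgV; exact: hx.
- by move=> x y hx M hM; exact: (hx (conjsg M y) (maximal_conjsg y hM)).
Defined.

End Frattini.

(** [has_index A n]: the subgroup with carrier [A] has exactly [n] left
    cosets. *)
Definition has_index (G : groupType) (A : set G) (n : nat) : Prop :=
  (range (fun x : G => [set x * a | a in A]) #= `I_n)%card.

Definition pro_p (p : nat) (G : topGroupType) : Prop :=
  profinite G /\
  forall N : subgroup G, open N -> is_normal N ->
    exists k, has_index N (p ^ k)%N.

(** [S] is a pro-p group and its index, as a supernatural number (the least
    common multiple of the [|G : SN|] for [N] open normal), is prime to [p]. *)
Definition is_sylow (p : nat) (G : topGroupType) (S : subgroup G) : Prop :=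
  [/\ closed S, pro_p p (subgrp S) &
      forall N : subgroup G, open N -> is_normal N ->
        exists2 n, has_index [set x * y | x in S & y in N] n & coprime p n].

(** Sylow subgroups exist and are conjugate in a profinite group, so the default
    value is never used and the choice is immaterial. *)
Definition sylow (p : nat) (G : topGroupType) : subgroup G :=
  xget (trivsg G) [set S | is_sylow p S].

Definition generates (G : topGroupType) (A : set G) : Prop :=
  (generated A : set G) = setT.

Definition finitely_generated (G : topGroupType) : Prop :=
  exists s : seq G, generates [set` s].

(** The size of a minimum topological generating set, every infinite cardinal
    being identified with [+oo]. *)
Definition dgen (R : realType) (G : topGroupType) : \bar R :=
  ereal_inf [set ((size s)%:R)%:E | s in [set s : seq G | generates [set` s]]].

Definition d_p (R : realType) (p : nat) (G : topGroupType) : \bar R :=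
  dgen R (subgrp (sylow p G)).

Definition is_aut (S : topGroupType) (f : S -> S) : Prop :=
  [/\ {morph f : x y / x * y}, continuous f &
      exists g : S -> S, [/\ cancel f g, cancel g f & continuous g]].

Section CRank.
Variables (p : nat) (S : topGroupType).
Local Notation V := (quotgrp (frattini S)).

(** Invariance under the action of Aut(S) on S/Phi(S) given by
    [f (x Phi(S)) = (f x) Phi(S)]. *)
Definition aut_invariant (W : set V) : Prop :=
  forall f : S -> S, is_aut f ->
    forall x, W (coset (frattini S) x) -> W (coset (frattini S) (f x)).

(** [B < A] are invariant and [A/B] is irreducible; the submodules of [A/B] are
    the [U/B] for [U] invariant between [B] and [A]. *)
Definition irreducible_factor (A B : subgroup V) : Prop :=
  [/\ aut_invariant A, aut_invariant B, B `<` A &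
      forall U : subgroup V, closed U -> aut_invariant U -> B `<=` U ->
        U `<=` A -> (U : set V) = B \/ (U : set V) = A].

(** [A/B] has an F_p-basis with [r] elements: the cosets modulo [B] of [b 0],
    ..., [b (r-1)]. *)
Definition factor_dim (A B : subgroup V) (r : nat) : Prop :=
  exists b : 'I_r -> V, (forall i, sgval A (b i)) /\
    forall x, sgval A x ->
      exists! e : {ffun 'I_r -> 'I_p}, sgval B ((\prod_(i < r) b i ^+ e i)^-1 * x).

(** [n] is the maximum rank of the factors of some finite Aut(S)-invariant
    series [1 = W 0 < ... < W k = S/Phi(S)] with irreducible factors. *)
Definition is_c (n : nat) : Prop :=
  exists (k : nat) (W : nat -> subgroup V) (r : nat -> nat),
  [/\ (W 0%N : set V) = [set 1],
      (W k : set V) = setT,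
      (forall i, (i <= k)%N -> closed (W i)),
      (forall i, (i < k)%N -> irreducible_factor (W i.+1) (W i) /\
                              factor_dim (W i.+1) (W i) (r i)) &
      n = (\max_(i < k) r i)%N].

(** By Jordan-Hölder, at most one [n] satisfies [is_c n]; one does if [S] is a
    finitely generated pro-p group. *)
Definition cval : nat := xget 0%N [set n | is_c n].

End CRank.

Definition c_p (R : realType) (p : nat) (G : topGroupType) : \bar R :=
  let S := subgrp (sylow p G) in
  if `[< finitely_generated S >] then ((cval p S)%:R)%:E else d_p R p G.

Definition c_star (R : realType) (G : topGroupType) : \bar R :=
  ereal_sup [set c_p R p G | p in [set p | prime p]].

Definition O_p (p : nat) (G : topGroupType) : subgroup G :=
  generated (\bigcup_(N in [set N : subgroup G |
    [/\ closed N, is_normal N & pro_p p (subgrp N)]]) N).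

Definition fitting (G : topGroupType) : subgroup G :=
  generated (\bigcup_(p in [set p | prime p]) O_p p G).

Definition is_simple (G : topGroupType) : Prop :=
  [set: G] <> [set 1] /\
  forall N : subgroup G, closed N -> is_normal N ->
    (N : set G) = [set 1] \/ (N : set G) = setT.

Definition is_perfect (G : topGroupType) : Prop :=
  generates [set [~ x, y] | x in [set: G] & y in [set: G]].

Definition quasisimple (G : topGroupType) : Prop :=
  is_perfect G /\ is_simple (quotgrp (centre G)).

Definition subnormal (G : topGroupType) (Q : subgroup G) : Prop :=
  exists (n : nat) (K : nat -> subgroup G),
  [/\ (K 0%N : set G) = Q,
      (K n : set G) = setT,
      (forall i, (i <= n)%N -> closed (K i)) &
      (forall i, (i < n)%N -> K i `<=` K i.+1 /\
         forall x y, sgval (K i) x -> sgval (K i.+1) y ->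
           sgval (K i) (x ^ y))].

Definition is_component (G : topGroupType) (Q : subgroup G) : Prop :=
  [/\ closed Q, subnormal Q & quasisimple (subgrp Q)].

Definition layer (G : topGroupType) : subgroup G :=
  generated (\bigcup_(Q in [set Q : subgroup G | is_component Q]) Q).

Definition generalised_fitting (G : topGroupType) : subgroup G :=
  generated (fitting G `|` layer G).

Definition fitting_degenerate (G : topGroupType) : Prop :=
  (generalised_fitting G : set G) = [set 1].

Definition fitting_regular (G : topGroupType) : Prop :=
  forall N : normalSubgroup G, closed N ->
    [set: quotgrp N] <> [set 1] -> ~ fitting_degenerate (quotgrp N).

(* Main.v *)
(* Write [n] for a bound on all [c_p(G)]. By Tate's theorem, for every prime [p]
   there are normal subgroups [A_p <= M_p] of [G], [M_p] open, with [A_p] a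
   pro-p' group and [M_p / A_p] a pro-p group.  Let [K = H / N] be a nontrivial
   quotient, and let [H1] be the intersection of [H] with the [A_p], [p <= n]:
   every finite image of [H1] has order prime to all [p <= n].

   If [H1 <= N], then [K] is virtually pronilpotent; if [[H1, H1] <= N], then
   the image of [H1] in [K] is abelian.  Either way [F*(K)] is nontrivial.
   Otherwise some finite image of [[H1, H1]] contains an element of prime power
   order [q^k] outside the image of [N].  Let [D] be the intersection of [A_q]
   and the [A_r] for the primes [r] dividing the order of [G / M_q].  In a finite
   image, a prime [r] dividing the order of [D] has a Sylow subgroup [S] with
   [N_G(S)] covering [G / A_q].  A group whose order has only prime factors larger
   than [n] acts on a space of dimension at most [n] in characteristic [r], prime
   to its order, through an abelian group; hence [[H1, H1]] lies in [C(S) A_q],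
   and a [q]-element of [C(S) A_q] is conjugate into [C(S)] by an element of the
   [q']-group [A_q].  Letting [S] vary, [q]-elements of [[H1, H1]] centralise [D].
   So [C_H(D)] is not contained in [N]; it is virtually pronilpotent, because
   [G / D] is so and [C_H(D)] centralises [D], and [F*(K)] is nontrivial. *)

From HB Require Import structures.
From mathcomp Require Import all_boot all_order all_algebra.
From mathcomp Require Import all_fingroup all_solvable all_field all_character.

Set Implicit Arguments.
Unset Strict Implicit.
Unset Printing Implicit Defensive.

Import GroupScope.
Local Open Scope group_scope.

(** * Finite groups of order prime to small primes *)

(** The bound concerns the Sylow subgroups of [G]; those of [H] need not even be finitely generated.
    So all structure is built in [G], and [H] enters only through intersections and centralisers.
    The primes up to [n] are removed because of Clifford theory: an abelian normal subgroup whose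
    prime index exceeds the degree of an irreducible representation acts by scalars. This makes only
    the derived subgroup act trivially, whence the separate case of an abelian image of [H1]. [D] is
    chosen so that a prime [r] dividing its order differs from [q] and does not divide the order of
    [G / M_q]. Then [G / A_q] has order prime to [r], so [A_q] contains the Sylow [r]-subgroups of
    [G] and the Frattini argument applies. Virtual pronilpotence suffices for the following reason.
    If the pronilpotent part is nontrivial, one of its Sylow subgroups is a nontrivial normal pro-p
    subgroup. Otherwise the group is finite, and a minimal normal subgroup is elementary abelian or
    contains a simple component. *)

Lemma maximal_normal_prime_index (gT : finGroupType) (T A : {group gT}) :
  maximal A T -> A <| T -> prime #|T : A|.
Proof.
move=> maxA nsAT; have [sAT nAT] := andP nsAT.
have ltAT: A \proper T by apply: maxgroupp maxA.
have [p pr_p pTA] : exists2 p, prime p & p %| #|T / A|.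
  have ntTA : T / A != 1 by rewrite -subG1 quotient_sub1 //; case/andP: ltAT.
  exists (pdiv #|T / A|); last exact: pdiv_dvd.
  by apply: pdiv_prime; rewrite cardG_gt1.
have [x Tx ox] := Cauchy pr_p pTA.
have sxT : <[x]> \subset T / A by rewrite cycle_subG.
have [B defB sAB sBT] := inv_quotientS nsAT sxT.
have [BA|BT] : B :=: A \/ B :=: T.
- case: (eqVproper sBT) => [->|ltBT]; first by right.
  by left; have [_ maxA'] := maxgroupP maxA; apply: maxA'.
- by move: ox pr_p; rewrite /order defB BA trivg_quotient cards1 => <-.
by rewrite -card_quotient // -BT -defB -/(order x) ox.
Qed.

(** * Groups all of whose proper subgroups are abelian *)

Section MinimalNonabelian.

Variables (gT : finGroupType) (T : {group gT}).
Hypothesis abelP : forall H : {group gT}, H \proper T -> abelian H.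
Hypothesis nabT : ~~ abelian T.
Implicit Types M : {group gT}.

Let Z : {group gT} := 'Z(T)%G.

(** Otherwise maximality gives [M <*> Z = T], and the join of the abelian [M] with a central
    subgroup is abelian. *)
Lemma minnonab_center_sub M : maximal M T -> Z \subset M.
Proof.
move=> maxM; have ltMT := maxgroupp maxM; have [sMT _] := andP ltMT.
apply/idPn => nsZM; case/negP: nabT.
have <-: M <*> Z = T.
  have : M \proper (M <*> Z)%G.
    by rewrite properE joing_subl join_subG subxx.
  case: (eqVproper (_ : M <*> Z \subset T)) => [|//|lt ltM].
    by rewrite join_subG sMT center_sub.
  have e := (maxgroupP maxM).2 (M <*> Z)%G lt (joing_subl _ _).
  by move: ltM; rewrite /= e properxx.
have sZC : Z \subset 'C(M) by apply: subset_trans (subsetIr T _) (centS sMT).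
by rewrite abelianY abelP // center_abelian.
Qed.

(** A common element is centralised by both subgroups, which are abelian and, when distinct,
    generate [T]. *)
Lemma minnonab_TI M1 M2 x : maximal M1 T -> maximal M2 T ->
  x \in M1 -> x \in M2 -> x \notin Z -> M1 :=: M2.
Proof.
move=> max1 max2 x1 x2; apply: contraNeq => neM.
have [s1 s2] : M1 \subset T /\ M2 \subset T.
  by split; apply: proper_sub; [apply: maxgroupp max1|apply: maxgroupp max2].
have abM M : maximal M T -> abelian M by move=> mM; apply: abelP; apply: maxgroupp mM.
have defT: M1 <*> M2 = T.
  have s12 : M1 <*> M2 \subset T by rewrite join_subG s1.
  case: (eqVproper s12) => // lt12; case/negP: neM.
  have e1 := (maxgroupP max1).2 (M1 <*> M2)%G lt12 (joing_subl _ _).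
  have e2 := (maxgroupP max2).2 (M1 <*> M2)%G lt12 (joing_subr _ _).
  by rewrite -e1 e2.
rewrite inE (subsetP s1) //= -sub_cent1 -defT join_subG !sub_cent1.
by rewrite (subsetP (abM _ max1)) // (subsetP (abM _ max2)).
Qed.

Lemma minnonab_notZ M : maximal M T -> ~~ (M <| T) -> exists2 x, x \in M & x \notin Z.
Proof.
move=> maxM nnM; apply/subsetPn; apply: contra nnM => sMZ.
have /eqP -> : M :==: Z by rewrite eqEsubset sMZ minnonab_center_sub.
exact: center_normal.
Qed.

Lemma minnonab_maxJ M x : x \in T -> maximal M T -> maximal (M :^ x)%G T.
Proof.
by move=> Tx; rewrite -(maximalJ M T x) (conjGid Tx).
Qed.

(** A maximal subgroup that is not normal is its own normaliser, and conjugates sharing a noncentral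
    element coincide by [minnonab_TI]. The conjugates of [M :\: Z] are thus disjoint and can be
    counted. *)
Lemma minnonab_normedTI M : maximal M T -> ~~ (M <| T) ->
  normedTI (M :\: Z) T M.
Proof.
move=> maxM nnM; have sMT := proper_sub (maxgroupp maxM).
apply/normedTI_memJ_P; split=> //.
  have [x Mx nZx] := minnonab_notZ maxM nnM.
  by apply/set0Pn; exists x; rewrite inE nZx.
have nZ x : x \in T -> x \in 'N(Z) by move=> Tx; apply: (subsetP (normal_norm (center_normal T))).
have NM : 'N_T(M) = M.
  have sMN : M \subset 'N_T(M) by rewrite subsetI sMT normG.
  case: (eqVproper (subsetIl T 'N(M))) => [e|lt].
    by case/negP: nnM; rewrite /normal sMT -{1}e subsetIr.
  exact: (maxgroupP maxM).2 _ lt sMN.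
move=> a x /setDP[Ma nZa] Tx; rewrite in_setD memJ_norm ?nZ // nZa /=.
apply/idP/idP => [Max|Mx]; last by rewrite memJ_norm // (subsetP (normG M)).
rewrite -NM inE Tx /=; apply/normP.
apply: (@minnonab_TI (M :^ x)%G M (a ^ x)) => //.
- exact: minnonab_maxJ.
- by rewrite memJ_conjg.
- by rewrite memJ_norm ?nZ.
Qed.

(* Distinct maximal subgroups meet in the centre, so two classes of
   self-normalising ones would already cover too many elements. *)
Lemma minnonab_normal_maximal : exists2 A : {group gT}, maximal A T & A <| T.
Proof.
case: (boolP [exists A : {group gT}, maximal A T && (A <| T)]).
  by case/existsP=> A /andP[]; exists A.
move/existsPn => nonorm; exfalso.
have nn M : maximal M T -> ~~ (M <| T).
  by move=> maxM; apply: contra (nonorm M) => ->; rewrite maxM.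
have inmax x : x \in T -> exists2 M : {group gT}, maximal M T & x \in M.
  move=> Tx; have sxT : <[x]> \subset T by rewrite cycle_subG.
  case: (@maximal_exists _ <[x]>%G T sxT) => [e|[M maxM sxM]].
    by case/negP: nabT; rewrite -e cycle_abelian.
  by exists M; rewrite -?cycle_subG.
have Z_gt0 : 0 < #|Z| by apply: cardG_gt0.
have sZT : Z \subset T by apply: center_sub.
(* The [#|T : M|] disjoint conjugates of [M :\: Z] have [#|T| - #|Z| * #|T : M|] elements together;
   as [#|M : Z|] is at least 2, this is at least half of [#|T|]. *)
have bound M : maximal M T ->
    [/\ #|class_support (M :\: Z) T| + #|Z| * #|T : M| = #|T|,
        (#|Z| * #|T : M|).*2 <= #|T|, 1 < #|T : M| &
        class_support (M :\: Z) T \subset T :\: Z].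
  move=> maxM; have sMT := proper_sub (maxgroupp maxM).
  have sZM := minnonab_center_sub maxM.
  rewrite (card_support_normedTI (minnonab_normedTI maxM (nn _ maxM))).
  have [x Mx nZx] := minnonab_notZ maxM (nn _ maxM).
  have ltZM : 1 < #|M : Z|.
    by rewrite indexg_gt1; apply: contra nZx => /subsetP/(_ x Mx).
  split.
  - rewrite -mulnDl; have -> : #|M :\: Z| + #|Z| = #|M|.
      by rewrite cardsD (setIidPr sZM) subnK // subset_leq_card.
    exact: Lagrange.
  - by rewrite -(Lagrange sMT) -(Lagrange sZM) -muln2 mulnAC leq_mul2r leq_mul2l ltZM !orbT.
  - by rewrite indexg_gt1; case/andP: (maxgroupp maxM).
  apply/subsetP => _ /imset2P[a y /setDP[Ma nZa] Ty ->].
  rewrite inE (groupJ (subsetP sMT _ Ma) Ty) andbT memJ_norm //.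
  exact: (subsetP (normal_norm (center_normal T))).
have [x0 Tx0] : exists x, x \in T by exists 1; apply: group1.
have [M maxM _] := inmax x0 Tx0.
have [oM hM gM sM] := bound M maxM.
(* Because [#|T : M| > 1], the conjugates of [M] miss a noncentral element; a maximal subgroup
   containing it starts a second class. *)
have [x /setDP[Tx nZx] nMx] : exists2 x, x \in T :\: Z & x \notin class_support (M :\: Z) T.
  apply/subsetPn; apply/negP => /subset_leq_card.
  rewrite cardsD (setIidPr sZT) leqNgt -(ltn_add2r (#|Z| * #|T : M|)) oM => /negP; apply.
  have ltZ : #|Z| < #|Z| * #|T : M| by rewrite -{1}[#|Z|]muln1 ltn_pmul2l.
  by rewrite -{1}(subnK (subset_leq_card sZT)) ltn_add2l.
have [M2 maxM2 M2x] := inmax x Tx.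
have [oM2 hM2 gM2 sM2] := bound M2 maxM2.
have disj : [disjoint class_support (M :\: Z) T & class_support (M2 :\: Z) T].
  rewrite -setI_eq0; apply/eqP/setP => y; rewrite !inE; apply/negP.
  case/andP=> /imset2P[a u /setDP[Ma nZa] Tu ->] /imset2P[b v /setDP[M2b nZb] Tv e].
  case/negP: nMx; apply/imset2P.
  have nZ z : z \in T -> z \in 'N(Z) by move=> Tz; apply: (subsetP (normal_norm (center_normal T))).
  have eM : M :^ u = M2 :^ v.
    apply: (@minnonab_TI (M :^ u)%G (M2 :^ v)%G (a ^ u)).
    - exact: minnonab_maxJ.
    - exact: minnonab_maxJ.
    - by rewrite memJ_conjg.
    - by rewrite e memJ_conjg.
    - by rewrite memJ_norm ?nZ.
  exists (x ^ (v * u^-1)) (u * v^-1).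
  - have nZvu : v * u^-1 \in 'N(Z) by apply: nZ; rewrite groupM ?groupV.
    rewrite in_setD (memJ_norm _ nZvu) nZx /= conjgM -mem_conjgV invgK.
    by rewrite eM memJ_conjg.
  - by rewrite groupM ?groupV.
  - by rewrite -conjgM -mulgA mulKg mulgV conjg1.
(* The two disjoint supports have at least [#|T|] elements together, yet both lie in [T :\: Z]. *)
have := subset_leq_card
  (_ : class_support (M :\: Z) T :|: class_support (M2 :\: Z) T \subset T :\: Z).
rewrite subUset sM sM2 => /(_ isT).
rewrite cardsU (disjoint_setI0 disj) cards0 subn0 cardsD (setIidPr sZT).
rewrite leqNgt => /negP; apply.
have ltT : #|T| - #|Z| < #|T| by rewrite ltn_subrL Z_gt0 cardG_gt0.
apply: (leq_trans ltT).
rewrite -(leq_add2r (#|Z| * #|T : M| + #|Z| * #|T : M2|)) addnACA oM oM2 leq_add2l.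
by rewrite -leq_double doubleD -[#|T|.*2]addnn leq_add.
Qed.

Lemma minnonab_normal_prime_index :
  exists A : {group gT}, [/\ A <| T, abelian A & prime #|T : A|].
Proof.
have [A maxA nsA] := minnonab_normal_maximal.
exists A; split=> //; last exact: maximal_normal_prime_index.
by apply: abelP; apply: maxgroupp maxA.
Qed.

End MinimalNonabelian.

(** * Representations of degree smaller than every prime dividing the order *)

Section AbelianRep.

Local Open Scope ring_scope.
Import GRing.Theory.

Variable (F : closedFieldType).

(** [G] permutes the [A]-components transitively and [A] fixes each of them, so their number divides
    the prime [#|G : A|]; being at most [n], it is 1. Simple modules of an abelian group over a
    closed field are one-dimensional, so the only component is a sum of copies of one character. *)
Lemma Clifford_prime_index_scalar (gT : finGroupType) (G A : {group gT}) (n : nat)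
    (rG : mx_representation F G n) :
  (A <| G)%g -> abelian A -> mx_irreducible rG -> prime #|G : A|%g ->
  (n < #|G : A|%g)%N -> forall a, a \in A -> is_scalar_mx (rG a).
Proof.
move=> nsAG abA irrG prGA ltn a Aa.
have sAG := normal_sub nsAG.
pose rA := subg_repr rG (normal_sub nsAG).
have splitA : group_splitting_field F A by apply: group_closure_closed_field.
pose sA := DecSocleType rA.
have tr := Clifford_atrans irrG sA.
have [W _ defW] := imsetP tr.
have simW := socle_simple W; have [modL nzL _] := simW.
have rankW := Clifford_rank_components irrG W.
have rankW_gt0 : (0 < \rank W)%N by rewrite lt0n mxrank_eq0 nz_socle.
have cardsA : #|[set: sA]| = #|sA| by rewrite cardsT.
have sAC : (A \subset 'C_G[W | Clifford_action sA])%g.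
  have := Clifford_astab sA; rewrite join_subG => /andP[sAC _].
  apply/subsetP=> x Ax; rewrite inE (subsetP sAG) //=.
  by have := subsetP sAC x Ax; apply: subsetP; apply: astabS; rewrite sub1set inE.
have dvsA : (#|sA| %| #|G : A|%g)%N.
  rewrite -cardsA defW card_orbit_in //.
  by rewrite -(Lagrange_index (subsetIl G _) sAC) dvdn_mulr.
have sA_le : (#|sA| <= n)%N by apply: leq_trans (eq_leq rankW); apply: leq_pmulr.
have sA1 : #|sA| = 1%N.
  case/primeP: prGA => _ /(_ _ dvsA) /orP[/eqP//|/eqP e].
  by rewrite e leqNgt ltn in sA_le.
have W1 : (W :=: 1%:M)%MS.
  apply/eqmxP; rewrite -mxrank_leqif_eq ?submx1 // mxrank1.
  by apply/eqP; apply: etrans rankW; rewrite sA1 mul1n.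
have rL : \rank (socle_base W) = 1%N by apply: mxsimple_abelian_linear simW.
have [v nzv defL] : exists2 v : 'rV_n, v != 0 & (socle_base W :=: v)%MS.
  exists (nz_row (socle_base W)); first by rewrite nz_row_eq0.
  apply/eqmxP; rewrite andbC nz_row_sub /= -(mxrank_leqif_sup (nz_row_sub _)).2 rL.
  by rewrite rank_rV nz_row_eq0 nzL.
have [c defc] : exists c, v *m rG a = c *: v.
  have : (v *m rG a <= v)%MS.
    rewrite -(eqmxMr _ defL) -defL.
    by have /mxmoduleP/(_ a Aa) := modL.
  by case/sub_rVP=> c ->; exists c.
(* The eigenvalue of [a] on one simple submodule is its eigenvalue on every isomorphic copy, and
   these copies span the space. *)
apply/is_scalar_mxP; exists c; apply/eqP; rewrite -subr_eq0; apply/eqP.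
suff : (W <= kermx (rG a - c%:M))%MS by rewrite W1 => /sub_kermxP; rewrite mul1mx.
have [I [U isoU defWU]] := component_mx_def simW.
have -> : (W : 'M_n) = component_mx rA (socle_base W) by [].
rewrite defWU; apply/sumsmx_subP => i _.
case: (isoU i) => f _ homf <-.
apply/sub_kermxP; rewrite mulmxBr mul_mx_scalar.
have -> : socle_base W *m f *m rG a = socle_base W *m rG a *m f.
  by have /hom_mxP/(_ a Aa) := homf => ->.
have /submxP[D ->] : (socle_base W <= v)%MS by rewrite defL.
by rewrite -(mulmxA D) defc -scalemxAr -scalemxAl subrr.
Qed.

(** Induction on the order reduces to a faithful representation of a group with abelian proper
    subgroups. If it is nonabelian it has a normal abelian [A] of prime index larger than [n]. On
    each irreducible summand [A] is scalar, so commutators with [A] act trivially; hence [A] is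
    central with cyclic quotient, a contradiction. *)
Lemma der1_sub_rker_small_degree (gT : finGroupType) (G : {group gT}) (n : nat)
    (rG : mx_representation F G n) :
  [pchar F]^'.-group G -> (forall p, prime p -> p %| #|G| -> n < p)%N ->
  (G^`(1) \subset rker rG)%g.
Proof.
have [m] := ubnP #|G|; elim: m => // m IHm in gT G n rG *.
move=> ltG p'G big.
case: (eqVneq (rker rG) 1%g) => [K1|ntK]; last first.
  have nK := rker_norm rG; have nsK := rker_normal rG.
  have ltGK : (#|G / rker rG|%g < #|G|)%N by apply: ltn_quotient ntK (normal_sub nsK).
  have IH : ((G / rker rG)^`(1) \subset rker (kquo_repr rG))%g.
    apply: IHm (leq_trans ltGK ltG) _ _ => [|p pr_p pG]; first exact: quotient_pgroup.
    by apply: big => //; apply: dvdn_trans pG _; apply: dvdn_quotient.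
  rewrite -quotient_sub1 ?(subset_trans (der_sub 1 G)) // quotient_der //.
  by apply: subset_trans IH _; apply: kquo_mx_faithful.
rewrite K1; have abP (H : {group gT}) : H \proper G -> abelian H.
  move=> ltHG; have sHG := proper_sub ltHG.
  have := IHm _ H n (subg_repr rG sHG) (leq_trans (proper_card ltHG) ltG).
  rewrite rker_subg K1 setIg1 => H1; apply/derG1P/trivgP/H1.
    exact: pgroupS sHG p'G.
  by move=> p pr_p pH; apply: big => //; apply: dvdn_trans pH (cardSg sHG).
case: (boolP (abelian G)) => [/derG1P-> // | nabG].
have [A [nsAG abA prGA]] := minnonab_normal_prime_index abP nabG.
have sAG := normal_sub nsAG.
have ltnA : (n < #|G : A|%g)%N by apply: big => //; apply: dvdn_indexg.
case/negP: nabG; apply: (@cyclic_factor_abelian _ A); last first.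
  by apply: prime_cyclic; rewrite card_quotient ?normal_norm.
apply/subsetP=> a Aa; rewrite inE (subsetP sAG) //=; apply/centP=> g Gg.
have Ga := subsetP sAG a Aa; have Gx : [~ a, g] \in G by rewrite groupR.
suff : [~ a, g] \in rker rG by rewrite K1 => /set1P/eqP/commgP.
rewrite inE Gx mul1mx /=.
apply: (mx_reducible_semisimple (mxmodule1 rG) (mx_Maschke_pchar rG p'G)).
case=> I U W simU defW _; rewrite -subr_eq0.
suff : (1%:M <= kermx (rG [~ a, g] - 1%:M))%MS.
  by move=> /sub_kermxP; rewrite mul1mx => ->.
rewrite -defW; apply/sumsmx_subP => i _.
have [modU _ _] := simU i.
have irrU := (submod_mx_irr modU).2 (simU i).
apply/sub_kermxP; rewrite mulmxBr mulmx1.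
suff : [~ a, g] \in rstab rG (U i) by rewrite inE Gx /= => /eqP ->; rewrite subrr.
rewrite -(rker_submod modU) inE Gx mul1mx /=.
have /is_scalar_mxP[c rUa] : is_scalar_mx (submod_repr modU a).
  apply: (Clifford_prime_index_scalar nsAG) => //.
  by apply: leq_ltn_trans ltnA; apply: rank_leq_row.
apply/eqP; apply: (can_inj (mulKmx (repr_mx_unit (submod_repr modU) (groupM Gg Ga)))).
rewrite mulmx1 -(repr_mxM (submod_repr modU) (groupM Gg Ga) Gx).
rewrite -(commgC a g).
by rewrite !repr_mxM // rUa scalar_mxC.
Qed.

End AbelianRep.

(** * Coprime action on sections of small rank *)

Section CoprimeSmallRank.

Variables (p n : nat).
Hypothesis pr_p : prime p.

(** Extending scalars from ['F_p] to its algebraic closure keeps the degree, here the rank of [V],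
    and the kernel, so the result over closed fields applies. *)
Lemma abelem_small_rank_cent (gT : finGroupType) (V T : {group gT}) :
  p.-abelem V -> T \subset 'N(V) -> p^'.-group T -> #|V| <= p ^ n ->
  (forall q, prime q -> q %| #|T| -> n < q) -> T^`(1) \subset 'C(V).
Proof.
move=> abV nVT p'T oV big.
have [-> | ntV] := eqVneq (V : {set gT}) 1; first exact: cents1.
have [K [f _]] := countable_algebraic_closure 'F_p.
pose rT := map_repr f (abelem_repr abV ntV nVT).
have : T^`(1) \subset rker rT.
  apply: der1_sub_rker_small_degree => [|q pr_q qT].
    apply: sub_in_pnat p'T => q _; apply: contra => charq.
    have : q \in [pchar 'F_p]%R by rewrite -(GRing.fmorph_pchar f).
    by rewrite (GRing.pcharf_eq (pchar_Fp pr_p)) inE.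
  apply: leq_ltn_trans (big q pr_q qT).
  rewrite (dim_abelemE abV ntV) -(leq_exp2l _ _ (prime_gt1 pr_p)).
  by rewrite -p_part part_pnat_id //; apply: abelem_pgroup abV.
rewrite rker_map rker_abelem; move/subset_trans; apply; exact: subsetIr.
Qed.

Lemma abelem_factor_small_rank_cent (gT : finGroupType) (V W T : {group gT}) :
  W <| V -> p.-abelem (V / W) -> T \subset 'N(V) -> T \subset 'N(W) ->
  p^'.-group T -> #|V : W| <= p ^ n ->
  (forall q, prime q -> q %| #|T| -> n < q) -> [~: V, T^`(1)] \subset W.
Proof.
move=> nsWV abV nVT nWT p'T oV big.
have [sWV nWV] := andP nsWV.
have nWT' : T^`(1) \subset 'N(W) by apply: subset_trans (der_sub 1 T) nWT.
rewrite -quotient_cents2 // centsC quotient_der //.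
apply: (@abelem_small_rank_cent _ (V / W)%G (T / W)%G) => //.
- exact: quotient_norms.
- exact: quotient_pgroup.
- by rewrite card_quotient.
move=> q pr_q qT; apply: big => //; apply: dvdn_trans qT _; exact: dvdn_quotient.
Qed.

(** In a coprime action, fixed points of a quotient lift to fixed points. So [S] is [W 0 * 'C_S(T)],
    and [W 0] consists of nongenerators. *)
Lemma coprime_series_cent (gT : finGroupType) (S T : {group gT}) (W : nat -> {group gT}) k :
  p.-group S -> p^'.-group T -> T \subset 'N(S) -> W 0 \subset 'Phi(S) -> W k = S ->
  (forall i, i < k -> W i \subset W i.+1) ->
  (forall i, i <= k -> W i <| S) ->
  (forall i, i <= k -> T \subset 'N(W i)) ->
  (forall i, i < k -> [~: W i.+1, T] \subset W i) ->
  T \subset 'C(S).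
Proof.
move=> pS p'T nST W0 Wk sW nsW nW stab.
have solS : solvable S by apply: nilpotent_sol (pgroup_nil pS).
have coST : coprime #|S| #|T| by apply: pnat_coprime pS p'T.
have cov i : i <= k -> W i \subset W 0 * 'C_S(T).
  elim: i => [|i IHi] lti; first exact: mulG_subl.
  have sWS := normal_sub (nsW _ lti).
  have nWW : W i.+1 \subset 'N(W i).
    exact: subset_trans sWS (normal_norm (nsW _ (ltnW lti))).
  have sWWC : W i.+1 \subset W i * 'C_(W i.+1)(T).
    rewrite -quotientSK // coprime_quotient_cent ?(coprimeSg sWS) ?(solvableS sWS) //.
    - by rewrite subsetI subxx /= quotient_cents2 ?stab ?nW ?(ltnW lti).
    - exact: sW.
    - by rewrite nW // ltnW.
  apply: subset_trans sWWC _.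
  have : W i * 'C_(W i.+1)(T) \subset W 0 * 'C_S(T) * 'C_S(T).
    by apply: mulgSS; [apply: IHi (ltnW lti) | apply: setSI].
  by rewrite -mulgA mulGid.
have sSC : S \subset W 0 * 'C_S(T) by rewrite -{1}Wk cov.
have defS : 'C_S(T) = S.
  suff e : <<'C_S(T)>> = S by rewrite -[RHS]e genGid.
  apply: Phi_nongen; apply/eqP; rewrite eqEsubset join_subG Phi_sub subsetIl /=.
  apply: subset_trans sSC _; apply: subset_trans (mulSg _ W0) _.
  by rewrite mul_subG ?joing_subl ?joing_subr.
by rewrite centsC -defS subsetIr.
Qed.

End CoprimeSmallRank.

(** * Tate's theorem *)

Lemma conjg_pair (gT1 gT2 : finGroupType) (a c : gT1) (b d : gT2) :
  (a, b) ^ (c, d) = (a ^ c, b ^ d).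
Proof. by []. Qed.

Lemma mulg_pair (gT1 gT2 : finGroupType) (a c : gT1) (b d : gT2) :
  (a, b) * (c, d) = (a * c, b * d).
Proof. by []. Qed.

Section Tate.

Variables (gT : finGroupType) (M K P : {group gT}) (p : nat).
Hypotheses (pr_p : prime p) (nsKM : K <| M) (sylP : p.-Sylow(M) P) (defM : K * P = M).
Let Q : {group gT} := (K :&: P)%G.
Let L : {group gT} := Q^`(1)%G.

(** The group [E] below is an extension of [M] by the abelian [p]-group [Q / L] that splits over
    [P], hence over [M] by Gaschütz. A complement is the graph of a homomorphism from [M] to [P / L]
    that agrees on [P] with the quotient map up to factors in [Q / L]; [K2] is its kernel. *)
Lemma Tate_descent : Q :!=: 1 -> Q \subset 'Phi(P) ->
  exists2 K2 : {group gT}, K2 <| M & K2 \proper K /\ p.-nat #|M : K2|.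
Proof.
move=> ntQ sQPhi.
have sKM := normal_sub nsKM; have nKM := normal_norm nsKM.
have sPM := pHall_sub sylP; have pP := pHall_pgroup sylP.
have sQP : Q \subset P by apply: subsetIr.
have sQK : Q \subset K by apply: subsetIl.
have pQ := pgroupS sQP pP.
have nsQP : Q <| P by rewrite /normal sQP normsI ?normG // (subset_trans sPM).
have nsLP : L <| P by apply: char_normal_trans (der_char 1 Q) nsQP.
have nLP := normal_norm nsLP.
have sLQ : L \subset Q by apply: der_sub.
have nLQ : Q \subset 'N(L) by apply: der_norm.
have ltLQ : L \proper Q.
  by rewrite (sol_der1_proper (nilpotent_sol (pgroup_nil pQ))).
pose dl x := (x, coset L x) : gT * coset_of L.
have dlM : {in P &, {morph dl : x y / x * y}}.
  by move=> x y Px Py; rewrite /dl morphM ?(subsetP nLP).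
pose dlm := Morphism dlM.
(* [D] is the graph of the quotient map of [P], [K1] is a copy of [K] in the first coordinate, and
   [A] will be the kernel of the projection of [E = D * K1] onto [M]. *)
pose D : {group gT * coset_of L} := (dlm @* P)%G.
pose K1 : {group gT * coset_of L} := (@pairg1 gT (coset_of L) @* K)%G.
pose A : {group gT * coset_of L} := (@pair1g gT (coset_of L) @* (Q / L))%G.
have memD x y : (x, y) \in D = (x \in P) && (y == coset L x).
  apply/morphimP/andP => [[z _ Pz [-> ->]] // | [Px /eqP->]].
  by exists x.
have memK1 x y : (x, y) \in K1 = (x \in K) && (y == 1).
  by rewrite /= morphim_pairg1 inE /= inE.
have memA x y : (x, y) \in A = (x == 1) && (y \in Q / L).
  by rewrite /= morphim_pair1g inE /= inE.
have nsP x y : x \in P -> y \in P -> x ^ y \in P by move=> Px Py; rewrite groupJ.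
have nK1D : D \subset 'N(K1).
  apply/subsetP=> -[x y]; rewrite memD => /andP[Px /eqP->]; rewrite inE.
  apply/subsetP=> _ /imsetP[[k z] K1kz ->].
  move: K1kz; rewrite memK1 => /andP[Kk /eqP->].
  by rewrite conjg_pair memK1 conj1g eqxx andbT memJ_norm // (subsetP nKM) ?(subsetP sPM).
have nAD : D \subset 'N(A).
  apply/subsetP=> -[x y]; rewrite memD => /andP[Px /eqP->]; rewrite inE.
  apply/subsetP=> _ /imsetP[[k z] Akz ->].
  move: Akz; rewrite memA => /andP[/eqP-> Qz].
  rewrite conjg_pair memA conj1g eqxx /= memJ_norm //.
  have nQ : P / L \subset 'N(Q / L) by apply: quotient_norms; apply: normal_norm nsQP.
  by apply: (subsetP nQ); apply: mem_quotient.
pose E := (D <*> K1)%G; have defE : D * K1 = E by rewrite /= norm_joinEl.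
pose PA := (D <*> A)%G; have defPA : D * A = PA by rewrite /= norm_joinEl.
have memE x y : (x, y) \in E -> exists2 z, z \in P & y = coset L z /\ z^-1 * x \in K.
  rewrite -defE => /mulsgP[[z1 z2] [k1 k2]].
  rewrite memD memK1 => /andP[Pz /eqP->] /andP[Kk /eqP->] [-> ->].
  by exists z1 => //; rewrite mulg1 mulKg.
have memE' z k : z \in P -> k \in K -> (z * k, coset L z) \in E.
  move=> Pz Kk; rewrite -defE -[coset L z]mulg1.
  by apply: (@mem_mulg _ _ _ (z, coset L z) (k, 1)); rewrite ?memD ?memK1 ?Pz ?Kk /=.
have sAE : A \subset E.
  apply/subsetP=> -[x y]; rewrite memA => /andP[/eqP-> /morphimP[z nz Qz ->]].
  by rewrite -(mulgV z); apply: memE'; rewrite ?groupV ?(subsetP sQP) ?(subsetP sQK).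
have nAE : E \subset 'N(A).
  rewrite -defE mul_subG //; apply: cents_norm.
  apply/centsP=> -[k1 k2] + [a1 a2]; rewrite memK1 memA => /andP[_ /eqP->] /andP[/eqP-> _].
  by rewrite /commute !mulg_pair !mul1g !mulg1.
have nsAE : A <| E by rewrite /normal sAE.
have abA : abelian A by rewrite morphim_abelian // sub_der1_abelian.
have sPAE : PA \subset E by rewrite join_subG joing_subl.
have tiDA : D :&: A = 1.
  apply/trivgP/subsetP=> -[x y]; rewrite inE memD memA.
  by case/andP=> /andP[_ /eqP->] /andP[/eqP-> _]; rewrite morph1 inE.
have oD : #|D| = #|P|.
  by apply: card_injm => //; apply/injmP => x y _ _ [].
have oA : #|A| = #|Q : L|.
  by rewrite (card_injm (injm_pair1g _ _)) ?subsetT // card_quotient.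
have oK1 : #|K1| = #|K| by rewrite (card_injm (injm_pairg1 _ _)) ?subsetT.
have oDK1 : #|D :&: K1| = #|L|.
  have -> : D :&: K1 = @pairg1 gT (coset_of L) @* L.
    apply/setP=> -[x y]; rewrite inE memD memK1 morphim_pairg1 inE /= inE.
    apply/idP/idP => [/andP[/andP[Px /eqP->] /andP[Kx /eqP e]]|/andP[Lx /eqP->]].
      by rewrite e eqxx andbT; apply: coset_idr e; apply: (subsetP nLP).
    have Qx := subsetP sLQ x Lx.
    by rewrite (subsetP sQP) // (subsetP sQK) // coset_id // !eqxx.
  by rewrite (card_injm (injm_pairg1 _ _)) ?subsetT.
have oE : (#|E| * #|L| = #|P| * #|K|)%N by rewrite -defE -oDK1 -mul_cardG oD oK1.
have oPA : #|PA| = (#|P| * #|Q : L|)%N by rewrite -defPA TI_cardMg // oD oA.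
have iE : #|E : PA| = #|K : Q|.
  apply/eqP; rewrite -(eqn_pmul2l (cardG_gt0 Q)) Lagrange //.
  rewrite -(eqn_pmul2l (cardG_gt0 P)) -oE -(Lagrange sPAE) oPA -(Lagrange sLQ).
  apply/eqP; rewrite -!mulnA; congr (_ * _)%N; rewrite mulnC -!mulnA.
  by congr (_ * _)%N; rewrite mulnC.
have sylQ : p.-Sylow(K) Q by apply: Sylow_setI_normal sylP.
have co : coprime #|A| #|E : PA|.
  rewrite iE; apply: (@pnat_coprime p).
    by rewrite oA; apply: pnat_dvd pQ; apply: dvdn_indexg.
  by case/and3P: sylQ.
(* [D] complements [A] in [PA], and the index of [PA] in [E] is prime to [p]. *)
have spl : [splits E, over A].
  rewrite (Gaschutz_split nsAE (joing_subr _ _) sPAE abA co).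
  apply/splitsP; exists D; apply/complP; split; first by rewrite setIC.
  by rewrite -defPA (normC nAD).
have [C /complP[tiAC defC]] := splitsP spl.
have sCE : C \subset E by rewrite -defC mulG_subr.
have fstE : @fst gT (coset_of L) @* E = M.
  apply/setP=> x; apply/morphimP/idP => [[[u v] _ /memE[z Pz [_ Kzu]] ->]|Mx] /=.
    by rewrite -(mulKVg z u); apply: groupM; [apply: (subsetP sPM) | apply: (subsetP sKM)].
  have : x \in P * K by rewrite (normC (subset_trans sPM nKM)) defM.
  by case/mulsgP=> z k Pz Kk ->; exists (z * k, coset L z); rewrite ?memE' ?inE.
have fstA : @fst gT (coset_of L) @* A = 1.
  apply/trivgP/subsetP => x /morphimP[[u v] _]; rewrite memA => /andP[/eqP-> _] ->.
  by rewrite /= inE.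
have fstC : @fst gT (coset_of L) @* C = M.
  by rewrite -fstE -defC morphimMl ?subsetT // fstA mul1g.
pose C0 := ('ker_C (@snd gT (coset_of L)))%G.
have memC0 x y : (x, y) \in C0 = ((x, y) \in C) && (y == 1).
  by rewrite inE; congr (_ && _); rewrite !inE.
have nsC0 : C0 <| C by apply: normalGI (subsetT _) (ker_normal _).
pose K2 := (@fst gT (coset_of L) @* C0)%G.
have nsK2 : K2 <| M by rewrite -fstC; apply: morphim_normal.
have memK2 x : (x \in K2) = ((x, 1) \in C).
  apply/morphimP/idP => [[[u v] _]|Cx1].
    by rewrite memC0 => /andP[Cuv /eqP e] /= ->; rewrite -e.
  by exists (x, 1); rewrite ?memC0 ?Cx1 ?eqxx ?inE.
have sK2K : K2 \subset K.
  apply/subsetP=> x; rewrite memK2 => /(subsetP sCE)/memE[z Pz [/esym e Kzx]].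
  have Lz : z \in L by apply: coset_idr e; apply: (subsetP nLP).
  by rewrite -(mulKVg z x) groupM // (subsetP sQK) // (subsetP sLQ).
have idx : p.-nat #|M : K2|.
  have sndC : @snd gT (coset_of L) @* C \subset P / L.
    apply/subsetP=> _ /morphimP[[u v] _ /(subsetP sCE)/memE[z Pz [-> _]] ->] /=.
    exact: mem_quotient.
  apply: pnat_dvd (quotient_pgroup _ pP); apply: dvdn_trans (cardSg sndC).
  rewrite card_morphim setTI -(indexgI C) -fstC.
  by apply: index_morphim; apply: subsetT.
exists K2 => //; split=> //.
(* If [K2 = K], the image [B] of the homomorphism meets [Q / L] trivially. But [P] is generated by
   [Q] and the part of [P] over [B], and [Q] consists of nongenerators, so [B] contains [Q / L].
   Then [Q = L], impossible for a nontrivial [p]-group. *)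
rewrite properEneq sK2K andbT; apply/eqP => eK2.
pose B := (@snd gT (coset_of L) @* C)%G.
have tiBQ : B :&: (Q / L) = 1.
  apply/trivgP/subsetP=> y /setIP[/morphimP[[x z] _ Cxz /= ->] Qz].
  have /memE[w Pw [ez Kwx]] := subsetP sCE _ Cxz.
  have Qw : w \in Q.
    rewrite -(quotientGK (_ : L <| Q)) ?(normalS sLQ sQP) // inE (subsetP nLP) //=.
    by rewrite inE -ez.
  have Kx : x \in K by rewrite -(mulKVg w x) groupM // (subsetP sQK).
  have Cx1 : (x, 1) \in C by rewrite -memK2 eK2.
  have C1z : (1, z) \in C.
    have -> : (1, z) = (x, 1)^-1 * (x, z) :> gT * coset_of L.
      by apply: (mulgI (x, 1)); rewrite mulKVg mulg_pair mulg1 mul1g.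
    by rewrite groupM ?groupV.
  have : (1, z) \in A :&: C by rewrite inE C1z memA eqxx Qz.
  by rewrite tiAC inE => /eqP[->]; rewrite inE.
have sBP : B \subset P / L.
  apply/subsetP=> _ /morphimP[[u v] _ /(subsetP sCE)/memE[z Pz [-> _]] ->] /=.
  exact: mem_quotient.
have sPQB : P \subset Q * (P :&: (coset L @*^-1 B)).
  apply/subsetP=> x Px; have := memE' x 1 Px (group1 K).
  rewrite mulg1 -defC => /mulsgP[[a1 a2] [c1 c2]].
  rewrite memA => /andP[/eqP-> /morphimP[q nq Qq ->]] Cc [_ e].
  apply/mulsgP; exists q (q^-1 * x) => //; last by rewrite mulKVg.
  have Pq := subsetP sQP q Qq.
  apply/setIP; split; first by rewrite groupM ?groupV.
  apply/morphpreP; split; first by rewrite groupM ?groupV ?(subsetP nLP).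
  rewrite morphM ?morphV ?groupV ?(subsetP nLP) //= e mulKg.
  by apply/morphimP; exists (c1, c2).
have defB : P :&: (coset L @*^-1 B) = P.
  suff e : <<P :&: (coset L @*^-1 B)>> = P by rewrite -[RHS]e genGid.
  apply: Phi_nongen; apply/eqP; rewrite eqEsubset join_subG Phi_sub subsetIl /=.
  apply: subset_trans sPQB _; apply: subset_trans (mulSg _ sQPhi) _.
  by rewrite mul_subG ?joing_subl ?joing_subr.
case/negP: (proper_subn ltLQ); apply/subsetP => q Qq.
have nq := subsetP nLQ q Qq; apply: coset_idr => //; apply/set1P.
rewrite -[[set 1]]tiBQ inE mem_quotient // andbT.
have : q \in P :&: (coset L @*^-1 B) by rewrite defB (subsetP sQP).
by case/setIP=> _ /morphpreP[].
Qed.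

End Tate.

(* Tate's theorem; the transfer argument is replaced by Gaschütz' splitting
   theorem. *)
Lemma Sylow_Phi_pnilpotent (gT : finGroupType) (G N P : {group gT}) p :
  prime p -> p.-Sylow(G) P -> N <| G -> N :&: P \subset 'Phi(P) ->
  p^'.-Hall(N) 'O_p^'(N).
Proof.
move=> pr_p sylP nsNG sNPhi.
have sPG := pHall_sub sylP; have [sNG nNG] := andP nsNG.
have nNP := subset_trans sPG nNG.
pose M := (N <*> P)%G; have defM : N * P = M by rewrite /= norm_joinEr.
have sMG : M \subset G by rewrite join_subG sNG.
have sylM : p.-Sylow(M) P := pHall_subl (joing_subr _ _) sMG sylP.
(* A minimal such [K] is a [p']-group: if it met [P] nontrivially, [Tate_descent] would give a
   smaller one. *)
pose good (K : {group gT}) := [&& K \subset N, K <| M & p.-nat #|N : K|].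
have [K minK] : {K : {group gT} | mingroup K good}.
  apply: ex_mingroup; exists N; rewrite /good subxx indexgg /= andbT.
  by rewrite /normal joing_subl join_subG normG nNP.
have [/and3P[sKN nsKM pNK] minK'] := mingroupP minK.
have nsKN : K <| N := normalS sKN (joing_subl _ _) nsKM.
have pMN : p.-nat #|M : N|.
  rewrite -defM indexMg; apply: pnat_dvd (dvdn_indexg _ _) _; exact: pHall_pgroup sylP.
have sKM := normal_sub nsKM; have nKM := normal_norm nsKM.
have pMK : p.-nat #|M : K|.
  by rewrite -(Lagrange_index (joing_subl N P) sKN) pnatM pMN.
have defKP : K * P = M.
  apply/eqP; rewrite eqEsubset mul_subG ?joing_subr //=.
  rewrite -(quotientSK _ nKM) (pHall_id (quotient_pHall _ sylM)) //.
    by apply: subset_trans nKM; apply: joing_subr.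
  by rewrite /pgroup card_quotient.
have sylQ : p.-Sylow(K) (K :&: P) := Sylow_setI_normal nsKM sylM.
have [Q1 | ntQ] := eqVneq (K :&: P) 1.
  have hallK : p^'.-Hall(N) K.
    rewrite pHallE sKN -(Lagrange sKN).
    rewrite partnM ?cardG_gt0 // (part_pnat_id (_ : p^'.-nat #|K|)); last first.
      by case/and3P: sylQ; rewrite Q1 indexg1.
    by rewrite part_p'nat ?muln1 ?eqxx // pnatNK.
  by rewrite (normal_Hall_pcore hallK nsKN).
have sQPhi : K :&: P \subset 'Phi(P) := subset_trans (setSI P sKN) sNPhi.
have [K2 nsK2M [ltK2 pK2]] := Tate_descent nsKM sylM defKP ntQ sQPhi.
have sK2K := proper_sub ltK2.
case/negP: (proper_subn ltK2); rewrite (minK' K2) // /good nsK2M (subset_trans sK2K) //.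
by move: pK2; rewrite -(Lagrange_index (joing_subl N P) (subset_trans sK2K sKN)) pnatM => /andP[].
Qed.

(** * Centralisers of Sylow subgroups *)

(** Take [T] minimal. If [p] divides [#|T|] but not [#|X / Y|], a Sylow [p]-subgroup of [T] lies in
    [Y]. By the Frattini argument its normaliser still supplements [Y], so it is normal in [T]; its
    Schur-Zassenhaus complement also supplements [Y], so it is trivial. *)
Lemma min_supplement (gT : finGroupType) (X Y : {group gT}) : Y <| X ->
  exists T : {group gT}, [/\ T \subset X, T * Y = X & {subset \pi(T) <= \pi(X / Y)}].
Proof.
move=> nsYX; have [sYX nYX] := andP nsYX.
pose good (T : {group gT}) := (T \subset X) && (T * Y == X :> {set gT}).
have [T minT] : {T : {group gT} | mingroup T good}.
  by apply: ex_mingroup; exists X; rewrite /good subxx mulGSid /=.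
have [/andP[sTX /eqP defX] minT'] := mingroupP minT.
exists T; split=> // p pT; apply/idPn => npXY.
have pr_p : prime p by move: pT; rewrite mem_primes => /andP[].
pose U := (T :&: Y)%G.
have nsUT : U <| T := normalGI sTX nsYX.
have [P sylP] := Sylow_exists p T.
have sPT := pHall_sub sylP.
have sPU : P \subset U.
  have iTU : #|T : U| = #|X / Y|.
    rewrite -defX quotientMidr -card_quotient ?(normal_norm nsUT) //.
    by rewrite /= setIC (card_isog (second_isog (subset_trans sTX nYX))).
  rewrite -quotient_sub1 ?(subset_trans sPT (normal_norm nsUT)) // subG1 trivg_card1.
  have pPU := quotient_pgroup U (pHall_pgroup sylP).
  rewrite -(part_pnat_id pPU); apply/eqP/part_p'nat.
  rewrite p'natE //; apply: contra npXY => pPU'.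
  rewrite /= mem_primes pr_p cardG_gt0 /= -iTU -card_quotient ?(normal_norm nsUT) //.
  by apply: dvdn_trans pPU' _; apply: cardSg; apply: quotientS.
have sPY : P \subset Y := subset_trans sPU (subsetIr T Y).
have sylPU : p.-Sylow(U) P := pHall_subl sPU (subsetIl T Y) sylP.
have shrink (T2 : {group gT}) : T2 \subset T -> T \subset T2 * Y -> T2 :=: T.
  move=> sT2 sTY; apply: minT' => //; rewrite /good (subset_trans sT2) //=.
  rewrite eqEsubset mul_subG ?(subset_trans sT2) //= -defX.
  have : T * Y \subset T2 * Y * Y by apply: mulSg.
  by rewrite -mulgA mulGid.
have defN : 'N_T(P) = T.
  apply: (shrink 'N_T(P)%G); first exact: subsetIl.
  have nT : 'N_T(P) \subset 'N(U) by rewrite subIset // normal_norm.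
  rewrite -{1}(Frattini_arg nsUT sylPU) -(normC nT).
  by apply: mulgS; apply: subsetIr.
have nsPT : P <| T by rewrite /normal sPT -defN subsetIr.
have /splitsP[T1 /complP[tiPT1 defT]] := SchurZassenhaus_split (pHall_Hall sylP) nsPT.
have sT1T : T1 \subset T by rewrite -defT mulG_subr.
have eT1 : T1 :=: T.
  apply: shrink => //; rewrite -{1}defT.
  by rewrite -(normC (subset_trans sT1T (normal_norm nsPT))); apply: mulgS.
have P1 : P :=: 1 by rewrite -tiPT1 eT1 (setIidPl sPT).
by move: pT; rewrite /= -p_part_gt1 -(card_Hall sylP) P1 cards1.
Qed.

(** As [S] lies in [A], the Frattini argument gives [G = A * 'N_G(S)], so modulo [A] the group [T]
    equals a subgroup of ['N_G(S)]. Chosen by [min_supplement], that subgroup involves only primes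
    dividing [#|T|] and not [r]. Its derived subgroup centralises each factor of the series, hence
    [S]. *)
Lemma der1_sub_cent_mul (gT : finGroupType) (G A S T : {group gT}) (W : nat -> {group gT})
    (r n k : nat) :
  prime r -> A <| G -> r^'.-nat #|G : A| -> r.-Sylow(G) S -> T \subset G ->
  (forall q, prime q -> q %| #|T| -> n < q) ->
  W 0 \subset 'Phi(S) -> W k = S ->
  (forall i, i < k -> W i \subset W i.+1) ->
  (forall i, i < k -> #|W i.+1 : W i| <= r ^ n) ->
  (forall i, i <= k -> 'N_G(S) \subset 'N(W i)) ->
  T^`(1) \subset 'C_G(S) * A.
Proof.
move=> pr_r nsAG r'GA sylS sTG big W0 Wk sW iW nW.
have [sAG nAG] := andP nsAG; have [sSG rS _] := and3P sylS.
have nAT := subset_trans sTG nAG.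
have sSA : S \subset A.
  have nAS := subset_trans sSG nAG.
  rewrite -quotient_sub1 // subG1 trivg_card1.
  have rSA := quotient_pgroup A rS.
  rewrite -(part_pnat_id rSA); apply/eqP/part_p'nat.
  apply: pnat_dvd r'GA; rewrite -card_quotient //; apply: cardSg; exact: quotientS.
have sylSA : r.-Sylow(A) S := pHall_subl sSA sAG sylS.
have defG := Frattini_arg nsAG sylSA.
pose AT := (A <*> T)%G; have defAT : A * T = AT by rewrite /= norm_joinEr.
have sATG : AT \subset G by rewrite join_subG sAG.
pose X := ('N_G(S) :&: AT)%G; pose Y := (X :&: A)%G.
have nAX : X \subset 'N(A) by rewrite (subset_trans _ nAG) // subIset ?subsetIl.
have nsYX : Y <| X := norm_normalI nAX.
have defAX : A * X = AT.
  by rewrite /= group_modl ?joing_subl // defG (setIidPr sATG).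
have cardXY : #|X / Y| = #|T / A|.
  have <- : X / A = T / A by rewrite -[LHS]quotientMidl defAX -defAT quotientMidl.
  by rewrite -(card_isog (second_isog nAX)) setIC.
have [T1 [sT1X defX piT1]] := min_supplement nsYX.
have sT1N : T1 \subset 'N_G(S) := subset_trans sT1X (subsetIl _ _).
have sT1G : T1 \subset G := subset_trans sT1N (subsetIl _ _).
have bigT1 q : prime q -> q %| #|T1| -> n < q.
  move=> pr_q qT1; apply: big => //.
  have : q \in \pi(T1) by rewrite /= mem_primes pr_q cardG_gt0.
  move/piT1; rewrite /= cardXY mem_primes => /and3P[_ _] qTA.
  exact: dvdn_trans qTA (dvdn_quotient _ _).
have r'T1 : r^'.-group T1.
  apply/pgroupP => q pr_q qT1; apply/negP => /eqP e; rewrite {q}e in pr_q qT1.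
  have : r \in \pi(T1) by rewrite /= mem_primes pr_r cardG_gt0.
  move/piT1; rewrite /= cardXY mem_primes => /and3P[_ _] qTA.
  have rGA : r %| #|G : A|.
    rewrite -card_quotient //; apply: dvdn_trans qTA _; apply: cardSg; exact: quotientS.
  by move: r'GA; rewrite p'natE // rGA.
(* Joining with ['Phi(S)] makes the terms normal in [S] with elementary abelian quotients, and does
   not enlarge the factors. *)
pose V i := (W i <*> 'Phi(S))%G.
have sWS i : i <= k -> W i \subset S.
  move=> lik; rewrite -Wk; move: (subnKC lik); move: (k - i)%N => d.
  elim: d i {lik} => [|d IHd] i ed; first by rewrite -ed addn0.
  have lik : i < k by rewrite -ed addnS ltnS leq_addr.
  by apply: subset_trans (sW i lik) _; apply: IHd; rewrite addSnnS.
have sVS i : i <= k -> V i \subset S by move=> lik; rewrite join_subG sWS // Phi_sub.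
have abV i : i <= k -> S \subset 'N(V i).
  move=> lik; apply: sub_der1_norm (sVS i lik).
  apply: subset_trans (joing_subr _ _).
  by rewrite (Phi_joing rS) joing_subl.
have nVS i : i <= k -> V i <| S.
  by move=> lik; rewrite /normal sVS // abV.
have elV i : i <= k -> r.-abelem (S / V i).
  move=> lik; rewrite -trivg_Phi ?quotient_pgroup // -(quotient_Phi rS) ?normal_norm ?nVS //.
  by rewrite quotientS1 // joing_subr.
have T1N : T1 \subset 'N(S) := subset_trans sT1N (subsetIr _ _).
have nVT i : i <= k -> T1 \subset 'N(V i).
  move=> lik; apply: normsY; first exact: subset_trans sT1N (nW i lik).
  exact: char_norm_trans (Phi_char S) T1N.
have step i : i < k -> [~: V i.+1, T1^`(1)] \subset V i.
  move=> lik; have lik' := ltnW lik.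
  have sVV : V i \subset V i.+1 by apply: genS; apply: setSU; apply: sW.
  apply: (abelem_factor_small_rank_cent (p := r) (n := n)) => //.
  - exact: normalS sVV (sVS _ lik) (nVS _ lik').
  - exact: abelemS (quotientS _ (sVS _ lik)) (elV _ lik').
  - exact: nVT.
  - exact: nVT.
  have nVW : W i.+1 \subset 'N(V i) := subset_trans (sWS _ lik) (normal_norm (nVS _ lik')).
  have -> : V i.+1 = (V i <*> W i.+1)%G.
    by apply/val_inj; rewrite /= [RHS]joingC joingA (joing_idPl (sW i lik)).
  rewrite [(V i <*> W i.+1)%G : {set _}]norm_joinEr // indexMg.
  apply: leq_trans (iW i lik); apply: dvdn_leq; first exact: indexg_gt0.
  by rewrite indexgS // joing_subl.
have cT1 : T1^`(1) \subset 'C(S).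
  have sT1' := der_sub 1 T1.
  apply: (coprime_series_cent (p := r) (W := V) (k := k)) => //.
  - exact: pgroupS sT1' r'T1.
  - exact: subset_trans sT1' T1N.
  - by rewrite /= (joing_idPr W0).
  - by apply/val_inj; rewrite /= Wk (joing_idPl (Phi_sub S)).
  - by move=> i lik; apply: genS; apply: setSU; apply: sW.
  - by move=> i lik; apply: subset_trans sT1' (nVT _ lik).
have nAT1 := subset_trans sT1G nAG.
have eTT1 : T / A = T1 / A.
  rewrite -[LHS]quotientMidl defAT -defAX -[RHS]quotientMidl.
  rewrite -defX (normC (_ : T1 \subset 'N(Y))) ?mulgA; last first.
    by apply: subset_trans (normal_norm nsYX).
  by rewrite (mulGSid (subsetIr X A)).
have sT'G : T^`(1) \subset G := subset_trans (der_sub 1 T) sTG.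
rewrite (normC (_ : 'C_G(S) \subset 'N(A))); last by rewrite subIset // nAG.
rewrite -quotientSK ?(subset_trans sT'G) // quotient_der // eTT1 -quotient_der //.
by apply: quotientS; rewrite subsetI cT1 (subset_trans (der_sub 1 T1)).
Qed.

(* Each Sylow subgroup of [D] has a conjugate centralised by [y]: conjugate a
   Sylow [q]-subgroup of ['C_G(S) * A] containing [y] by an element of the
   [q']-group [A]. *)
Lemma pelt_cent_of_Sylow_cents (gT : finGroupType) (G A D : {group gT}) (q : nat) y :
  prime q -> A <| G -> q^'.-group A -> D <| G -> y \in G -> q.-elt y ->
  (forall r, prime r -> r %| #|D| ->
     exists2 S : {group gT}, r.-Sylow(G) S & y \in 'C_G(S) * A) ->
  y \in 'C(D).
Proof.
move=> pr_q nsAG q'A nsDG Gy qy cy.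
suff : D \subset 'C[y] by rewrite sub_cent1.
suff /(dvdn_leq (cardG_gt0 _)) le : #|D| %| #|'C_D[y]|.
  have /eqP <- : 'C_D[y] == D :> {set gT} by rewrite eqEcard subsetIl.
  exact: subsetIr.
(* It suffices that the [r]-part of [#|D|] divides [#|'C_D[y]|] for each prime [r]. *)
apply/(dvdn_partP _ (cardG_gt0 D)) => r; rewrite mem_primes => /and3P[pr_r _ rD].
have [S sylS yCA] := cy r pr_r rD.
pose B := ('C_G(S) <*> A)%G.
have nAG := normal_norm nsAG; have sAG := normal_sub nsAG.
have defB : 'C_G(S) * A = B by rewrite /= norm_joinEl // subIset // nAG.
have sBG : B \subset G by rewrite join_subG subsetIl.
have [Q sylQ] := Sylow_exists q 'C_G(S).
(* The index of ['C_G(S)] in [B] divides the order of the [q']-group [A]. *)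
have sylQB : q.-Sylow(B) Q.
  have sCB : 'C_G(S) \subset B := joing_subl _ _.
  rewrite pHallE (subset_trans (pHall_sub sylQ)) //= (card_Hall sylQ).
  rewrite -(Lagrange sCB) partnM ?cardG_gt0 // (part_p'nat (n := #|B : _|)) ?muln1 ?eqxx //.
  have -> : #|B : 'C_G(S)| = #|A : 'C_G(S)|.
    apply/eqP; rewrite -(eqn_pmul2l (cardG_gt0 'C_G(S))) Lagrange // -defB.
    by rewrite LagrangeMl.
  exact: pnat_dvd (dvdn_indexg _ _) q'A.
have By : <[y]> \subset B by rewrite cycle_subG -defB.
have [b Bb] : exists2 b, b \in B & <[y]> \subset Q :^ b := Sylow_subJ sylQB By qy.
rewrite cycle_subG mem_conjg => Qyb.
have cyb : y \in 'C(S :^ b).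
  have := subsetP (pHall_sub sylQ) _ Qyb; rewrite inE => /andP[_].
  by rewrite -mem_conjg -centJ.
have sylSb : r.-Sylow(G) (S :^ b) by rewrite pHallJ // (subsetP sBG).
have sylD : r.-Sylow(D) (D :&: S :^ b)%G by apply: Sylow_setI_normal nsDG sylSb.
rewrite -(card_Hall sylD); apply: cardSg; apply: setIS.
by rewrite sub_cent1.
Qed.

(** [M] is characteristically simple, hence a direct product of automorphic images [f @: H] of a
    simple subgroup. Such an image is normal as a direct factor, and undoing [f] makes [H] normal.
    If [H] were abelian, the Fitting subgroup of [M] would be nontrivial and hence equal to [M]. *)
Lemma minnormal_simple_normal (gT : finGroupType) (M G : {group gT}) :
  minnormal M G -> ~~ solvable M ->
  exists H : {group gT}, [/\ H <| M, simple H & ~~ abelian H].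
Proof.
move=> minM nsolM; have [H [sHM simH [I sIM defM]]] :=
  charsimple_dprod (minnormal_charsimple minM).
have [f If] : exists f, f \in I.
  apply/set0Pn; apply: contra nsolM => /eqP I0.
  by move: defM; rewrite I0 big_set0 => <-; apply: solvable1.
have Af := subsetP sIM f If.
have fM := Aut_morphic Af.
have sfHM : f @: H <| M.
  by move: defM; rewrite (bigD1 f) //= => /dprod_normal2[].
have nsHM : H <| M.
  apply/andP; split=> //; apply/subsetP => x Mx; rewrite inE.
  apply/subsetP => _ /imsetP[h Hh ->].
  have Mh := subsetP sHM h Hh.
  have := subsetP (normal_norm sfHM) (f x); rewrite Aut_closed // => /(_ isT).
  rewrite inE => /subsetP/(_ (f h ^ f x)); rewrite memJ_conjg imset_f // => /(_ isT).
  by rewrite -(morphJ (morphm fM)) // => /imsetP[h' Hh' /perm_inj ->].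
exists H; split=> //; apply: contra nsolM => abH.
have [ntH _] := simpleP _ simH.
have [_ cM] := charsimpleP _ (minnormal_charsimple minM).
have sHF : H \subset 'F(M) := Fitting_max nsHM (abelian_nil abH).
rewrite -(cM 'F(M)%G) ?Fitting_char ?(nilpotent_sol (Fitting_nil _)) //.
by apply: contra ntH; rewrite -!subG1; apply: subset_trans.
Qed.

Lemma nilpotent_lcn_sub (gT : finGroupType) (Y A : {group gT}) :
  Y \subset 'N(A) -> nilpotent (Y / A) -> exists k, 'L_k.+1(Y) \subset A.
Proof.
move=> nAY /lcnP[k Lk]; exists k.
have sL : 'L_k.+1(Y) \subset 'N(A) := subset_trans (lcn_sub _ _) nAY.
by rewrite -quotient_sub1 // -Lk /quotient morphim_lcn.
Qed.

(** Stated through a lower central term so that such inclusions for several primes combine by taking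
    the largest index. *)
Lemma pgroup_lcn_sub (gT : finGroupType) (p : nat) (Y M A : {group gT}) :
  Y \subset M -> M \subset 'N(A) -> A \subset M -> p.-nat #|M : A| ->
  exists k, 'L_k.+1(Y) \subset A.
Proof.
move=> sYM nAM sAM pMA; apply: nilpotent_lcn_sub; first exact: subset_trans nAM.
apply: (@pgroup_nil _ p); apply: pgroupS (quotientS A sYM) _.
by rewrite /pgroup card_quotient.
Qed.

Require Import Defs.
From mathcomp Require Import all_classical all_reals all_analysis.

Local Open Scope classical_set_scope.
Local Open Scope group_scope.

(** * Finite images of profinite groups *)

Lemma mulgl_continuous (G : topGroupType) (y : G) : continuous (fun x : G => y * x).
Proof.
move=> x.
apply: (@continuous_comp _ _ _ (fun x : G => (y, x)) (fun z => z.1 * z.2)).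
  by apply: cvg_pair => /=; [exact: cvg_cst|exact: cvg_id].
exact: mulg_continuous.
Qed.

(* Continuous homomorphisms to a discrete finite group. *)
Record fhom (G : topGroupType) (F : finGroupType) := FHom {
  fh :> G -> F;
  fhM : {morph fh : x y / x * y};
  fh_open : open [set x | fh x = 1]
}.

Section FHomTheory.
Variables (G : topGroupType) (F : finGroupType) (f : fhom G F).

Lemma fh1 : f 1 = 1.
Proof. by apply: (mulgI (f 1)); rewrite -fhM !mulg1. Qed.

Lemma fhV x : f x^-1 = (f x)^-1.
Proof. by apply: (mulgI (f x)); rewrite -fhM !mulgV fh1. Qed.

Lemma fhJ x y : f (x ^ y) = f x ^ f y.
Proof. by rewrite !conjgE !fhM fhV. Qed.

Lemma fhR x y : f [~ x, y] = [~ f x, f y].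
Proof. by rewrite !commgEl fhM fhV fhJ. Qed.

Lemma fh_pre_open (B : set F) : open (f @^-1` B).
Proof.
rewrite openE => x Bx; rewrite /interior.
have : nbhs x ((fun y => x^-1 * y) @^-1` [set y | f y = 1]).
  apply: open_nbhs_nbhs; split; last by rewrite /preimage /= mulVg fh1.
  by apply: open_comp; [move=> y _; apply: mulgl_continuous|apply: fh_open].
apply: filterS => y /=; rewrite fhM fhV => e.
by have -> : f y = f x by apply: (mulgI (f x)^-1); rewrite e mulVg.
Qed.

Lemma fh_pre_closed (B : set F) : closed (f @^-1` B).
Proof. by rewrite -[_ @^-1` B]setCK; apply: open_closedC; exact: (fh_pre_open (~` B)). Qed.

End FHomTheory.
Arguments fh_pre_closed {G F} f B _ _.

Section Image.
Variables (G : groupType) (F : finGroupType) (f : G -> F).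

Definition imf (X : set G) : {set F} :=
  [set y | `[< exists2 x, X x & f x = y >]]%SET.

Lemma imfP (X : set G) y : reflect (exists2 x, X x & f x = y) (y \in imf X).
Proof. by rewrite inE; apply: asboolP. Qed.

Lemma mem_imf (X : set G) x : X x -> f x \in imf X.
Proof. by move=> Xx; apply/imfP; exists x. Qed.

Lemma imfS (X Y : set G) : X `<=` Y -> imf X \subset imf Y.
Proof. by move=> sXY; apply/fintype.subsetP => _ /imfP[x /sXY Yx <-]; apply: mem_imf. Qed.

End Image.

Lemma imf_group_set (G : topGroupType) (F : finGroupType) (f : fhom G F) (X : subgroup G) :
  group_set (imf f X).
Proof.
apply/group_setP; split; first by rewrite -(fh1 f); apply: mem_imf; apply: sg1.
by move=> _ _ /imfP[x Xx <-] /imfP[y Yy <-]; rewrite -fhM; apply/mem_imf/sgM.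
Qed.

Canonical imf_group G F (f : fhom G F) (X : subgroup G) := Group (imf_group_set f X).

Section Factor.
Variables (G : topGroupType) (F F' : finGroupType) (f : fhom G F) (g : fhom G F').
Variable (H : subgroup G).
Hypothesis ker_fg : forall x, sgval H x -> f x = 1 -> g x = 1.

(** All passages from a finer finite image to a coarser one go through this morphism, which lets
    finite group theory transport indices, Hall subgroups and central series. *)
Lemma factor_fhom : exists phi : {morphism (imf f H) >-> F'},
  forall x, sgval H x -> phi (f x) = g x.
Proof.
pose phi (y : F) : F' := xget 1 [set z | exists2 x, sgval H x & f x = y /\ g x = z].
have phiE x : sgval H x -> phi (f x) = g x.
  move=> Hx; rewrite /phi; case: xgetP => [z -> [x' Hx' [fx' <-]]|/(_ (g x))];
    last by case; exists x.
  apply: (mulgI (g x)^-1); rewrite mulVg -fhV -fhM; apply: ker_fg.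
    by apply: sgM => //; apply: sgV.
  by rewrite fhM fhV fx' mulVg.
have phiM : {in imf f H &, {morph phi : x y / x * y}}.
  move=> _ _ /imfP[x Hx <-] /imfP[y Hy <-].
  by rewrite -fhM !phiE ?fhM //; apply: sgM.
by exists (Morphism phiM).
Qed.

Lemma morphim_factor (phi : {morphism (imf f H) >-> F'}) (X : set G) :
  (forall x, sgval H x -> phi (f x) = g x) -> X `<=` H -> phi @* imf f X = imf g X.
Proof.
move=> phiE sXH; apply/setP => z; apply/morphimP/imfP.
  by move=> [_ _ /imfP[x Xx <-] ->]; exists x => //; rewrite phiE //; apply: sXH.
move=> [x Xx <-]; exists (f x); last by rewrite phiE //; apply: sXH.
  by apply: mem_imf; apply: sXH.
exact: mem_imf.
Qed.

End Factor.

(** The sets are a basis of a proper filter; a cluster point of it lies in each of them, since they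
    are closed. *)
Lemma compact_directed (T : topologicalType) (I : Type) (E : I -> set T) (i0 : I) :
  compact [set: T] -> (forall i, closed (E i)) -> (forall i, E i !=set0) ->
  (forall i j, exists k, E k `<=` E i `&` E j) -> exists x, forall i, E i x.
Proof.
move=> cT clE neE dirE.
pose FE := filter_from [set: I] E.
have fFE : ProperFilter FE.
  apply: filter_from_proper; last by move=> i _; apply: neE.
  apply: filter_from_filter; first by exists i0.
  by move=> i j _ _; have [k sk] := dirE i j; exists k.
have [x [_ clx]] : [set: T] `&` cluster FE !=set0.
  by apply: cT; exists i0.
exists x => i; have := clx; rewrite clusterE => /(_ (E i)) h.
by rewrite ((closure_id _).1 (clE i)); apply: h; exists i.
Qed.

(** * Compact Hausdorff totally disconnected spaces are zero-dimensional *)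

Section ClopenSeparation.
Variable T : topologicalType.
Hypotheses (cT : compact [set: T]) (hT : hausdorff_space T).

(** The quasi-component of [x]. *)
Let quasi (x : T) := \bigcap_(C in [set C | clopen C /\ C x]) C.

(** The sets [C] minus [U], for [C] clopen around [x], are closed and directed with empty
    intersection, so by compactness one of them is empty. *)
Lemma clopen_cover_quasi (x : T) (U : set T) : open U -> quasi x `<=` U ->
  exists C, [/\ clopen C, C x & C `<=` U].
Proof.
move=> oU qU; apply: contrapT => noC.
pose J := {C : set T | clopen C /\ C x}.
have [] := @compact_directed T J (fun C => sval C `&` ~` U).
- by exists setT; split; [apply: clopenT|].
- exact: cT.
- by move=> -[C [[oC cC] Cx]] /=; apply: closedI => //; apply: open_closedC.
- move=> -[C [clC Cx]] /=; apply: contrapT => h; apply: noC; exists C; split=> //.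
  by move=> y Cy; apply: contrapT => Uy; apply: h; exists y.
- move=> -[C [clC Cx]] [D [clD Dx]].
  exists (exist _ (C `&` D) (conj (clopenI clC clD) (conj Cx Dx))) => /=.
  by move=> y [[Cy Dy] Uy]; split; split.
move=> y hy.
have : quasi x y by move=> C [clC Cx]; have [] := hy (exist _ C (conj clC Cx)).
have [_ nUy] := hy (exist _ setT (conj clopenT I)).
by move/qU.
Qed.

(** If the quasi-component splits into disjoint closed parts, normality gives an open [V0] around
    the part of [x] whose closure misses the other. A clopen set around [x] avoiding the boundary of
    [V0] meets [V0] in a clopen set, which must contain the whole quasi-component. *)
Lemma quasi_connected (x : T) : connected (quasi x).
Proof.
have qx : quasi x x by move=> C [].
have clq : closed (quasi x) by apply: closed_bigI => C [[_ ?] _].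
have main (A A' : set T) : closed A -> closed A' -> A `&` A' = set0 ->
    quasi x `<=` A `|` A' -> A x -> quasi x `<=` A.
  move=> clA clA' AA' qA Ax.
  have nA : set_nbhs A (~` A').
    move=> y Ay; apply: open_nbhs_nbhs; split; first exact: closed_openC.
    by move=> A'y; rewrite -[False]/(set0 y) -AA'.
  have [V AV0 clV] := compact_normal hT cT clA nA.
  pose V0 := V°; have oV0 : open V0 by apply: open_interior.
  have V0V : V0 `<=` V by apply: interior_subset.
  have sV0 : closure V0 `<=` ~` A' by apply: subset_trans clV; apply: closure_subset.
  have [D [[oD clD] Dx sD]] : exists D, [/\ clopen D, D x & D `<=` V0 `|` ~` closure V0].
    apply: clopen_cover_quasi.
      by apply: openU => //; apply: closed_openC; apply: closed_closure.
    move=> y /qA[/AV0|A'y]; first by left.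
    by right => /sV0; apply.
  have cl2 : clopen (D `&` V0).
    split; first exact: openI.
    have -> : D `&` V0 = D `&` closure V0.
      apply/seteqP; split=> y [Dy Vy]; split=> //; first exact: subset_closure.
      by case: (sD y Dy) => // /(_ Vy).
    by apply: closedI => //; apply: closed_closure.
  move=> y qy; have [Dy V0y] : (D `&` V0) y by apply: qy; split=> //; split=> //; apply: AV0.
  case: (qA y qy) => // A'y; exfalso.
  by apply: (sV0 y) => //; apply: subset_closure.
move=> B [b Bb] [C oC eC] [D clD eD].
have clB : closed B by rewrite eD; apply: closedI.
have clB' : closed (quasi x `&` ~` C) by apply: closedI => //; apply: open_closedC.
have BB' : B `&` (quasi x `&` ~` C) = set0.
  by apply/seteqP; split=> y // []; rewrite eC => -[_ Cy] [_ /(_ Cy)].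
have sq : quasi x `<=` B `|` (quasi x `&` ~` C).
  by move=> y qy; case: (pselect (C y)) => Cy; [left; rewrite eC|right].
have sBq : B `<=` quasi x by rewrite eC => y [].
apply/seteqP; split=> //.
case: (sq x qx) => [Bx|[_ nCx]]; first exact: main clB clB' BB' sq Bx.
have h := main _ _ clB' clB.
have : quasi x `<=` quasi x `&` ~` C by apply: h; [rewrite setIC|rewrite setUC|].
by move=> /(_ b (sBq b Bb)) [_]; move: Bb; rewrite eC => -[].
Qed.

Lemma totally_disconnected_zero_dimensional :
  totally_disconnected [set: T] -> zero_dimensional T.
Proof.
move=> td x y xy; apply: contrapT => noU.
have qy : quasi x y.
  move=> C [clC Cx]; apply: contrapT => nCy; apply: noU; exists C; split=> //.
have : connected_component [set: T] x y.
  exists (quasi x) => //; split=> //; first by move=> C [].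
  exact: quasi_connected.
by rewrite td // => /= e; rewrite e eqxx in xy.
Qed.

End ClopenSeparation.

Lemma cvg_mulg (G : topGroupType) (T : Type) (F : set_system T) (FF : Filter F)
    (f g : T -> G) (a b : G) :
  f @ F --> a -> g @ F --> b -> (fun x => f x * g x) @ F --> a * b.
Proof.
move=> fa gb.
have h : (fun x => (f x, g x)) @ F --> (a, b) by apply: cvg_pair.
exact: (cvg_comp _ _ h (@mulg_continuous G (a, b))).
Qed.

Section ProfiniteBase.
Variable G : topGroupType.

(* Elements that can be deleted from products without leaving or entering [C]. *)
Definition clopen_core (C : set G) : normalSubgroup G.
Proof.
unshelve refine (@NormalSubgroup _ (@Subgroup _
  [set g | forall x y, C (x * g * y) <-> C (x * y)] _ _ _) _) => /=.
- by move=> x y; rewrite mulg1.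
- by move=> g h Cg Ch x y; rewrite mulgA Ch Cg.
- by move=> g Cg x y; rewrite -(Cg (x * g^-1) y) mulgKV.
- by move=> g z Cg x y; rewrite conjgE !mulgA -(mulgA _ z y) Cg !mulgA mulgKV.
Defined.

Lemma clopen_core_sub (C : set G) : C 1 -> clopen_core C `<=` C.
Proof. by move=> C1 g /(_ 1 1); rewrite !mul1g mulg1 => ->. Qed.

Lemma open_subgroup_nbhs (N : subgroup G) : nbhs 1 (N : set G) -> open (N : set G).
Proof.
move=> N1; rewrite openE => x Nx; rewrite /interior.
have : nbhs x ((fun y => x^-1 * y) @^-1` N).
  by apply: mulgl_continuous; rewrite mulVg.
by apply: filterS => y /= Ny; rewrite -(mulKVg x y); apply: sgM.
Qed.

(** Since [C] and its complement are open, each pair [(x, y)] has a neighbourhood on which the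
    condition holds for all [g] close to 1; compactness of [G * G] makes one neighbourhood of 1
    serve all pairs. *)
Lemma clopen_core_open (C : set G) : compact [set: G] -> clopen C -> open (clopen_core C : set G).
Proof.
move=> cG [oC clC]; apply: open_subgroup_nbhs.
have /compact_near_coveringP := compact_setX cG cG.
move=> /(_ G (nbhs (1 : G)) (fun g (z : G * G) => C (z.1 * g * z.2) <-> C (z.1 * z.2)) _).
have near1 (z : G * G) : \forall z' \near z & g \near (1 : G),
    C (z'.1 * g * z'.2) <-> C (z'.1 * z'.2).
  have mulz : (fun w : (G * G) * G => w.1.1 * w.2 * w.1.2) @ nbhs (z, 1) --> z.1 * 1 * z.2.
    apply: cvg_mulg; first apply: cvg_mulg.
    - by apply: (@cvg_comp _ _ _ fst fst _ (nbhs z)); [apply: cvg_fst|apply: cvg_fst].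
    - exact: cvg_snd.
    - by apply: (@cvg_comp _ _ _ fst snd _ (nbhs z)); [apply: cvg_fst|apply: cvg_snd].
  have mulz' : (fun w : (G * G) * G => w.1.1 * w.1.2) @ nbhs (z, 1) --> z.1 * z.2.
    apply: cvg_mulg.
    - by apply: (@cvg_comp _ _ _ fst fst _ (nbhs z)); [apply: cvg_fst|apply: cvg_fst].
    - by apply: (@cvg_comp _ _ _ fst snd _ (nbhs z)); [apply: cvg_fst|apply: cvg_snd].
  rewrite mulg1 in mulz.
  have key (D : set G) : open D -> D (z.1 * z.2) ->
      nbhs (z, 1 : G) [set w | D (w.1.1 * w.2 * w.1.2) /\ D (w.1.1 * w.1.2)].
    move=> oD Dz; have nD : nbhs (z.1 * z.2) D by apply: open_nbhs_nbhs.
    by apply: filterI; [apply: mulz|apply: mulz'].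
  case: (pselect (C (z.1 * z.2))) => Cz.
    by apply: filterS (key C oC Cz) => w [].
  by apply: filterS (key (~` C) (closed_openC clC) Cz) => w [].
move=> /(_ (fun z _ => near1 z)); apply: filterS => g hg x y.
exact: (hg (x, y)).
Qed.

Lemma profinite_open_normal (U : set G) : profinite G -> nbhs 1 U ->
  exists N : normalSubgroup G, open (N : set G) /\ N `<=` U.
Proof.
move=> [cG hG tdG] U1.
have zd := totally_disconnected_zero_dimensional cG hG tdG.
have [C [C1 clC] CU] := zero_dimensional_cvg hG zd cG U1.
exists (clopen_core C); split; first exact: clopen_core_open.
exact: subset_trans (clopen_core_sub C1) CU.
Qed.

End ProfiniteBase.

Section FinGrp.
Variables (T : groupType) (s : seq T).
Hypothesis sP : forall x, x \in s.

(* The dummy [let] makes [sP] part of the type, so that instances depending on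
   it can be inferred. *)
Definition fingrp : Type := let _ := sP in T.
HB.instance Definition _ := Group.copy fingrp T.

Let fingrp_pickle (x : fingrp) := seq.index (x : T) s.
Let fingrp_unpickle n : option fingrp := nth None (map Some s) n.
Fact fingrp_pickleK : pcancel fingrp_pickle fingrp_unpickle.
Proof.
move=> x; rewrite /fingrp_unpickle (nth_map (x : T)).
  by rewrite nth_index //; apply: sP.
by rewrite index_mem; apply: sP.
Qed.
HB.instance Definition _ := Choice_isCountable.Build fingrp fingrp_pickleK.

Fact fingrp_enumP : Finite.axiom (undup (s : seq fingrp)).
Proof. by move=> x; rewrite count_uniq_mem ?undup_uniq // mem_undup [_ \in _]sP. Qed.
HB.instance Definition _ := fintype.isFinite.Build fingrp fingrp_enumP.

End FinGrp.

Lemma fhom_of_open_normal (G : topGroupType) (N : normalSubgroup G) :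
  compact [set: G] -> open (N : set G) ->
  exists (F : finGroupType) (f : fhom G F), forall x, f x = 1 <-> sgval N x.
Proof.
move=> cG oN.
pose tr (x : G) : set G := (fun y => x^-1 * y) @^-1` N.
have otr x : open (tr x).
  by apply: open_comp => // y _; apply: mulgl_continuous.
have [D covD] : exists D : seq G, forall x, exists2 y, y \in D & tr y x.
  (* Finite lists filtered by inclusion: near-covering compactness yields one list whose translates
     of [N] cover [G]. *)
  pose FF := filter_from [set: seq G] (fun D => [set E : seq G | {subset D <= E}]).
  have fFF : ProperFilter FF.
    apply: filter_from_proper; last by move=> D _; exists D.
    apply: filter_from_filter; first by exists [::].
    move=> D E _ _; exists (D ++ E) => // A sA.
    by split=> x xD; apply: sA; rewrite mem_cat xD ?orbT.
  have /compact_near_coveringP := cG.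
  move=> /(_ (seq G) FF (fun D x => exists2 y, y \in D & tr y x) _) cov.
  have [|D _ sD] := cov; last by exists D => x; apply: (sD D).
  move=> x _; exists (tr x, [set E : seq G | x \in E]) => /=.
    split; first by apply: open_nbhs_nbhs; split; [apply: otr|rewrite /tr /= mulVg; apply: sg1].
    by exists [:: x] => // E; apply; rewrite inE.
  by move=> [y E] [/= tr_y xE]; exists x.
pose s : seq (quotgrp N) := [seq Defs.coset N x | x <- D].
have sP (x : quotgrp N) : x \in s.
  elim/coset_ind: x => x.
  have [y Dy /= Nxy] := covD x.
  by apply/mapP; exists y => //; apply/esym/coset_eqP.
have fM : {morph (fun x : G => Defs.coset N x : fingrp sP) : x y / x * y}.
  by move=> x y; rewrite cosetM.
have kerE x : (Defs.coset N x : fingrp sP) = 1 <-> sgval N x.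
  split=> [e|Nx].
    have /esym/coset_eqP : Defs.coset N x = Defs.coset N 1 by [].
    by rewrite invg1 mul1g.
  by apply/esym/coset_eqP; rewrite invg1 mul1g.
have oK : open [set x : G | (Defs.coset N x : fingrp sP) = 1].
  by rewrite (_ : [set x | _] = N) //; apply/seteqP; split=> x /kerE.
by exists (fingrp sP : finGroupType), (FHom fM oK).
Qed.

Section FPair.
Variables (G : topGroupType) (F F' : finGroupType) (f : fhom G F) (g : fhom G F').

Lemma fpairM : {morph (fun x => (f x, g x)) : x y / x * y}.
Proof. by move=> x y; rewrite !fhM. Qed.

Lemma fpair_open : open [set x | (f x, g x) = 1].
Proof.
rewrite (_ : [set x | _] = [set x | f x = 1] `&` [set x | g x = 1]).
  by apply: openI; apply: fh_open.
by apply/seteqP; split=> x /= [e1 e2]; rewrite ?e1 ?e2.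
Qed.

Definition fpair := FHom fpairM fpair_open.

Lemma fpair_ker x : fpair x = 1 -> f x = 1 /\ g x = 1.
Proof. by case. Qed.

End FPair.

Definition kerf (G : topGroupType) (F : finGroupType) (f : fhom G F) : normalSubgroup G.
Proof.
unshelve refine (@NormalSubgroup _ (@Subgroup _ [set x | f x = 1] _ _ _) _) => /=.
- exact: fh1.
- by move=> x y e1 e2; rewrite fhM e1 e2 mulg1.
- by move=> x e; rewrite fhV e invg1.
- by move=> x y /= e; rewrite fhJ e conj1g.
Defined.

Definition sgI (G : groupType) (X Y : subgroup G) : subgroup G.
Proof.
unshelve refine (@Subgroup _ (X `&` Y) _ _ _) => /=.
- by split; apply: sg1.
- by move=> x y [? ?] [? ?]; split; apply: sgM.
- by move=> x [? ?]; split; apply: sgV.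
Defined.

Definition nsI (G : groupType) (X Y : normalSubgroup G) : normalSubgroup G.
Proof.
refine (@NormalSubgroup _ (sgI X Y) _).
by move=> x y [? ?]; split; apply: nsJ.
Defined.

(** * A profinite group seen through its finite images *)

Section Profinite.
Variable G : topGroupType.
Hypothesis pG : profinite G.

Lemma fhom_basis (U : set G) : nbhs 1 U ->
  exists (F : finGroupType) (f : fhom G F), forall x, f x = 1 -> U x.
Proof.
move=> U1; have [N [oN NU]] := profinite_open_normal pG U1.
have [cG _ _] := pG.
have [F [f fE]] := fhom_of_open_normal cG oN.
by exists F, f => x /fE/NU.
Qed.

(** If [x] is outside the closed set [X], some kernel [ker f] has [x * ker f] disjoint from [X], and
    then [f] tells [x] from [X]. *)
Lemma closed_imf (X : set G) x : closed X ->
  (forall (F : finGroupType) (f : fhom G F), f x \in imf f X) -> X x.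
Proof.
move=> clX h; apply: contrapT => nXx.
have [F [f fE]] : exists (F : finGroupType) (f : fhom G F),
    forall y, f y = 1 -> ~ X (x * y).
  apply: (fhom_basis (U := (fun y => x * y) @^-1` (~` X))).
  apply: mulgl_continuous; rewrite mulg1.
  by apply: open_nbhs_nbhs; split=> //; apply: closed_openC.
have /imfP[y Xy fxy] := h F f.
by apply: (fE (x^-1 * y)); rewrite ?mulKVg // fhM fhV fxy mulVg.
Qed.

Lemma fhom_sep x : (forall (F : finGroupType) (f : fhom G F), f x = 1) -> x = 1.
Proof.
move=> h; have [_ hG _] := pG.
apply: (@closed_imf [set 1]).
  exact: (accessible_closed_set1 (hausdorff_accessible hG)).
by move=> F f; rewrite h -(fh1 f); apply: mem_imf.
Qed.

(* Compactness: a condition on elements that can be met in every finite quotient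
   can be met in [G]. *)
Lemma fhom_compact (E : forall F : finGroupType, fhom G F -> set G) :
  (forall F f, closed (@E F f)) -> (forall F f, @E F f !=set0) ->
  (forall F F' (f : fhom G F) (g : fhom G F'), (forall x, f x = 1 -> g x = 1) ->
     E F f `<=` E F' g) ->
  exists x, forall F f, @E F f x.
Proof.
move=> clE neE monE; have [cG _ _] := pG.
(* One finite quotient is chosen for each open normal subgroup; intersections make the family
   directed, and monotonicity of [E] reaches all other quotients. *)
pose J := {N : normalSubgroup G | open (N : set G)}.
have J0 : J.
  have [N [oN _]] := cid (profinite_open_normal pG (filterT : nbhs (1 : G) setT)).
  by exists N.
pose fN (i : J) := cid (fhom_of_open_normal cG (proj2_sig i)).
pose gN i := cid (proj2_sig (fN i)).
have [||||x hx] := @compact_directed G J (fun i => E _ (sval (gN i))) J0.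
- exact: cG.
- by move=> i; apply: clE.
- by move=> i; apply: neE.
- move=> i j; exists (exist _ (nsI (sval i) (sval j)) (openI (proj2_sig i) (proj2_sig j))).
  by move=> x Ex; split; move: Ex; apply: monE => y /(proj2_sig (gN _)) [] ? ?;
    apply/(proj2_sig (gN _)).
exists x => F f; apply: monE (hx (exist _ (kerf f) (fh_open f))) => y.
by move/(proj2_sig (gN _)).
Qed.

End Profinite.

Lemma card_finset (T : finType) (B : {set T}) : ([set x | x \in B] #= `I_#|B|)%card.
Proof.
have -> : [set x | x \in B] = range (@enum_val T (mem B)).
  apply/seteqP; split=> [x Bx|_ [i _ <-]]; last exact: enum_valP.
  by exists (enum_rank_in Bx x) => //; rewrite enum_rankK_in.
apply: card_eq_trans (_ : ([set: 'I_#|B|] #= _)%card); last by rewrite card_eq_sym; apply: card_II.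
by apply: inj_card_eq => i j _ _; apply: enum_val_inj.
Qed.

Lemma card_range_equiv (T : choiceType) (U V : Type) (x0 : T) (p : T -> U) (q : T -> V) :
  (forall x y, p x = p y <-> q x = q y) -> (range p #= range q)%card.
Proof.
move=> pq; pose h u := q (xget x0 [set x | p x = u]).
have hE x : h (p x) = q x.
  apply/pq; have := @xgetPex _ x0 [set y | p y = p x]; apply.
  by exists x.
have -> : range q = h @` range p.
  apply/seteqP; split=> [_ [x _ <-]|_ [_ [x _ <-] <-]]; last by rewrite hE; exists x.
  by exists (p x); [exists x|rewrite hE].
rewrite card_eq_sym; apply: inj_card_eq => _ _ /set_mem[x _ <-] /set_mem[y _ <-].
by rewrite !hE => /pq.
Qed.

Section Index.
Variables (G : topGroupType) (F : finGroupType) (f : fhom G F).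

Definition sgT : subgroup G.
Proof. by exists setT. Defined.

Lemma has_index_preim (A : set G) (B : {group F}) : B \subset imf f sgT ->
  (forall x, A x <-> f x \in B) -> has_index A #|imf f sgT : B|.
Proof.
move=> sB AE; rewrite /has_index.
have h x y : [set x * a | a in A] = [set y * a | a in A] <-> f x *: B = f y *: B.
  have e1 (z t : G) : A (t^-1 * z) <-> f z \in f t *: B.
    by rewrite AE fhM fhV mem_lcoset.
  have A1 : A 1 by apply/AE; rewrite fh1 group1.
  split=> [e|e].
    apply/lcoset_eqP; apply/e1.
    have : [set y * a | a in A] x by rewrite -e; exists 1; rewrite ?mulg1.
    by move=> [a Aa <-]; rewrite mulKg.
  apply/seteqP; split=> _ [a Aa <-].
    exists (y^-1 * (x * a)); last by rewrite mulKVg.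
    by apply/e1; rewrite -e fhM mem_lcoset mulKg; apply/AE.
  exists (x^-1 * (y * a)); last by rewrite mulKVg.
  by apply/e1; rewrite e fhM mem_lcoset mulKg; apply/AE.
apply: card_eq_trans (card_range_equiv (1 : G) h) _.
rewrite -card_lcosets.
have -> : range (fun x => f x *: B) = [set C | C \in lcosets B (imf f sgT)].
  apply/seteqP; split=> [_ [x _ <-]|C /lcosetsP[_ /imfP[x _ <-] ->]]; last by exists x.
  by apply/lcosetsP; exists (f x) => //; apply: mem_imf.
exact: card_finset.
Qed.

Lemma has_index_inj (A : set G) n m : has_index A n -> has_index A m -> n = m.
Proof.
by rewrite /has_index card_eq_sym => h1 h2; apply/card_eq_II/(card_eq_trans h1).
Qed.

End Index.

Section Restriction.
Variables (G : topGroupType) (H : subgroup G).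

Lemma fresM (F : finGroupType) (f : fhom G F) :
  {morph (fun x : subgrp H => f (val x)) : x y / x * y}.
Proof. by move=> x y; rewrite valM fhM. Qed.

Lemma fres_open (F : finGroupType) (f : fhom G F) :
  open [set x : subgrp H | f (val x) = 1].
Proof.
have := @open_comp _ _ (val : subgrp H -> G) [set x | f x = 1].
by apply; [move=> x _; apply: subgrp_val_continuous|apply: fh_open].
Qed.

Definition fres (F : finGroupType) (f : fhom G F) := FHom (fresM f) (fres_open f).

(** The topology of [H] is induced from [G], so the open kernel of [g] contains the trace on [H] of
    some open normal subgroup of [G]. *)
Lemma fres_lift (F' : finGroupType) (g : fhom (subgrp H) F') : profinite G ->
  exists (F : finGroupType) (f : fhom G F), forall x, fres f x = 1 -> g x = 1.
Proof.
move=> pG; have [B oB BE] := fh_open g.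
have B1 : nbhs 1 B.
  apply: open_nbhs_nbhs; split=> //.
  have : (val @^-1` B) (1 : subgrp H) by rewrite BE /= fh1.
  have e1 : val (1 : subgrp H) = 1 :> G by exact: val1.
  by rewrite -e1.
have [F [f fB]] := fhom_basis pG B1.
exists F, f => x /= /fB Bx.
by have : (val @^-1` B) x by []; rewrite BE.
Qed.

Lemma imf_fres (F : finGroupType) (f : fhom G F) (X : set (subgrp H)) :
  imf (fres f) X = imf f (val @` X).
Proof.
apply/setP => y; apply/imfP/imfP => [[x Xx <-]|[_ [x Xx <-] <-]].
  by exists (val x) => //; exists x.
by exists x.
Qed.

End Restriction.

(** Fibres of maps to finite groups are clopen, so separation by such maps gives both the Hausdorff
    property and total disconnectedness. *)
Lemma profinite_criterion (G : topGroupType) : compact [set: G] ->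
  (forall x : G, (forall (F : finGroupType) (f : fhom G F), f x = 1) -> x = 1) ->
  profinite G.
Proof.
move=> cG sepG.
have sep (x y : G) : x != y -> exists (F : finGroupType) (f : fhom G F), f x != f y.
  move=> xy; apply: contrapT => h; case/eqP: xy.
  apply: (mulgI x^-1); rewrite mulVg; apply/esym/sepG => F f.
  apply: contrapT => /eqP ne; apply: h; exists F, f.
  by apply: contra ne => /eqP e; rewrite fhM fhV e mulVg.
split=> //.
  rewrite open_hausdorff => x y /sep[F [f fxy]].
  exists (f @^-1` [set f x]%classic, f @^-1` [set f y]%classic) => /=; first by rewrite !inE.
  split; try exact: fh_pre_open.
  by apply/eqP/seteqP; split=> z // [/= -> e]; rewrite e eqxx in fxy.
apply: zero_dimension_totally_disconnected => x y /sep[F [f fxy]].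
exists (f @^-1` [set f x]%classic); split=> //=.
  by split; [apply: fh_pre_open|apply: fh_pre_closed].
by move=> e; rewrite e eqxx in fxy.
Qed.

Lemma subgrp_compact (G : topGroupType) (H : subgroup G) : compact [set: G] ->
  closed (H : set G) -> compact [set: subgrp H].
Proof.
move=> cG clH.
have cH : compact (H : set G) by apply: subclosed_compact clH cG _.
move=> FF PFF _.
have [p [Hp clp]] : (H : set G) `&` cluster (val @ FF) !=set0.
  apply: cH; rewrite /nbhs /=; apply: filterS filterT => x _.
  exact: set_mem (valP x).
exists (exist _ p (mem_set Hp)); split=> // A B FA.
rewrite nbhsE => -[B' [[C oC CE] B'p] B'B].
have Cp : nbhs p C.
  by apply: open_nbhs_nbhs; split=> //; rewrite -CE in B'p.
have [|_ [[x Ax <-] Cx]] := clp (val @` A) C _ Cp.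
  by rewrite /nbhs /=; apply: filterS FA => x Ax; exists x.
by exists x; split=> //; apply: B'B; rewrite -CE.
Qed.

Lemma subgrp_profinite (G : topGroupType) (H : subgroup G) : profinite G ->
  closed (H : set G) -> profinite (subgrp H).
Proof.
move=> pG clH; have [cG _ _] := pG.
apply: profinite_criterion; first exact: subgrp_compact.
move=> x h; apply/val_inj; rewrite val1; apply: fhom_sep => // F f.
exact: (h F (fres H f)).
Qed.

Definition sgpre (G : topGroupType) (F : finGroupType) (f : fhom G F) (B : {group F}) :
  subgroup G.
Proof.
unshelve refine (@Subgroup _ [set x | f x \in B] _ _ _) => /=.
- by rewrite fh1 group1.
- by move=> y z By Bz; rewrite fhM groupM.
- by move=> y By; rewrite fhV groupV.
Defined.

Lemma sgpre_open (G : topGroupType) F f B : open (@sgpre G F f B : set G).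
Proof. exact: (fh_pre_open f [set y | y \in B]). Qed.

Lemma sgpre_closed (G : topGroupType) F f B : closed (@sgpre G F f B : set G).
Proof. exact: (fh_pre_closed f [set y | y \in B]). Qed.

Section QuotientMaps.
Variables (G : topGroupType) (N : normalSubgroup G).

Lemma fquoM (F : finGroupType) (g : fhom (quotgrp N) F) :
  {morph (fun x : G => g (Defs.coset N x)) : x y / x * y}.
Proof. by move=> x y; rewrite cosetM fhM. Qed.

Lemma fquo_open (F : finGroupType) (g : fhom (quotgrp N) F) :
  open [set x : G | g (Defs.coset N x) = 1].
Proof.
have := @open_comp _ _ (Defs.coset N) [set x | g x = 1].
by apply; [move=> x _; apply: coset_continuous|apply: fh_open].
Qed.

Definition fquo (F : finGroupType) (g : fhom (quotgrp N) F) := FHom (fquoM g) (fquo_open g).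

Lemma imf_fquo (F : finGroupType) (g : fhom (quotgrp N) F) (X : set G) :
  imf (fquo g) X = imf g (Defs.coset N @` X).
Proof.
apply/setP => y; apply/imfP/imfP => [[x Xx <-]|[_ [x Xx <-] <-]].
  by exists (Defs.coset N x) => //; exists x.
by exists x.
Qed.

Lemma coset_one : Defs.coset N 1 = 1.
Proof. by []. Qed.

Lemma coset_eq1 x : Defs.coset N x = 1 <-> sgval N x.
Proof.
rewrite -coset_one; split=> [/esym/coset_eqP|Nx]; first by rewrite invg1 mul1g.
by apply/esym/coset_eqP; rewrite invg1 mul1g.
Qed.

Definition quosg (X : subgroup G) : subgroup (quotgrp N).
Proof.
unshelve refine (@Subgroup _ (Defs.coset N @` X) _ _ _) => /=.
- by exists 1 => //; apply: sg1.
- by move=> _ _ [x Xx <-] [y Xy <-]; exists (x * y); [apply: sgM|rewrite cosetM].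
- by move=> _ [x Xx <-]; exists x^-1; [apply: sgV|rewrite cosetV].
Defined.

Lemma quosg_normal (X : subgroup G) : is_normal X -> is_normal (quosg X).
Proof.
move=> nX _ b [x Xx <-]; elim/coset_ind: b => y.
by exists (x ^ y); [apply: nX|rewrite !conjgE !cosetM cosetV].
Qed.

Lemma quotgrp_compact : compact [set: G] -> compact [set: quotgrp N].
Proof.
move=> cG; have -> : [set: quotgrp N] = Defs.coset N @` setT.
  by apply/seteqP; split=> // a _; elim/coset_ind: a => x; exists x.
by apply: continuous_compact => //; apply: continuous_subspaceT; apply: coset_continuous.
Qed.

Lemma quotgrp_profinite : profinite G -> closed (N : set G) -> profinite (quotgrp N).
Proof.
move=> pG clN; have [cG _ _] := pG.
have cQ := quotgrp_compact cG.
apply: profinite_criterion => // a; elim/coset_ind: a => x h.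
apply/coset_eq1; apply: (closed_imf pG clN) => F f.
(* [P] is the product of [N] and the kernel of [f]. Its image in the quotient is open and normal, so
   a coset killed by all finite quotients lies in it, for every [f]. *)
pose P := sgpre f [group of imf f N].
have nP : is_normal P.
  move=> y z /= /imfP[u Nu fu]; rewrite fhJ -fu -fhJ; apply: mem_imf; exact: nsJ.
have oQ : open (quosg P : set (quotgrp N)) by apply: coset_open; apply: sgpre_open.
have [F' [g gE]] := @fhom_of_open_normal _ (NormalSubgroup (quosg_normal nP)) cQ oQ.
have [y Py /coset_eqP Nxy] := (gE _).1 (h F' g).
rewrite -(mulKVg y x) fhM; apply: groupM; [exact: Py | exact: mem_imf].
Qed.

Lemma quosg_closed (X : subgroup G) : profinite G -> closed (N : set G) ->
  closed (X : set G) -> closed (quosg X : set (quotgrp N)).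
Proof.
move=> pG clN clX; have [cG _ _] := pG; have [_ hQ _] := quotgrp_profinite pG clN.
apply: compact_closed => //; apply: continuous_compact.
  by apply: continuous_subspaceT; apply: coset_continuous.
by apply: subclosed_compact clX cG _.
Qed.

End QuotientMaps.

Lemma has_index_ker (G : topGroupType) (F : finGroupType) (f : fhom G F) (N : set G) :
  (forall x, f x = 1 <-> N x) -> has_index N #|imf f (sgT G)|.
Proof.
move=> fN; rewrite -[#|_|]indexg1.
apply: (@has_index_preim _ _ _ N 1%G); first exact: sub1G.
by move=> x; rewrite -fN; split=> [->|/set1P]; rewrite ?group1.
Qed.

Lemma pro_pP p (G : topGroupType) : prime p -> profinite G ->
  pro_p p G <-> forall (F : finGroupType) (f : fhom G F), p.-group (imf f (sgT G)).
Proof.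
move=> pr_p pG; have [cG _ _] := pG; split=> [[_ h] F f|h].
  have [k ik] := h (kerf f) (fh_open f) (@nsJ _ (kerf f)).
  have e := has_index_inj (has_index_ker (f := f) (N := kerf f) _) ik.
  by rewrite /pgroup e // pnatX pnat_id.
split=> // N oN nN.
have [F [f fN]] := fhom_of_open_normal (N := NormalSubgroup nN) cG oN.
have /p_natP[k ek] := h F f.
by exists k; rewrite -ek; apply: has_index_ker.
Qed.

Lemma pro_p_sub p (G : topGroupType) (X : subgroup G) : prime p -> profinite G ->
  closed (X : set G) ->
  pro_p p (subgrp X) <-> forall (F : finGroupType) (f : fhom G F), p.-group (imf f X).
Proof.
move=> pr_p pG clX; have pX := subgrp_profinite pG clX.
rewrite (pro_pP pr_p pX).
have eX : (val @` (sgT (subgrp X) : set _)) = (X : set G).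
  apply/seteqP; split=> [_ [x _ <-]|x Xx]; first exact: set_mem (valP x).
  by exists (exist _ x (mem_set Xx)).
split=> h F f; first by rewrite -eX -imf_fres; apply: h.
have [F' [g gf]] := fres_lift f pG.
have [phi phiE] := factor_fhom (f := fres X g) (g := f) (H := sgT _) (fun x _ => gf x).
have pg : p.-group (imf (fres X g) (sgT (subgrp X))) by rewrite imf_fres eX; apply: h.
by rewrite -(morphim_factor phiE) //; apply: morphim_pgroup pg.
Qed.

Local Open Scope nat_scope.
Local Open Scope group_scope.

(** * Sylow subgroups *)

(** In the joint quotient [fpair f g] the image of the cut-down subgroup is the full preimage of
    [P], so the index there is [#|imf f S : P|]; projecting to [g] can only replace it by a
    divisor. *)
Lemma imf_sgpre_index (G : topGroupType) (F F' : finGroupType) (f : fhom G F) (g : fhom G F')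
    (S : subgroup G) (P : {group F}) : P \subset imf f S ->
  #|imf g S : imf g (sgI S (sgpre f P))| %| #|imf f S : P|.
Proof.
move=> sPS; pose e := fpair f g; pose S1 := sgI S (sgpre f P).
have [phi phiE] := factor_fhom (f := e) (g := f) (H := S)
  (fun x _ => @proj1 _ _ \o @fpair_ker _ _ _ f g x).
have [psi psiE] := factor_fhom (f := e) (g := g) (H := S)
  (fun x _ => @proj2 _ _ \o @fpair_ker _ _ _ f g x).
have sS1 : S1 `<=` S by move=> x [].
have eS1 : imf e S1 = imf e S :&: phi @*^-1 P.
  apply/setP=> y; rewrite finset.in_setI; apply/imfP/andP => [[x [Sx Px] <-]|[]].
    by split; [apply/imfP; exists x|apply/morphpreP; split; [apply: mem_imf|rewrite phiE]].
  move=> /imfP[x Sx <-] /morphpreP[_]; rewrite phiE // => Px.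
  by exists x.
have d1 : #|imf g S : imf g S1| %| #|imf e S : imf e S1|.
  rewrite -(morphim_factor psiE) // -(morphim_factor psiE sS1).
  by apply: index_morphim; apply: finset.subsetIl.
apply: dvdn_trans d1 _.
have sS1e : imf e S1 \subset imf e S by apply: imfS.
rewrite -(index_morphim_ker phi sS1e) // (morphim_factor phiE) // (morphim_factor phiE) //.
have -> : imf f S1 = P.
  apply/setP=> y; apply/imfP/idP => [[x [_ Px] <-]//|Py].
  have /imfP[x Sx xy] := fintype.subsetP sPS y Py.
  by exists x => //; split=> //=; rewrite xy.
have -> : #|'ker_(imf e S) phi : imf e S1| = 1%N.
  apply/eqP; rewrite indexg_eq1 /= eS1 finset.subsetI finset.subsetIl /=.
  by rewrite finset.subIset // (ker_sub_pre phi P) orbT.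
by rewrite muln1.
Qed.

Section SylowExistence.
Variables (p : nat) (G : topGroupType).
Hypotheses (pr_p : prime p) (pG : profinite G).

Let p'idx := [set S : subgroup G | closed (S : set G) /\
  forall (F : finGroupType) (f : fhom G F), p^'.-nat #|imf f (sgT G) : imf f S|].

Definition sgbig (I : Type) (D : set I) (X : I -> subgroup G) : subgroup G.
Proof.
unshelve refine (@Subgroup _ (\bigcap_(i in D) X i) _ _ _) => /=.
- by move=> i _; apply: sg1.
- by move=> x y hx hy i Di; apply: sgM; [apply: hx|apply: hy].
- by move=> x hx i Di; apply: sgV; apply: hx.
Defined.

(** Under each [f], the intersection has the same image as a member of the chain with smallest
    image: over every element of that image, compactness finds a point common to the whole chain. *)
Lemma p'idx_chain (C : set (subgroup G)) : C `<=` p'idx ->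
  (forall S T, C S -> C T -> S `<=` T \/ T `<=` S) -> C !=set0 -> p'idx (sgbig C id).
Proof.
move=> sC totC [S0 CS0]; split.
  by apply: closed_bigI => S /sC[].
move=> F f; have [cG _ _] := pG.
have [S [CS minS]] : exists S, C S /\ forall T, C T -> #|imf f S| <= #|imf f T|.
  pose P n := `[< exists S, C S /\ #|imf f S| = n >].
  have exP : exists n, P n by exists #|imf f S0|; apply/asboolP; exists S0.
  have [n /asboolP[S [CS <-]] minn] := ex_minnP exP.
  by exists S; split=> // T CT; apply: minn; apply/asboolP; exists T.
suff <- : imf f S = imf f (sgbig C id) by apply: (sC S CS).2.
apply/eqP; rewrite finset.eqEsubset; apply/andP; split; last by apply: imfS => x; apply.
apply/fintype.subsetP => y Sy.
pose J := {T : subgroup G | C T}.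
have [||||x hx] := @compact_directed G J (fun T => (sval T : set G) `&` f @^-1` [set y]%classic)
    (exist _ S CS).
- exact: cG.
- by move=> [T CT] /=; apply: closedI; [apply: (sC T CT).1|apply: fh_pre_closed].
- move=> [T CT] /=.
  have : y \in imf f T.
    case: (totC _ _ CS CT) => [sST|sTS]; first by apply: (fintype.subsetP _ _ Sy); apply: imfS.
    have /eqP -> : imf f T == imf f S by rewrite eqEcard imfS //= minS.
    exact: Sy.
  by move=> /imfP[x Tx xy]; exists x.
- move=> [T CT] [T' CT']; case: (totC _ _ CT CT') => s.
    by exists (exist _ T CT) => x [Tx fx]; do 2 split=> //=; apply: s.
  by exists (exist _ T' CT') => x [Tx fx]; do 2 split=> //=; apply: s.
apply/imfP; exists x; last by have [] := hx (exist _ S CS).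
by move=> T CT; have [] := hx (exist _ T CT).
Qed.

(** Zorn's lemma gives a minimal closed subgroup of index prime to [p]. Its finite images are
    [p]-groups, since the preimage of a Sylow subgroup of an image again has index prime to [p]. *)
Lemma Sylow_exists_profinite : exists S : subgroup G, closed (S : set G) /\
  forall (F : finGroupType) (f : fhom G F), p.-Sylow(imf f (sgT G)) (imf f S).
Proof.
pose J := {S : subgroup G | p'idx S}.
have iT : p'idx (sgT G).
  by split; [apply: closedT|move=> F f; rewrite indexgg].
(* Reverse inclusion, so that a maximal element is a minimal subgroup. *)
pose R (S T : J) := `[< sval T `<=` sval S >].
have [|||[S [clS idS]] maxS] := @ZL_preorder J (exist _ (sgT G) iT) R.
- by move=> S; apply/asboolP.
- by move=> A B C /asboolP BA /asboolP CB; apply/asboolP; apply: subset_trans BA.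
- move=> A totA; case: (pselect (A !=set0)) => [[S0 AS0]|A0]; last first.
    by exists (exist _ (sgT G) iT) => s As; case: A0; exists s.
  have h : p'idx (sgbig [set S | exists h : p'idx S, A (exist _ S h)] id).
    apply: p'idx_chain.
    - by move=> S [].
    - move=> S T [hS AS] [hT AT]; case: (totA _ _ AS AT) => /asboolP; by [right|left].
    - by case: S0 AS0 => S hS AS; exists S, hS.
  exists (exist _ _ h) => -[S hS] AS; apply/asboolP => x /=; apply.
  by exists hS.
exists S; split=> // F f.
rewrite pHallE; rewrite imfS //=.
have [P sylP] := Sylow_exists p [group of imf f S].
have sPS := pHall_sub sylP.
pose S1 := sgI S (sgpre f P).
have iS1 : p'idx S1.
  split; first by apply: closedI => //; apply: sgpre_closed.
  move=> F' g.
  have sS1 : imf g S1 \subset imf g S by apply: imfS => x [].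
  rewrite -(Lagrange_index (imfS g (_ : S `<=` sgT G)) sS1) // pnatM idS /=.
  apply: pnat_dvd (imf_sgpre_index g sPS) _.
  by case/and3P: sylP.
have /asboolP/= sSS1 : R (exist _ S1 iS1) (exist _ S (conj clS idS)).
  by apply: maxS; apply/asboolP => x [].
have pS : p.-group (imf f S).
  apply: pgroupS (pHall_pgroup sylP).
  by apply/fintype.subsetP=> _ /imfP[x /sSS1[_ Px] <-].
rewrite -(Lagrange (imfS f (_ : S `<=` sgT G))) // partnM ?cardG_gt0 //.
by rewrite part_pnat_id // part_p'nat ?muln1 ?eqxx //; apply: idS.
Qed.

End SylowExistence.

Lemma is_sylowP p (G : topGroupType) (S : subgroup G) : prime p -> profinite G ->
  is_sylow p S <-> closed (S : set G) /\
    forall (F : finGroupType) (f : fhom G F), p.-Sylow(imf f (sgT G)) (imf f S).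
Proof.
move=> pr_p pG; have [cG _ _] := pG.
have SN (F : finGroupType) (f : fhom G F) (N : set G) : (forall x, f x = 1 <-> N x) ->
    has_index [set x * y | x in S & y in N] #|imf f (sgT G) : imf f S|.
  move=> fN; apply: has_index_preim; first exact: imfS.
  move=> z; split=> [[x Sx [y /fN fy] <-]|/imfP[x Sx fxz]].
    by rewrite fhM fy mulg1; apply: mem_imf.
  exists x => //; exists (x^-1 * z); last by rewrite mulKVg.
  by apply/fN; rewrite fhM fhV fxz mulVg.
split=> [[clS pS iS]|[clS sylS]].
  split=> // F f; rewrite /pHall imfS //=.
  rewrite ((pro_p_sub pr_p pG clS).1 pS) /=.
  have [n i_n co] := iS (kerf f) (fh_open f) (@nsJ _ (kerf f)).
  rewrite (has_index_inj (SN F f (kerf f) _) i_n) //.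
  by rewrite p'natE // -prime_coprime.
split=> //.
  by apply/(pro_p_sub pr_p pG clS) => F f; apply: pHall_pgroup (sylS F f).
move=> N oN nN.
have [F [f fN]] := fhom_of_open_normal (N := NormalSubgroup nN) cG oN.
exists #|imf f (sgT G) : imf f S|; first exact: SN.
by rewrite prime_coprime // -p'natE //; case/and3P: (sylS F f).
Qed.

Lemma is_sylow_sylow p (G : topGroupType) : prime p -> profinite G -> is_sylow p (sylow p G).
Proof.
move=> pr_p pG; apply: (@xgetPex _ (trivsg G) [set S | is_sylow p S]).
by have [S hS] := Sylow_exists_profinite p pG; exists S; apply/is_sylowP.
Qed.

(** Both [g] and [g^-1] are required to map [S] into itself, because in an infinite group the first
    condition alone need not be stable under inverses. *)
Definition normsg (G : groupType) (S : subgroup G) : subgroup G.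
Proof.
unshelve refine (@Subgroup _
  [set g | forall s, sgval S s -> sgval S (s ^ g) /\ sgval S (s ^ g^-1)] _ _ _) => /=.
- by move=> s Ss; rewrite invg1 conjg1.
- move=> g h Ng Nh s Ss; rewrite invMg !conjgM.
  by split; [apply: (Nh _ (Ng _ Ss).1).1|apply: (Ng _ (Nh _ Ss).2).2].
- by move=> g Ng s /Ng[? ?]; rewrite invgK.
Defined.

Lemma imf_normsg p (G : topGroupType) (S : subgroup G) : prime p -> profinite G ->
  closed (S : set G) ->
  (forall (F : finGroupType) (f : fhom G F), p.-Sylow(imf f (sgT G)) (imf f S)) ->
  forall (F : finGroupType) (f : fhom G F),
    imf f (sgT G) :&: 'N(imf f S) \subset imf f (normsg S).
Proof.
move=> pr_p pG clS sylS F f; apply/fintype.subsetP => y /finset.setIP[/imfP[g _ fg] Ny].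
pose E (F' : finGroupType) (h : fhom G F') := [set x : G | f x = y /\
  forall s, sgval S s -> h (s ^ x) \in imf h S /\ h (s ^ x^-1) \in imf h S].
have [|||x hx] := @fhom_compact G pG E.
- move=> F' h.
  have -> : E F' h = f @^-1` [set y]%classic `&`
      h @^-1` [set z | forall s, sgval S s -> h s ^ z \in imf h S /\ h s ^ z^-1 \in imf h S].
    by apply/seteqP; split=> x [fx hx]; split=> // s /hx; rewrite !fhJ fhV.
  by apply: closedI; apply: fh_pre_closed.
- move=> F' h; pose e := fpair f h.
  have [phi phiE] := factor_fhom (f := e) (g := f) (H := sgT G)
    (fun x _ => @proj1 _ _ \o @fpair_ker _ _ _ f h x).
  pose K := ('ker phi)%G.
  pose eS := [group of imf e S].
  have eG (x : G) : e x \in imf e (sgT G) by apply: mem_imf.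
  have sSG : eS \subset imf e (sgT G) by apply: imfS.
  have sKG : K \subset imf e (sgT G) by apply: finset.subsetIl.
  have nKS : eS \subset 'N(K) := fintype.subset_trans sSG (ker_norm phi).
  have Ng : eS :^ e g \subset K <*> eS.
    apply/fintype.subsetP=> _ /imsetP[_ /imfP[s Ss <-] ->].
    have : y \in 'N(imf f S) by [].
    rewrite -fg => /normP/setP/(_ (f s ^ f g)); rewrite memJ_conjg mem_imf //.
    move=> /esym/imfP[t St ft].
    rewrite norm_joinEr // -fhJ; apply/mulsgP.
    exists (e (s ^ g) * (e t)^-1) (e t); last by rewrite mulgKV.
      apply/kerP; first by rewrite groupM ?groupV.
      by rewrite -fhV -fhM phiE // fhM fhV fhJ ft mulgV.
    exact: mem_imf.
  have sKSG : K <*> eS \subset imf e (sgT G) by rewrite join_subG sKG.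
  have sylE : p.-Sylow(K <*> eS) eS := pHall_subl (joing_subr _ _) sKSG (sylS _ e).
  have sylEg : p.-Sylow(K <*> eS) (eS :^ e g).
    apply: (pHall_subl Ng sKSG).
    by rewrite pHallJ //; apply: sylS.
  have [k KSk defk] := Sylow_trans sylE sylEg.
  have defKS : K <*> eS = K * eS by apply: norm_joinEr.
  have : k \in K * eS by rewrite -defKS.
  rewrite -(normC nKS) => /mulsgP[a b eSa Kb ek].
  have /imfP[u _ eu] : b \in imf e (sgT G) := fintype.subsetP sKG b Kb.
  have fu : f u = 1 by rewrite -(phiE u I) eu; apply/mker.
  have nx : e (g * u^-1) \in 'N(eS).
    apply/normP; rewrite fhM fhV eu conjsgM defk ek conjsgM (conjGid eSa).
    by rewrite conjsgK.
  exists (g * u^-1); split; first by rewrite fhM fhV fu invg1 mulg1.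
  have key x s : e x \in 'N(eS) -> sgval S s -> h (s ^ x) \in imf h S.
    move=> Nx Ss; have : e s ^ e x \in eS by rewrite memJ_norm //; apply: mem_imf.
    by rewrite -fhJ => /imfP[t St [_ <-]]; apply: mem_imf.
  by move=> s Ss; split; apply: key => //; rewrite fhV groupV.
- move=> F1 F2 h1 h2 h12 x [fx hx]; split=> // s Ss.
  have key z : h1 z \in imf h1 S -> h2 z \in imf h2 S.
    move=> /imfP[t St tz]; apply/imfP; exists t => //.
    apply: (mulgI (h2 t)^-1); rewrite mulVg -fhV -fhM; apply/esym/h12.
    by rewrite fhM fhV tz mulVg.
  by have [? ?] := hx s Ss; split; apply: key.
have [fx _] := hx _ f.
apply/imfP; exists x => // s Ss; split; apply: (closed_imf pG clS) => F' h;
  by have [_ /(_ s Ss)[]] := hx _ h.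
Qed.

(** * The Frattini quotient *)

Section FactorBasis.
Variables (V : groupType) (p : nat).
Hypotheses (pr_p : prime p) (abV : forall x y : V, x * y = y * x)
  (expV : forall x : V, x ^+ p = 1).

Lemma expg_mod_p (x : V) m : x ^+ m = x ^+ (m %% p).
Proof. by rewrite {1}(divn_eq m p) mulnC expgnDr expgM expV expg1n mul1g. Qed.

(** The join of [B] with the cyclic group of [x]; natural exponents suffice because [x ^+ p.-1] is
    the inverse of [x]. *)
Definition sgadj (B : subgroup V) (x : V) : subgroup V.
Proof.
unshelve refine (@Subgroup _ [set y | exists i : nat, sgval B ((x ^+ i)^-1 * y)] _ _ _) => /=.
- by exists 0; rewrite expg0 invg1 mulg1; apply: sg1.
- move=> y z [i Bi] [j Bj]; exists (i + j)%N.
  have -> : (x ^+ (i + j))^-1 * (y * z) = ((x ^+ i)^-1 * y) * ((x ^+ j)^-1 * z); last exact: sgM.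
  by rewrite expgnDr invMg -!mulgA (abV (x ^+ j)^-1) -!mulgA (abV z) !mulgA.
- move=> y [i Bi]; exists (p.-1 * i)%N.
  have -> : (x ^+ (p.-1 * i))^-1 * y^-1 = ((x ^+ i)^-1 * y)^-1; last exact: sgV.
  rewrite invMg invgK abV; congr (_ * _).
  apply: (mulgI (x ^+ (p.-1 * i))); rewrite mulgV -expgnDr -mulSnr.
  by rewrite prednK ?prime_gt0 // expgM expV expg1n.
Defined.

Lemma sgadj_pow_inj (B : subgroup V) (x : V) (i j : 'I_p) : ~ sgval B x ->
  sgval B ((x ^+ i)^-1 * x ^+ j) -> i = j.
Proof.
move=> nBx Bij; apply: contrapT => ne; apply: nBx.
have BX (y : V) m : sgval B y -> sgval B (y ^+ m).
  by move=> By; elim: m => [|m IHm]; [apply: sg1|rewrite expgS; apply: sgM].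
(* The difference [j - i] modulo [p], written without negative numbers; if it is nonzero it is
   invertible modulo [p], so [x] is a power of [x ^+ d]. *)
pose d := (j + (p - i))%N.
have Bd : sgval B (x ^+ d).
  have -> : x ^+ d = (x ^+ i)^-1 * x ^+ j; last by [].
  apply: (mulgI (x ^+ i)); rewrite mulKVg -expgnDr /d addnCA subnKC ?(ltnW (ltn_ord i)) //.
  by rewrite expgnDr expV mulg1.
have cod : coprime d p.
  rewrite coprime_sym prime_coprime //; apply/negP => pd; apply: ne; apply/val_inj => /=.
  have : j = i %[mod p].
    apply/eqP; rewrite -(eqn_modDr (p - i)) subnKC ?(ltnW (ltn_ord i)) // modnn.
    by move: pd; rewrite /dvdn.
  by rewrite !modn_small.
have d_gt0 : 0 < d by rewrite /d addn_gt0 subn_gt0 ltn_ord orbT.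
have [km kn ek _] := egcdnP p d_gt0.
move: ek; rewrite (eqP cod) => ek.
have -> : x = (x ^+ d) ^+ km; last exact: BX.
by rewrite -expgM mulnC ek expgnDr mulnC expgM expV expg1n mul1g.
Qed.

Variables (s : seq V) (sP : forall x, x \in s).

Definition sgcard (A : set V) := #|[set x : fingrp sP | `[< A x >]]%SET|.

Lemma sgcard_le (A B : set V) : A `<=` B -> sgcard A <= sgcard B.
Proof.
move=> sAB; apply: subset_leq_card; apply/fintype.subsetP => x; rewrite !finset.inE.
by move=> /asboolP/sAB Bx; apply/asboolP.
Qed.

Lemma sgcard_lt (A B : set V) x : A `<=` B -> B x -> ~ A x -> sgcard A < sgcard B.
Proof.
move=> sAB Bx nAx; apply: proper_card; apply/fintype.properP; split.
  apply/fintype.subsetP => y; rewrite !finset.inE.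
  by move=> /asboolP/sAB By; apply/asboolP.
by exists x; rewrite finset.inE; [apply/asboolP|apply/asboolPn].
Qed.

(** Induction by enlarging [B]: for [x0] in [A] outside [B], a basis of [A] modulo [sgadj B x0]
    followed by [x0] is a basis of [A] modulo [B]. *)
Lemma factor_basis (A B : subgroup V) : B `<=` A ->
  exists (r : nat) (b : 'I_r -> V), (forall i, sgval A (b i)) /\
    forall x, sgval A x ->
      exists! e : {ffun 'I_r -> 'I_p}, sgval B ((\prod_(i < r) b i ^+ e i)^-1 * x).
Proof.
have [m] := ubnP (sgcard A - sgcard B); elim: m => // m IHm in B *.
move=> ltm sBA; case: (pselect (A `<=` B)) => [sAB|nsAB].
  exists 0, (fun=> 1); split=> [i|x Ax]; first exact: sg1.
  have e0 : {ffun 'I_0 -> 'I_p} by apply: finfun => -[].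
  exists e0; split; first by rewrite big_ord0 invg1 mul1g; apply: sAB.
  by move=> e _; apply/ffunP => -[].
have [x0 [Ax0 nBx0]] : exists x0, sgval A x0 /\ ~ sgval B x0.
  by apply: contrapT => h; apply: nsAB => x Ax; apply: contrapT => nBx; apply: h; exists x.
pose B' := sgadj B x0.
have sBB' : B `<=` B' by move=> y By; exists 0; rewrite expg0 invg1 mul1g.
have B'x0 : sgval B' x0 by exists 1%N; rewrite expg1 mulVg; apply: sg1.
have AX (y : V) k : sgval A y -> sgval A (y ^+ k).
  by move=> Ay; elim: k => [|k IHk]; [apply: sg1|rewrite expgS; apply: sgM].
have sB'A : B' `<=` A.
  by move=> y [k Bk]; rewrite -(mulKVg (x0 ^+ k) y); apply: sgM; [apply: AX|apply: sBA].
have ltB : sgcard B < sgcard B' by apply: sgcard_lt B'x0 nBx0.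
have [|r [b [Ab hb]]] := IHm B' _ sB'A.
  apply: leq_trans (ltm : _ <= m); apply: ltn_sub2l => //.
  by apply: leq_trans ltB _; apply: sgcard_le.
pose b' (i : 'I_r.+1) := oapp b x0 (unlift ord_max i).
have b'l i : b' (widen_ord (leqnSn r) i) = b i.
  have -> : widen_ord (leqnSn r) i = lift ord_max i
    by apply/val_inj; rewrite /= /bump leqNgt ltn_ord.
  by rewrite /b' liftK.
have b'm : b' ord_max = x0 by rewrite /b' unlift_none.
exists r.+1, b'; split=> [i|x Ax]; first by rewrite /b'; case: (unlift _ i).
have prodE (e : {ffun 'I_r.+1 -> 'I_p}) : \prod_(i < r.+1) b' i ^+ e i =
    (\prod_(i < r) b i ^+ [ffun i => e (widen_ord (leqnSn r) i)] i) * x0 ^+ e ord_max.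
  rewrite big_ord_recr /= b'm; congr (_ * _).
  by apply: eq_bigr => i _; rewrite ffunE b'l.
have [e0 [[k Bk] e0U]] := hb x Ax.
have p_gt0 := prime_gt0 pr_p.
pose j : 'I_p := Ordinal (ltn_pmod k p_gt0).
rewrite expg_mod_p -/(val j) in Bk.
pose e1 : {ffun 'I_r.+1 -> 'I_p} := [ffun i => oapp e0 j (unlift ord_max i)].
have e1l : [ffun i => e1 (widen_ord (leqnSn r) i)] = e0.
  apply/ffunP => i; rewrite !ffunE.
  have -> : widen_ord (leqnSn r) i = lift ord_max i
    by apply/val_inj; rewrite /= /bump leqNgt ltn_ord.
  by rewrite liftK.
have e1m : e1 ord_max = j by rewrite ffunE unlift_none.
exists e1; split; first by rewrite prodE e1l e1m invMg -mulgA.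
move=> e; rewrite prodE invMg -mulgA => Be.
have e0E : e0 = [ffun i => e (widen_ord (leqnSn r) i)].
  by apply: e0U; exists (e ord_max).
have jE : j = e ord_max.
  apply: (sgadj_pow_inj nBx0).
  rewrite -e0E in Be; move: Be Bk; move: (_^-1 * x) => y Be Bk.
  have -> : (x0 ^+ j)^-1 * x0 ^+ e ord_max = (x0 ^+ j)^-1 * y * ((x0 ^+ e ord_max)^-1 * y)^-1.
    by rewrite invMg invgK !mulgA mulgK.
  by apply: sgM => //; apply: sgV.
apply/ffunP => i; rewrite ffunE; case: (unliftP ord_max i) => [i' ->|->] /=; last exact: jE.
rewrite e0E ffunE; congr (e _); apply/val_inj; by rewrite /= /bump leqNgt ltn_ord.
Qed.

End FactorBasis.

Lemma morph_one (G G' : groupType) (f : G -> G') : {morph f : x y / x * y} -> f 1 = 1.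
Proof. by move=> fM; apply: (mulgI (f 1)); rewrite -fM !mulg1. Qed.

Lemma morph_inv (G G' : groupType) (f : G -> G') : {morph f : x y / x * y} ->
  {morph f : x / x^-1}.
Proof.
by move=> fM x; apply: (mulgI (f x)); rewrite -fM !mulgV; apply: morph_one.
Qed.

Definition autpre (X : topGroupType) (f : X -> X) (fM : {morph f : x y / x * y})
  (M : subgroup X) : subgroup X.
Proof.
unshelve refine (@Subgroup _ (f @^-1` M) _ _ _) => /=.
- by rewrite morph_one //; apply: sg1.
- by move=> x y Mx My; rewrite fM; apply: sgM.
- by move=> x Mx; rewrite morph_inv //; apply: sgV.
Defined.

Lemma autpre_maximal (X : topGroupType) (f : X -> X) (fM : {morph f : x y / x * y})
    (M : subgroup X) : is_aut f -> maximal_subgroup M -> maximal_subgroup (autpre fM M).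
Proof.
move=> [_ cf [g [fg gf cg]]] [clM nMT maxM].
have gM : {morph g : x y / x * y} by move=> x y; apply: (can_inj fg); rewrite fM !gf.
split.
- have h : closed (f @^-1` M) by apply: (preimage_closed _ clM) => x _; apply: cf.
  exact: h.
- move=> e; apply: nMT; apply/seteqP; split=> // x _.
  by have : sgval (autpre fM M) (g x); [rewrite e|rewrite /= gf].
move=> K clK sMK.
have clK' : closed (autpre gM K : set X).
  have h : closed (g @^-1` K) by apply: (preimage_closed _ clK) => x _; apply: cg.
  exact: h.
case: (maxM (autpre gM K) clK').
- by move=> x Mx; apply: sMK; rewrite /= gf.
- move=> e; left; apply/seteqP; split=> // x Kx /=.
  by rewrite -e /= fg.
- move=> e; right; apply/seteqP; split=> // x _.
  by have : sgval (autpre gM K) (f x); [rewrite e|rewrite /= fg].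
Qed.

Lemma aut_frattini (X : topGroupType) (f : X -> X) x : is_aut f ->
  sgval (frattini X) x -> sgval (frattini X) (f x).
Proof.
move=> af; have [fM _ _] := af; move=> Px M maxM.
by apply: (Px (autpre fM M)); apply: autpre_maximal.
Qed.

Section CompositionSeries.
Variables (p : nat) (X : topGroupType).
Local Notation V := (quotgrp (frattini X)).
Hypotheses (pr_p : prime p) (abV : forall x y : V, x * y = y * x)
  (expV : forall x : V, x ^+ p = 1).
Variables (s : seq V) (sP : forall x, x \in s).
Hypothesis closedV : forall A : set V, closed A.

Lemma aut_invariant_triv : aut_invariant (trivsg V).
Proof. by move=> f af x /= /coset_eq1 Px; apply/coset_eq1; apply: aut_frattini. Qed.

(** A proper invariant subgroup [B] of [A] of largest cardinality makes the top factor irreducible;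
    induction continues below [B]. *)
Lemma invariant_series (A : subgroup V) : aut_invariant A ->
  exists (k : nat) (W : nat -> subgroup V),
  [/\ (W 0 : set V) = [set 1], (W k : set V) = A &
      forall i, i < k -> irreducible_factor (W i.+1) (W i)].
Proof.
have [m] := ubnP (sgcard sP A); elim: m => // m IHm in A *; move=> ltm invA.
case: (pselect ((A : set V) = [set 1])) => [A1|nA1].
  by exists 0, (fun=> A).
pose P n := `[< exists B : subgroup V,
  [/\ aut_invariant B, B `<=` A, ~ (A `<=` B) & sgcard sP B = n] >].
have exP : exists n, P n.
  exists (sgcard sP (trivsg V)); apply/asboolP; exists (trivsg V); split=> //.
  - exact: aut_invariant_triv.
  - by move=> _ ->; apply: sg1.
  - by move=> sA1; apply: nA1; apply/seteqP; split=> // _ ->; apply: sg1.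
have ubP n : P n -> n <= sgcard sP A.
  by move=> /asboolP[B [_ sBA _ <-]]; apply: sgcard_le.
have [n /asboolP[B [invB sBA nsAB Bn]] maxn] := ex_maxnP exP ubP.
have [x [Ax nBx]] : exists x, sgval A x /\ ~ sgval B x.
  by apply: contrapT => h; apply: nsAB => x Ax; apply: contrapT => nBx; apply: h; exists x.
have ltBm : sgcard sP B < m by apply: leq_trans (ltm : _ <= m); apply: sgcard_lt Ax nBx.
have [k [W [W0 Wk Wf]]] := IHm B ltBm invB.
exists k.+1, (fun i => if i <= k then W i else A); split=> //; first by rewrite ltnn.
move=> i; rewrite ltnS => lik; rewrite lik.
case: (ltngtP i k) lik => // [lik|eik] _.
  exact: Wf.
have eWB : (W i : set V) = B by rewrite eik.
rewrite /irreducible_factor eWB; split=> //.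
move=> U clU invU sBU sUA; case: (pselect (A `<=` U)) => [sAU|nsAU].
  by right; apply/seteqP.
left; apply/seteqP; split=> // y Uy; apply: contrapT => nBy.
have PU : P (sgcard sP U) by apply/asboolP; exists U.
by have := maxn _ PU; rewrite leqNgt -Bn (sgcard_lt sP sBU Uy nBy).
Qed.

Lemma is_c_exists : exists n, is_c p X n.
Proof.
have invT : aut_invariant (sgT V) by [].
have [k [W [W0 Wk Wf]]] := invariant_series invT.
have /choice [r hr] : forall i, exists r, i < k -> factor_dim p (W i.+1) (W i) r.
  move=> i; case: (ltnP i k) => [lik|_]; last by exists 0.
  have [_ _ [sB _] _] := Wf i lik.
  by have [r [b hb]] := factor_basis pr_p abV expV sP sB; exists r => _; exists b.
exists (\max_(i < k) r i); exists k, W, r; split=> //.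
by move=> i lik; split; [apply: Wf|apply: hr].
Qed.

End CompositionSeries.

Section FrattiniProfinite.
Variable X : topGroupType.
Hypothesis pX : profinite X.

(** Some finite image of the closed proper subgroup [M] is proper; the preimage of that image
    contains [M] and so equals it by maximality. Thus the Frattini subgroup can be read off in
    finite images. *)
Lemma maximal_subgroup_imf (M : subgroup X) : maximal_subgroup M ->
  exists (F : finGroupType) (f : fhom X F),
    maximal (imf f M) (imf f (sgT X)) /\ (forall x, f x \in imf f M -> sgval M x).
Proof.
move=> [clM nMT maxM].
have [x nMx] : exists x, ~ sgval M x.
  by apply: contrapT => h; apply: nMT; apply/seteqP; split=> // x _;
    apply: contrapT => nMx; apply: h; exists x.
have [F [f nfx]] : exists (F : finGroupType) (f : fhom X F), f x \notin imf f M.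
  apply: contrapT => h; apply: nMx; apply: (closed_imf pX clM) => F f.
  by apply: contrapT => /negP nfx; apply: h; exists F, f.
have sat (K : {group F}) : imf f M \subset K ->
    (sgpre f K : set X) = M \/ (sgpre f K : set X) = setT.
  move=> sMK; apply: maxM; first exact: sgpre_closed.
  by move=> y My; apply: (fintype.subsetP sMK); apply: mem_imf.
have eM : (sgpre f [group of imf f M] : set X) = M.
  case: (sat [group of imf f M] (fintype.subxx _)) => // e.
  by case/negP: nfx; have : sgval (sgpre f [group of imf f M]) x by rewrite e.
exists F, f; split; last by move=> y fy;
  have : sgval (sgpre f [group of imf f M]) y by []; rewrite eM.
apply/maxgroupP; split.
  apply/fintype.properP; split; first exact: imfS.
  by exists (f x) => //; apply: mem_imf.
move=> K /fintype.properP[sKT [_ /imfP[y _ <-] nKy]] sMK.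
apply/eqP; rewrite finset.eqEsubset sMK andbT; apply/fintype.subsetP => z Kz.
have /imfP[t _ tz] := fintype.subsetP sKT z Kz.
case: (sat K sMK) => e.
  have : sgval (sgpre f K) t by rewrite /= tz.
  by rewrite e => Mt; rewrite -tz; apply: mem_imf.
case/negP: nKy; have : sgval (sgpre f K) y by rewrite e.
by [].
Qed.

Lemma imf_maximal_subgroup (F : finGroupType) (f : fhom X F) (K : {group F}) :
  maximal K (imf f (sgT X)) -> maximal_subgroup (sgpre f K).
Proof.
move=> maxK; have /fintype.properP[sKT [_ /imfP[y _ <-] nKy]] := maxgroupp maxK.
split; first exact: sgpre_closed.
  by move=> e; case/negP: nKy; have : sgval (sgpre f K) y by rewrite e.
move=> L clL sKL.
have sKL' : K \subset imf f L.
  apply/fintype.subsetP => z Kz; have /imfP[t _ tz] := fintype.subsetP sKT z Kz.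
  by rewrite -tz; apply: mem_imf; apply: sKL; rewrite /= tz.
have kerL x : f x = 1 -> sgval L x by move=> fx; apply: sKL; rewrite /= fx group1.
have LE x : f x \in imf f L -> sgval L x.
  move=> /imfP[z Lz zx]; rewrite -(mulKVg z x); apply: sgM => //.
  by apply: kerL; rewrite fhM fhV zx mulVg.
case: (eqVproper (imfS f (_ : L `<=` sgT X))) => // [e|lt].
  by right; apply/seteqP; split=> // x _; apply: LE; rewrite e mem_imf.
left; apply/seteqP; split=> x Lx; last exact: sKL.
have /= <- := (maxgroupP maxK).2 [group of imf f L] lt sKL'.
exact: mem_imf.
Qed.

Lemma imf_frattini (F : finGroupType) (f : fhom X F) :
  imf f (frattini X) \subset 'Phi(imf f (sgT X)).
Proof.
apply/bigcapsP => K; case/predU1P => [->|maxK]; first exact: imfS.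
apply/fintype.subsetP => _ /imfP[x Px <-].
exact: (Px _ (imf_maximal_subgroup maxK)).
Qed.

Lemma frattini_closed : closed (frattini X : set X).
Proof. by apply: closed_bigI => M []. Qed.

End FrattiniProfinite.

Definition sgcomp (G G' : groupType) (f : G -> G') (fM : {morph f : x y / x * y})
  (M : subgroup G') : subgroup G.
Proof.
unshelve refine (@Subgroup _ (f @^-1` M) _ _ _) => /=.
- by rewrite morph_one //; apply: sg1.
- by move=> x y Mx My; rewrite fM; apply: sgM.
- by move=> x Mx; rewrite morph_inv //; apply: sgV.
Defined.

Section FrattiniProp.
Variables (p : nat) (X : topGroupType).
Hypotheses (pr_p : prime p) (ppX : pro_p p X).
Local Notation V := (quotgrp (frattini X)).

Let pX : profinite X := ppX.1.

Lemma frattini_Phi x :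
  (forall (F : finGroupType) (f : fhom X F), f x \in 'Phi(imf f (sgT X))) ->
  sgval (frattini X) x.
Proof.
move=> hx M /(maximal_subgroup_imf pX)[F [f [maxM fM]]]; apply: fM.
by apply: (fintype.subsetP (Phi_sub_max maxM)); apply: hx.
Qed.

Lemma pro_p_imf (F : finGroupType) (f : fhom X F) : p.-group (imf f (sgT X)).
Proof. exact: (pro_pP pr_p pX).1. Qed.

Lemma Frattini_quot_abel (a b : V) : a * b = b * a.
Proof.
elim/coset_ind: a => x; elim/coset_ind: b => y.
rewrite -!cosetM; apply/coset_eqP; apply: frattini_Phi => F f.
have -> : (x * y)^-1 * (y * x) = [~ y, x] by rewrite commgEl conjgE invMg !mulgA.
rewrite fhR (Phi_joing (pro_p_imf f)).
apply: (fintype.subsetP (joing_subl _ _)); rewrite derg1 mem_commg //; exact: mem_imf.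
Qed.

Lemma Frattini_quot_exp (a : V) : a ^+ p = 1.
Proof.
elim/coset_ind: a => x.
have e m : Defs.coset (frattini X) x ^+ m = Defs.coset (frattini X) (x ^+ m).
  by elim: m => // m IHm; rewrite !expgS IHm cosetM.
have ef (F : finGroupType) (f : fhom X F) m : f (x ^+ m) = f x ^+ m.
  by elim: m => [|m IHm]; [rewrite !expg0 fh1|rewrite !expgS fhM IHm].
rewrite e; apply/coset_eq1; apply: frattini_Phi => F f.
rewrite (Phi_joing (pro_p_imf f)) ef.
apply: (fintype.subsetP (joing_subr _ _)).
rewrite -[p in _ ^+ p]expn1; apply: Mho_p_elt; first exact: mem_imf.
by apply: mem_p_elt (pro_p_imf f) _; apply: mem_imf.
Qed.

Let abV := Frattini_quot_abel.
Let expV := Frattini_quot_exp.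

Lemma Frattini_quot_hausdorff : hausdorff_space V.
Proof. by have [] := quotgrp_profinite pX (@frattini_closed X). Qed.

Lemma finite_sgadj (B : subgroup V) (v : V) : finite_set (B : set V) ->
  finite_set (sgadj pr_p abV expV B v : set V).
Proof.
move=> finB.
apply: (sub_finite_set (B := (fun z : V * nat => v ^+ z.2 * z.1) @` (B `*` `I_p))).
  move=> y [i Bi]; exists ((v ^+ i)^-1 * y, (i %% p)%N) => /=.
    by split=> //=; rewrite ltn_mod prime_gt0.
  by rewrite -(expg_mod_p expV) mulKVg.
by apply: finite_image; apply: finite_setX => //; apply: finite_II.
Qed.

Lemma finV_closed (A : set V) : finite_set A -> closed A.
Proof.
have [h _] := @accessible_finite_set_closed V.
exact: (h (hausdorff_accessible Frattini_quot_hausdorff) A).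
Qed.

(** The images of the generators generate, as an abstract group of exponent [p], a finite subgroup
    [B]. Being finite it is closed, so its preimage is a closed subgroup containing the
    generators. *)
Lemma Frattini_quot_finite : finitely_generated X -> finite_set [set: V].
Proof.
move=> [s gs].
have [B [finB sB]] : exists B : subgroup V, finite_set (B : set V) /\
    forall x, x \in s -> sgval B (Defs.coset (frattini X) x).
  elim: s {gs} => [|x s [B [finB sB]]]; first by exists (trivsg V); split=> //; apply: finite_set1.
  exists (sgadj pr_p abV expV B (Defs.coset (frattini X) x)); split; first exact: finite_sgadj.
  move=> y; rewrite inE => /orP[/eqP->|/sB By].
    by exists 1%N; rewrite expg1 mulVg; apply: sg1.
  by exists 0; rewrite expg0 invg1 mul1g.
suff <- : (B : set V) = setT by [].
apply/seteqP; split=> // a _; elim/coset_ind: a => x.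
have clB : closed (B : set V).
  exact: finV_closed.
have BM : {morph Defs.coset (frattini X) : x y / x * y} by move=> ? ?; rewrite cosetM.
have clK : closed (sgcomp BM B : set X).
  have h : closed (Defs.coset (frattini X) @^-1` B).
    by apply: (preimage_closed _ clB) => y _; apply: coset_continuous.
  exact h.
have : sgval (generated [set` s]) x by rewrite gs.
by move=> /(_ (sgcomp BM B)); apply; split.
Qed.

(** Guarantees that [cval] comes from an actual series and is not the default value 0, so a bound on
    it bounds the factors. *)
Lemma is_c_cval : finitely_generated X -> is_c p X (cval p X).
Proof.
move=> fgX; have finV := Frattini_quot_finite fgX.
have [s es] := (finite_seqP _).1 finV.
have sP (x : V) : x \in s by have : [set` s] x by rewrite -es.
apply: (@xgetPex _ 0 [set n | is_c p X n]).
apply: (is_c_exists pr_p abV expV sP) => A.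
apply: finV_closed.
exact: (sub_finite_set (@subsetT _ _) finV).
Qed.

Lemma frattini_open : finitely_generated X -> open (frattini X : set X).
Proof.
move=> fgX; have finV := Frattini_quot_finite fgX.
have clV : closed (~` [set (1 : V)]).
  apply: finV_closed.
  exact: (sub_finite_set (@subsetT _ _) finV).
have oV : open [set (1 : V)] by rewrite -[X in open X]setCK; apply: closed_openC.
have -> : (frattini X : set X) = Defs.coset (frattini X) @^-1` [set 1]%classic.
  by apply/seteqP; split=> x /coset_eq1.
by apply: open_comp => // x _; apply: coset_continuous.
Qed.

End FrattiniProp.

Section SubgroupLift.
Variables (G : topGroupType) (H : subgroup G).

Lemma subgrp_val1 : val (1 : subgrp H) = 1 :> G.
Proof. exact: val1. Qed.

Lemma subgrp_valM (x y : subgrp H) : val (x * y) = val x * val y :> G.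
Proof. exact: valM. Qed.

Lemma subgrp_valV (x : subgrp H) : val x^-1 = (val x)^-1 :> G.
Proof. by apply: (mulgI (val x)); rewrite -subgrp_valM !mulgV subgrp_val1. Qed.

Definition valsg (Y : subgroup (subgrp H)) : subgroup G.
Proof.
unshelve refine (@Subgroup _ ((val : subgrp H -> G) @` Y) _ _ _) => /=.
- by exists 1; [apply: sg1|apply: subgrp_val1].
- by move=> _ _ [x Yx <-] [y Yy <-]; exists (x * y); [apply: sgM|apply: subgrp_valM].
- by move=> _ [x Yx <-]; exists x^-1; [apply: sgV|apply: subgrp_valV].
Defined.

Lemma imf_valsg (F : finGroupType) (f : fhom G F) (Y : subgroup (subgrp H)) :
  imf f (valsg Y) = imf (fres H f) Y.
Proof. by rewrite imf_fres. Qed.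

Lemma imf_fresT (F : finGroupType) (f : fhom G F) : imf (fres H f) (sgT (subgrp H)) = imf f H.
Proof.
rewrite imf_fres; congr imf; apply/seteqP; split=> [_ [x _ <-]|x Hx].
  exact: set_mem (valP x).
by exists (exist _ x (mem_set Hx)).
Qed.

Lemma conj_val_subproof g (s : subgrp H) : sgval (normsg H) g -> val s ^ g \in (H : set G).
Proof. by move=> Ng; apply/mem_set; apply: (Ng _ (set_mem (valP s))).1. Qed.

Definition conj_subgrp g (Ng : sgval (normsg H) g) (s : subgrp H) : subgrp H :=
  exist _ (val s ^ g) (conj_val_subproof s Ng).

Lemma conj_subgrp_continuous g (Ng : sgval (normsg H) g) : continuous (conj_subgrp Ng).
Proof.
apply: continuous_subgrp => x.
apply: (@continuous_comp _ _ _ (val : subgrp H -> G) (fun y => y ^ g)).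
  exact: subgrp_val_continuous.
exact: conjg_continuous.
Qed.

(** Through this, invariance under [Aut(S)] becomes invariance under the normaliser of [S] in
    [G]. *)
Lemma conj_subgrp_aut g (Ng : sgval (normsg H) g) : is_aut (conj_subgrp Ng).
Proof.
have Ng' := sgV Ng.
split; last (exists (conj_subgrp Ng'); split).
- by move=> x y; apply: val_inj; rewrite subgrp_valM -[RHS]conjMg.
- exact: conj_subgrp_continuous.
- by move=> x; apply: val_inj; rewrite /= conjgK.
- by move=> x; apply: val_inj; rewrite /= conjgKV.
- exact: conj_subgrp_continuous.
Qed.

End SubgroupLift.

(** * The invariant series of a Sylow subgroup in finite images *)

Section SylowSeries.
Variables (r n : nat) (G : topGroupType) (S : subgroup G).
Hypotheses (pr_r : prime r) (pG : profinite G) (sylS : is_sylow r S).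
Local Notation X := (subgrp S).
Local Notation V := (quotgrp (frattini X)).

Let clS : closed (S : set G).
Proof. exact: ((is_sylowP S pr_r pG).1 sylS).1. Qed.

Let sylf (F : finGroupType) (f : fhom G F) : r.-Sylow(imf f (sgT G)) (imf f S).
Proof. exact: ((is_sylowP S pr_r pG).1 sylS).2. Qed.

Let pX : profinite X := subgrp_profinite pG clS.

Let ppX : pro_p r X.
Proof. by case: sylS. Qed.

Definition series_lift (W : nat -> subgroup V) i : subgroup G :=
  valsg (sgcomp (@cosetM _ (frattini X)) (W i)).

Lemma irreducible_factor_index (W : nat -> subgroup V) i m (F : finGroupType) (f : fhom G F) :
  W i `<=` W i.+1 -> factor_dim r (W i.+1) (W i) m ->
  #|imf f (series_lift W i.+1) : imf f (series_lift W i)| <= r ^ m.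
Proof.
move=> sW [b [_ hb]].
rewrite /series_lift !imf_valsg.
set Y := sgcomp _ (W i.+1); set Z := sgcomp _ (W i).
pose t (e : {ffun 'I_m -> 'I_r}) : X := generic_quotient.repr (\prod_(j < m) b j ^+ e j : V).
pose g e := fres S f (t e) *: imf (fres S f) Z.
rewrite -card_lcosets.
have sub : lcosets (imf (fres S f) Z) (imf (fres S f) Y) \subset
    [set g e | e : {ffun 'I_m -> 'I_r}].
  apply/fintype.subsetP => _ /lcosetsP[_ /imfP[x Yx <-] ->].
  have [e [he _]] := hb _ Yx.
  apply/imsetP; exists e => //; apply/lcoset_eqP; rewrite mem_lcoset -fhV -fhM.
  apply: mem_imf; rewrite /Z /= cosetM cosetV.
  by have -> : Defs.coset (frattini X) (t e) = \prod_(j < m) b j ^+ e j by apply: coset_repr.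
apply: leq_trans (subset_leq_card sub) _; apply: leq_trans (leq_imset_card _ _) _.
by rewrite card_ffun !card_ord.
Qed.

Hypotheses (fgX : finitely_generated X) (cX : cval r X <= n).

Lemma der1_sub_cent_Sylow (F : finGroupType) (f : fhom G F) (A T : {group F}) :
  normal A (imf f (sgT G)) -> r^'.-nat #|imf f (sgT G) : A| -> T \subset imf f (sgT G) ->
  (forall q, prime q -> q %| #|T| -> n < q) ->
  T^`(1) \subset (imf f (sgT G) :&: 'C(imf f S)) * A.
Proof.
move=> nsA r'A sT bigT.
have [k [W [m [W0 Wk clW Wf defc]]]] := is_c_cval pr_r ppX fgX.
have mle i : i < k -> m i <= n.
  move=> lik; apply: leq_trans cX; rewrite defc.
  exact: (leq_bigmax (F := fun i : 'I_k => m i) (Ordinal lik)).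
have invW i : i <= k -> aut_invariant (W i).
  case: i => [_|i lik]; first by rewrite W0; apply: aut_invariant_triv.
  by have [[]] := Wf i lik.
have sW i : i < k -> W i `<=` W i.+1 by move=> lik; have [[_ _ []]] := Wf i lik.
pose Wb i := [group of imf f (series_lift W i)].
apply: (@der1_sub_cent_mul _ [group of imf f (sgT G)] A [group of imf f S] T Wb r n k) => //.
- exact: sylf.
- change (imf f (series_lift W 0) \subset 'Phi(imf f S)).
  rewrite /series_lift imf_valsg -imf_fresT.
  apply: (fintype.subset_trans _ (imf_frattini (fres S f))); apply: imfS => x /=.
  by rewrite W0 => /coset_eq1.
- apply/val_inj; change (imf f (series_lift W k) = imf f S).
  rewrite /series_lift imf_valsg -imf_fresT; congr imf.
  by apply/seteqP; split=> x //= _; rewrite Wk.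
- by move=> i lik; apply: imfS => _ [x Wx <-]; exists x => //; apply: (sW i lik).
- move=> i lik; have [_ dimW] := Wf i lik.
  apply: leq_trans (irreducible_factor_index f (sW i lik) dimW) _.
  by rewrite leq_exp2l ?prime_gt1 // mle.
(* Elements normalising the image of [S] lift to the normaliser of [S], where conjugation is an
   automorphism and preserves the series. *)
move=> i lik; apply: fintype.subset_trans (imf_normsg pr_r pG clS sylf f) _.
apply/fintype.subsetP => _ /imfP[g Ng <-]; rewrite finset.inE.
apply/fintype.subsetP => _ /imsetP[_ /imfP[_ [x Wx <-] <-] ->].
rewrite -fhJ; apply: mem_imf; exists (conj_subgrp Ng x) => //.
exact: (invW i lik _ (conj_subgrp_aut Ng)).
Qed.

End SylowSeries.

(** * Virtual p-nilpotence *)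

Definition finer (G : topGroupType) (F F' : finGroupType) (f : fhom G F) (g : fhom G F') :=
  forall x, f x = 1 -> g x = 1.

Lemma finer_pairl (G : topGroupType) (F F' : finGroupType) (f : fhom G F) (g : fhom G F') :
  finer (fpair f g) f.
Proof. by move=> x /fpair_ker[]. Qed.

Lemma finer_pairr (G : topGroupType) (F F' : finGroupType) (f : fhom G F) (g : fhom G F') :
  finer (fpair f g) g.
Proof. by move=> x /fpair_ker[]. Qed.

Lemma finer_eq (G : topGroupType) (F F' : finGroupType) (f : fhom G F) (g : fhom G F') x y :
  finer f g -> f x = f y -> g x = g y.
Proof.
move=> fg e; apply: (mulgI (g y)^-1); rewrite mulVg -fhV -fhM; apply: fg.
by rewrite fhM fhV e mulVg.
Qed.

Lemma finer_morphim (G : topGroupType) (F F' : finGroupType) (f : fhom G F) (g : fhom G F')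
    (H : subgroup G) : finer f g ->
  exists phi : {morphism (imf f H) >-> F'}, (forall x, sgval H x -> phi (f x) = g x) /\
    forall X : set G, X `<=` H -> phi @* imf f X = imf g X.
Proof.
move=> fg; have [phi phiE] := factor_fhom (H := H) (fun x _ => fg x).
by exists phi; split=> // X sXH; apply: morphim_factor.
Qed.

Lemma finer_index (G : topGroupType) (F F' : finGroupType) (f : fhom G F) (g : fhom G F')
    (H K : subgroup G) : finer f g -> K `<=` H ->
  #|imf g H : imf g K| %| #|imf f H : imf f K|.
Proof.
move=> fg sKH; have [phi [_ phiE]] := finer_morphim H fg.
by rewrite -(phiE H) // -(phiE K) //; apply: index_morphim; apply: finset.subsetIl.
Qed.

Lemma imf_normal (G : topGroupType) (F : finGroupType) (f : fhom G F) (M : subgroup G) :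
  is_normal M ->
  normal (imf f M) (imf f (sgT G)).
Proof.
move=> nM; apply/andP; split; first exact: imfS.
apply/fintype.subsetP => _ /imfP[g _ <-]; rewrite finset.inE.
apply/fintype.subsetP => _ /imsetP[_ /imfP[x Mx <-] ->].
by rewrite -fhJ; apply: mem_imf; apply: nM.
Qed.

(** * Inverse limits of the pi-cores of finite images *)

Section ProfiniteCore.
Variables (pi : nat_pred) (G : topGroupType) (N : normalSubgroup G).
Hypotheses (pG : profinite G) (clN : closed (N : set G)).

Definition pcoresg : normalSubgroup G.
Proof.
unshelve refine (@NormalSubgroup _ (@Subgroup _
  [set x | forall (F : finGroupType) (f : fhom G F), f x \in pcore pi (imf f N)] _ _ _) _) => /=.
- by move=> F f; rewrite fh1 group1.
- by move=> x y hx hy F f; rewrite fhM groupM.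
- by move=> x hx F f; rewrite fhV groupV.
- move=> x y /= hx F f; rewrite fhJ memJ_norm //.
  have := char_norm_trans (pcore_char pi [group of imf f N])
    (normal_norm (imf_normal f (@nsJ _ N))).
  by move/fintype.subsetP; apply; apply: mem_imf.
Defined.

Lemma pcoresg_closed : closed (pcoresg : set G).
Proof.
move=> x clx F f.
have cM : closed (f @^-1` [set y | y \in pcore pi (imf f N)]) by apply: fh_pre_closed.
apply: cM; apply: closure_subset clx => y /= hy; exact: hy.
Qed.

Lemma pcoresg_sub : pcoresg `<=` N.
Proof.
move=> x hx; apply: (closed_imf pG clN) => F f.
exact: (fintype.subsetP (pcore_sub _ _) _ (hx F f)).
Qed.

Lemma pcoresg_pgroup (F : finGroupType) (f : fhom G F) : pi.-group (imf f pcoresg).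
Proof.
apply: pgroupS (pcore_pgroup pi (imf f N)).
by apply/fintype.subsetP => _ /imfP[x hx <-]; apply: hx.
Qed.

Variables (F0 : finGroupType) (f0 : fhom G F0).
Hypothesis hallN : forall (F : finGroupType) (f : fhom G F), finer f f0 ->
  pi.-Hall(imf f N) (pcore pi (imf f N)).

(** When the cores are Hall subgroups, passing to a coarser image maps core onto core; compactness
    then lifts an element of one core to the inverse limit. *)
Lemma imf_pcoresg (F : finGroupType) (f : fhom G F) : finer f f0 ->
  pcore pi (imf f N) \subset imf f pcoresg.
Proof.
move=> ff0; apply/fintype.subsetP => y Oy.
pose E (F' : finGroupType) (h : fhom G F') :=
  [set x : G | f x = y /\ h x \in pcore pi (imf h N)].
have [|||x hx] := @fhom_compact G pG E.
- move=> F' h.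
  have -> : E F' h = (f @^-1` [set y]%classic) `&` (h @^-1` [set z | z \in pcore pi (imf h N)]).
    by apply/seteqP; split.
  by apply: closedI; apply: fh_pre_closed.
- move=> F' h; pose e := fpair f h.
  have ef : finer e f := @finer_pairl _ _ _ f h.
  have eh : finer e h := @finer_pairr _ _ _ f h.
  have [phi [phiE phiI]] := finer_morphim N ef.
  have [psi [psiE psiI]] := finer_morphim N eh.
  have ef0 : finer e f0 by move=> x /ef/ff0.
  have hallO := hallN ef0.
  have sO : pcore pi (imf e N) \subset imf e N := pcore_sub _ _.
  have e1 : phi @* pcore pi (imf e N) = pcore pi (imf f N).
    have nO : normal (phi @* pcore pi (imf e N)) (imf f N).
      by rewrite -(phiI N) //; apply: morphim_normal; apply: pcore_normal.
    have hO : pi.-Hall(imf f N) (phi @* pcore pi (imf e N)).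
      by rewrite -(phiI N) //; apply: morphim_pHall.
    by rewrite (normal_Hall_pcore hO nO).
  move: Oy; rewrite -e1 => /morphimP[z eNz Oz yz].
  have /imfP[x Nx xz] := eNz.
  exists x; split; first by rewrite yz -xz phiE.
  rewrite -psiE // xz; have := morphim_pcore pi (imf e N) psi.
  rewrite psiI // => /fintype.subsetP; apply; exact: mem_morphim.
- move=> F1 F2 h1 h2 h12 x [fx hx]; split=> //.
  have [psi [psiE psiI]] := finer_morphim N h12.
  have /imfP[x' Nx' xx'] := fintype.subsetP (pcore_sub _ _) _ hx.
  rewrite -(finer_eq h12 xx') -psiE //.
  have := morphim_pcore pi (imf h1 N) psi.
  rewrite psiI // => /fintype.subsetP; apply; apply: mem_morphim; last by rewrite xx'.
  exact: mem_imf.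
apply/imfP; exists x; last by have [] := hx _ f.
by move=> F' h; have [] := hx _ h.
Qed.

Lemma pcoresg_index (F : finGroupType) (f : fhom G F) :
  pi^'.-nat #|imf f N : imf f pcoresg|.
Proof.
pose e := fpair f f0.
have ef : finer e f := @finer_pairl _ _ _ f f0.
have ef0 : finer e f0 := @finer_pairr _ _ _ f f0.
apply: pnat_dvd (finer_index ef pcoresg_sub) _.
apply: pnat_dvd (indexgS _ (imf_pcoresg ef0)) _.
by have /and3P[] := hallN ef0.
Qed.

End ProfiniteCore.

Section VirtuallyPnilpotent.
Variables (p : nat) (G : topGroupType) (S : subgroup G).
Hypotheses (pr_p : prime p) (pG : profinite G) (sylS : is_sylow p S).
Hypothesis fgS : finitely_generated (subgrp S).

Let sylf (F : finGroupType) (f : fhom G F) : p.-Sylow(imf f (sgT G)) (imf f S).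
Proof. exact: ((is_sylowP S pr_p pG).1 sylS).2. Qed.

Lemma exists_ker_frattini : exists (F0 : finGroupType) (f0 : fhom G F0),
  forall s : subgrp S, f0 (val s) = 1 -> sgval (frattini (subgrp S)) s.
Proof.
have ppS : pro_p p (subgrp S) by case: sylS.
(* Finite generation is what makes the Frattini subgroup open in [S]. *)
have [B oB BE] := frattini_open pr_p ppS fgS.
have B1 : nbhs 1 B.
  apply: open_nbhs_nbhs; split=> //.
  have : (val @^-1` B) (1 : subgrp S) by rewrite BE; apply: sg1.
  by rewrite -(subgrp_val1 S).
have [F0 [f0 f0B]] := fhom_basis pG B1.
exists F0, f0 => s /f0B Bs.
by have : (val @^-1` B) s by []; rewrite BE.
Qed.

Variables (F0 : finGroupType) (f0 : fhom G F0).
Hypothesis f0P : forall s : subgrp S, f0 (val s) = 1 -> sgval (frattini (subgrp S)) s.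
Let N : normalSubgroup G := kerf f0.

Lemma Tate_imf (F : finGroupType) (f : fhom G F) : finer f f0 ->
  p^'.-Hall(imf f N) (pcore p^' (imf f N)).
Proof.
move=> ff0; apply: (Sylow_Phi_pnilpotent pr_p (sylf f) (imf_normal f (@nsJ _ N))).
apply/fintype.subsetP => _ /finset.setIP[/imfP[x /= Nx <-] /imfP[s Ss sx]].
(* Since [f] is finer than [f0], the representative [s] of the common image is itself killed by
   [f0], hence lies in the Frattini subgroup of [S]. *)
have f0s : f0 s = 1 by rewrite (finer_eq ff0 sx).
pose s' : subgrp S := exist _ s (mem_set Ss).
have := fintype.subsetP (imf_frattini (fres S f)) (fres S f s').
rewrite imf_fresT /= sx; apply; rewrite -sx.
by apply: (mem_imf (fres S f) (x := s')); apply: f0P.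
Qed.

End VirtuallyPnilpotent.

Lemma imf_kerf_index (G : topGroupType) (F0 F : finGroupType) (f0 : fhom G F0) (f : fhom G F) :
  #|imf f (sgT G) : imf f (kerf f0)| %| #|imf f0 (sgT G)|.
Proof.
pose e := fpair f f0.
have ef : finer e f := @finer_pairl _ _ _ f f0.
have ef0 : finer e f0 := @finer_pairr _ _ _ f f0.
apply: dvdn_trans (finer_index ef (_ : kerf f0 `<=` sgT G)) _ => //.
have [phi [phiE phiI]] := finer_morphim (sgT G) ef0.
have -> : imf e (kerf f0) = 'ker phi.
  apply/setP => y; apply/imfP/idP => [[x /= fx <-]|ky].
    have eG : e x \in imf e (sgT G) by apply: mem_imf.
    by apply/(kerP phi eG); rewrite phiE.
  have /imfP[x _ xy] := dom_ker ky.
  exists x => //=; rewrite -phiE // xy; exact: mker.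
by rewrite -(phiI (sgT G)) // card_morphim finset.setIid.
Qed.

(* [A] is a pro-p' group, [M / A] is a pro-p group and [G / M] has order dividing
   [m], all read off in the finite images. *)
Record pnil_pair (p : nat) (G : topGroupType) (m : nat) (M A : normalSubgroup G) : Prop :=
  PnilPair {
    pnil_open : open (M : set G);
    pnil_closed : closed (A : set G);
    pnil_sub : A `<=` M;
    pnil_p' : forall (F : finGroupType) (f : fhom G F), p^'.-group (imf f A);
    pnil_p : forall (F : finGroupType) (f : fhom G F), p.-nat #|imf f M : imf f A|;
    pnil_gt0 : 0 < m;
    pnil_index : forall (F : finGroupType) (f : fhom G F), #|imf f (sgT G) : imf f M| %| m
  }.

Lemma virtually_pnilpotent (p : nat) (G : topGroupType) (S : subgroup G) :
  prime p -> profinite G -> is_sylow p S -> finitely_generated (subgrp S) ->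
  exists m M A, @pnil_pair p G m M A.
Proof.
move=> pr_p pG sylS fgS.
have [F0 [f0 f0P]] := exists_ker_frattini pr_p pG sylS fgS.
have clN : closed (kerf f0 : set G).
  have h := fh_pre_closed f0 [set 1]%classic; exact h.
have hall := Tate_imf pr_p pG sylS f0P.
exists #|imf f0 (sgT G)|, (kerf f0), (pcoresg p^' (kerf f0)); split.
- exact: fh_open.
- exact: pcoresg_closed.
- exact: pcoresg_sub.
- by move=> F f; apply: pcoresg_pgroup.
- move=> F f; rewrite -pnatNK; exact: (pcoresg_index pG clN hall).
- exact: cardG_gt0.
- by move=> F f; apply: imf_kerf_index.
Qed.

Lemma pnil_index_p' (p r m : nat) (G : topGroupType) (M A : normalSubgroup G)
    (F : finGroupType) (f : fhom G F) :
  pnil_pair p m M A -> prime r -> r != p -> ~~ (r %| m) ->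
  r^'.-nat #|imf f (sgT G) : imf f A|.
Proof.
move=> MA pr_r rp rm; have sA := pnil_sub MA.
rewrite -(Lagrange_index (imfS f (_ : M `<=` sgT G)) (imfS f sA)) // pnatM.
apply/andP; split.
  by rewrite p'natE //; apply: contra rm => /dvdn_trans; apply; apply: (pnil_index MA).
by apply: sub_in_pnat (pnil_p MA f) => q _ /eqP ->; rewrite !inE eq_sym.
Qed.

(** * The generalised Fitting subgroup *)

Lemma sub_generated (G : topGroupType) (A : set G) : A `<=` generated A.
Proof. by move=> x Ax K [_]; apply. Qed.

Section GeneralisedFitting.
Variable K : topGroupType.
Hypothesis pK : profinite K.

Lemma O_p_sub_generalised_fitting p (X : subgroup K) : prime p -> closed (X : set K) ->
  is_normal X -> pro_p p (subgrp X) -> X `<=` generalised_fitting K.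
Proof.
move=> pr_p clX nX ppX x Xx; apply: sub_generated; left.
by apply: sub_generated; exists p => //; apply: sub_generated; exists X.
Qed.

Lemma component_sub_generalised_fitting (X : subgroup K) : is_component X ->
  X `<=` generalised_fitting K.
Proof. by move=> cX x Xx; apply: sub_generated; right; apply: sub_generated; exists X. Qed.

(** For a prime [p] dividing the order of a nontrivial image of [X], the [p]-cores of the nilpotent
    images are Sylow subgroups. Their inverse limit is therefore a normal pro-p subgroup with
    nontrivial image. *)
Lemma pronilpotent_fitting (X : normalSubgroup K) x : closed (X : set K) ->
  (forall (F : finGroupType) (f : fhom K F), nilpotent (imf f X)) ->
  sgval X x -> x <> 1 -> ~ fitting_degenerate K.
Proof.
move=> clX nilX Xx nx1 FK; apply: nx1; apply: (fhom_sep pK) => F f.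
have : imf f X == 1%g.
  rewrite trivg_card1 -[_ == _]negbK; apply/negP => cX.
  have c1 : 1 < #|imf f X| by rewrite ltn_neqAle eq_sym cX cardG_gt0.
  have pr_p := pdiv_prime c1; set p := pdiv _ in pr_p.
  have hall (F' : finGroupType) (g : fhom K F') : finer g f ->
      p.-Hall(imf g X) (pcore p (imf g X)).
    by move=> _; apply: (nilpotent_pcore_Hall p (G := [group of imf g X])); apply: nilX.
  have sub : pcoresg p X `<=` [set 1].
    rewrite -FK; apply: (O_p_sub_generalised_fitting pr_p).
    - exact: pcoresg_closed.
    - exact: nsJ.
    - by apply/pro_p_sub => //; [exact: pcoresg_closed|move=> F' g; apply: pcoresg_pgroup].
  have := imf_pcoresg pK hall (f := f) (fun x fx => fx).
  have : pcore p (imf f X) != 1%g.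
    rewrite -cardG_gt1 (card_Hall (hall _ f (fun x fx => fx))) p_part_gt1.
    by rewrite mem_primes pr_p cardG_gt0 pdiv_dvd.
  move=> /trivgPn[z Oz nz] /fintype.subsetP/(_ z Oz)/imfP[t /sub -> ft].
  by rewrite -ft fh1 eqxx in nz.
move/eqP => e; have : f x \in imf f X by apply: mem_imf.
by rewrite e => /set1gP.
Qed.

Section Component.
Variables (F : finGroupType) (f : fhom K F) (C : normalSubgroup K) (M H : {group F}).
Hypotheses (clC : closed (C : set K)) (inj : forall x, sgval C x -> f x = 1 -> x = 1).
Hypotheses (sMC : M \subset imf f C) (nMG : imf f (sgT K) \subset 'N(M)).
Hypotheses (nHM : normal H M) (simH : simple H) (nabH : ~~ abelian H).

Let Q := sgI C (sgpre f H).

Let clQ : closed (Q : set K).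
Proof. by apply: closedI => //; apply: sgpre_closed. Qed.

Let imQ : imf (fres Q f) (sgT (subgrp Q)) = H.
Proof.
rewrite imf_fresT; apply/setP => y; apply/imfP/idP => [[x [_ Hx] <-] //|Hy].
have /imfP[x Cx fx] := fintype.subsetP sMC _ (fintype.subsetP (normal_sub nHM) _ Hy).
by exists x => //; split=> //=; rewrite fx.
Qed.

Let injQ (x : subgrp Q) : fres Q f x = 1 -> x = 1.
Proof.
move=> fx; apply: val_inj; rewrite subgrp_val1.
by apply: inj fx; have [] := set_mem (valP x).
Qed.

Let mapQ (x : subgrp Q) : fres Q f x \in H.
Proof. by rewrite -imQ; apply: mem_imf. Qed.

Let fullQ (L : subgroup (subgrp Q)) : H \subset imf (fres Q f) L -> (L : set (subgrp Q)) = setT.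
Proof.
move=> sHL; apply/seteqP; split=> // x _.
have /imfP[y Ly fxy] := fintype.subsetP sHL _ (mapQ x).
have e1 : y^-1 * x = 1 by apply: injQ; rewrite fhM fhV fxy mulVg.
have -> : x = y by apply: (mulgI y^-1); rewrite e1 mulVg.
exact: Ly.
Qed.

(** As [f] is injective on [C], it identifies [Q] with the nonabelian simple group [H]. Subnormality
    is the chain from [Q] through the preimage of [M] in [C] to [K]. *)
Lemma component_simple_image : is_component Q.
Proof.
split=> //.
- exists 2, (fun i => if i is 0 then Q else if i is 1 then sgI C (sgpre f M) else sgT K).
  split=> //.
    case=> [|[|i]] _; [exact: clQ|apply: closedI => //; exact: sgpre_closed|exact: closedT].
  case=> [|[|//]] _; split=> //.
  + move=> x [Cx Hx]; split=> //; exact: (fintype.subsetP (normal_sub nHM)).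
  + move=> x y [Cx Hx] [Cy My]; split; first exact: nsJ.
    by rewrite /= fhJ memJ_norm //; apply: (fintype.subsetP (normal_norm nHM)).
  + move=> x y [Cx Mx] _; split; first exact: nsJ.
    by rewrite /= fhJ memJ_norm //; apply: (fintype.subsetP nMG); apply: mem_imf.
have [ntH simH'] := simpleP _ simH.
have perfH : H^`(1) = H.
  case: (simH' _ (der_normal 1 H)) => // e; case/negP: nabH.
  by rewrite /abelian; apply/commG1P.
split.
- apply: fullQ; rewrite -perfH gen_subG.
  apply/fintype.subsetP => _ /imset2P[a b Ha Hb ->].
  rewrite -imQ in Ha Hb; move: Ha Hb => /imfP[x _ <-] /imfP[y _ <-].
  by rewrite -fhR; apply: mem_imf; apply: sub_generated; exists x => //; exists y.
split.
- move=> e; case/negP: nabH; apply/centsP => a; rewrite -{1}imQ => /imfP[x _ <-] b.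
  rewrite -{1}imQ => /imfP[y _ <-]; rewrite /commute -!fhM; congr fh.
  have : Defs.coset (centre (subgrp Q)) x = 1.
    have : [set: quotgrp (centre (subgrp Q))] (Defs.coset (centre (subgrp Q)) x) by [].
    by rewrite e.
  by move/coset_eq1; apply.
- move=> N clN nN; set P := sgcomp (@cosetM _ (centre (subgrp Q))) N.
  have nP : normal (imf (fres Q f) P) H.
    rewrite -imQ; apply: imf_normal => x y Px.
    have := nN _ (Defs.coset (centre (subgrp Q)) y) Px.
    by rewrite /P /= !conjgE !cosetM cosetV.
  have [e|e] := simH' _ nP; [left|right].
    apply/seteqP; split=> [a|_ ->]; last exact: sg1.
    elim/coset_ind: a => x Nx; have -> : x = 1.
      apply: injQ; have : fres Q f x \in imf (fres Q f) P by apply: mem_imf.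
      by rewrite e => /set1gP.
    by [].
  apply/seteqP; split=> // a _; elim/coset_ind: a => x.
  have : [set: subgrp Q] x by [].
  by rewrite -(@fullQ P) ?e.
Qed.

End Component.

(** [C] is finite, so its image contains a minimal normal subgroup of the image of [K]. If solvable
    it is elementary abelian and gives a normal pro-p subgroup; otherwise a simple normal subgroup
    of it gives a component. *)
Lemma finite_normal_fitting (F : finGroupType) (f : fhom K F) (C : normalSubgroup K) x :
  closed (C : set K) -> (forall x, sgval C x -> f x = 1 -> x = 1) ->
  sgval C x -> x <> 1 -> ~ fitting_degenerate K.
Proof.
move=> clC inj Cx nx1 FK.
have ntC : [group of imf f C] != 1%g :> {set F}.
  apply/trivgPn; exists (f x); first exact: mem_imf.
  by apply/eqP => /inj e; apply: nx1; apply: e.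
have [M minM sMC] := minnormal_exists ntC (normal_norm (imf_normal f (@nsJ _ C))).
have /andP[ntM nMG] := mingroupp minM.
have triv (Q : {group F}) : Q \subset M -> Q != 1%g :> {set F} ->
    ~ (sgI C (sgpre f Q) `<=` generalised_fitting K).
  move=> sQM /trivgPn[z Qz nz]; rewrite FK => sub.
  have /imfP[y Cy fy] := fintype.subsetP sMC _ (fintype.subsetP sQM _ Qz).
  have y1 : y = 1 by apply: sub; split=> //=; rewrite fy.
  by rewrite -fy y1 fh1 eqxx in nz.
have [solM|nsolM] := boolP (solvable M).
  have [_ _ /is_abelemP[p pr_p abM]] := minnormal_solvable minM (fintype.subxx _) solM.
  apply: (triv M (fintype.subxx _) ntM); apply: (O_p_sub_generalised_fitting pr_p).
  - by apply: closedI => //; apply: sgpre_closed.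
  - move=> y z [Cy My]; split; first exact: nsJ.
    by rewrite /= fhJ memJ_norm //; apply: (fintype.subsetP nMG); apply: mem_imf.
  apply/pro_p_sub => //; first by apply: closedI => //; apply: sgpre_closed.
  move=> F' g.
  have [phi phiE] := factor_fhom (f := f) (g := g) (H := sgI C (sgpre f M))
    (fun y (My : sgval (sgI C (sgpre f M)) y) fy =>
       etrans (congr1 g (inj y My.1 fy)) (fh1 g)).
  rewrite -(morphim_factor phiE) //; apply: morphim_pgroup.
  apply: pgroupS (abelem_pgroup abM).
  by apply/fintype.subsetP => _ /imfP[y [_ My] <-].
have [H [nHM simH nabH]] := minnormal_simple_normal minM nsolM.
apply: (triv H (normal_sub nHM)); first by have [] := simpleP _ simH.
apply: component_sub_generalised_fitting.
exact: (component_simple_image clC inj sMC nMG nHM simH nabH).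
Qed.

Lemma fhom_sep_seq (s : seq K) :
  exists (F : finGroupType) (f : fhom K F), forall x, x \in s -> f x = 1 -> x = 1.
Proof.
elim: s => [|x s [F [f fs]]].
  have [F [f _]] := fhom_basis pK (filterT : nbhs (1 : K) setT).
  by exists F, f.
have [->|/eqP nx1] := eqVneq x 1.
  by exists F, f => y; rewrite inE => /orP[/eqP -> //|/fs].
have [F' [g gx]] : exists (F' : finGroupType) (g : fhom K F'), g x <> 1.
  by apply: contrapT => h; apply: nx1; apply: (fhom_sep pK) => F' g; apply: contrapT => gx;
    apply: h; exists F', g.
exists _, (fpair f g) => y; rewrite inE => /orP[/eqP ->|sy] /fpair_ker[fy gy] //.
exact: fs fy.
Qed.

(** If [X] is nontrivial, it is pronilpotent and suffices. If it is trivial, all elements of [C]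
    occur in [s], and one finite quotient of [K] is injective on [C]. *)
Lemma virtually_pronilpotent_fitting (C X : normalSubgroup K) (s : seq K) x :
  closed (C : set K) -> closed (X : set K) ->
  (forall c, sgval C c -> exists2 t, t \in s & sgval X (t^-1 * c)) ->
  (forall (F : finGroupType) (f : fhom K F), nilpotent (imf f X)) ->
  sgval C x -> x <> 1 -> ~ fitting_degenerate K.
Proof.
move=> clC clX Cs nilX Cx nx1.
have [[y [Xy ny]]|X1] := pselect (exists y, sgval X y /\ y <> 1).
  exact: pronilpotent_fitting nilX Xy ny.
have [F [f fs]] := fhom_sep_seq s.
apply: (finite_normal_fitting clC (f := f) _ Cx nx1) => c /Cs[t st Xtc] fc.
have e : t^-1 * c = 1 by apply: contrapT => h; apply: X1; exists (t^-1 * c).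
have et : c = t by apply: (mulgI t^-1); rewrite e mulVg.
by apply: fs => //; rewrite et.
Qed.

End GeneralisedFitting.

Lemma virtually_pronilpotent_quotient_fitting (H : topGroupType) (N C X : normalSubgroup H)
    (F : finGroupType) (e : fhom H F) x :
  profinite H -> closed (N : set H) -> closed (C : set H) -> closed (X : set H) ->
  (forall c, sgval C c -> e c = 1 -> sgval X c) ->
  (forall (F' : finGroupType) (g : fhom H F'), (forall y, sgval N y -> g y = 1) ->
     nilpotent (imf g X)) ->
  sgval C x -> ~ sgval N x -> ~ fitting_degenerate (quotgrp N).
Proof.
move=> pH clN clC clX CX nilX Cx nNx.
have pK := quotgrp_profinite pH clN.
(* Representatives in [C] of the cosets of the kernel of [e]; the default 1 occurs only for [y]
   outside the image of [C]. *)
pose t (y : F) : H := xget 1 [set c | sgval C c /\ e c = y].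
apply: (@virtually_pronilpotent_fitting _ pK (NormalSubgroup (quosg_normal (@nsJ _ C)))
  (NormalSubgroup (quosg_normal (@nsJ _ X))) [seq Defs.coset N (t y) | y <- enum F]
  (Defs.coset N x)).
- exact: quosg_closed.
- exact: quosg_closed.
- move=> _ [c Cc <-]; exists (Defs.coset N (t (e c))); first by apply/map_f; rewrite mem_enum.
  have [Ct et] : sgval C (t (e c)) /\ e (t (e c)) = e c.
    by apply: (@xgetPex _ 1 [set d | sgval C d /\ e d = e c]); exists c.
  exists ((t (e c))^-1 * c); last by rewrite cosetM cosetV.
  by apply: CX; [apply: sgM => //; apply: sgV|rewrite fhM fhV et mulVg].
- move=> F' g; have -> : imf g (quosg N X) = imf (fquo g) X by rewrite imf_fquo.
  by apply: nilX => y /coset_eq1 /= ->; rewrite fh1.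
- by exists x.
- by move/coset_eq1.
Qed.

(** * Closed subgroups of groups with finite c_* *)

(** If a Sylow subgroup is not finitely generated, [d_p] is the infimum of the empty set, which is
    [+oo] and contradicts finiteness. The remaining values are natural numbers, so the integer part
    of the supremum bounds them. *)
Lemma c_star_fin_num (R : realType) (G : topGroupType) : c_star R G \is a fin_num ->
  exists n, forall p, prime p ->
    finitely_generated (subgrp (sylow p G)) /\ cval p (subgrp (sylow p G)) <= n.
Proof.
move=> fc; set r := fine (c_star R G); have er : c_star R G = r%:E by rewrite /r fineK.
exists (Num.truncn r) => p pr_p.
have : (c_p R p G <= r%:E)%E by rewrite -er; apply: ereal_sup_ubound; exists p.
rewrite /c_p; case: asboolP => [fg|nfg] h.
  split=> //.
  rewrite lee_fin in h.
  by rewrite Num.Theory.truncn_ge_nat //; apply: Order.POrderTheory.le_trans h;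
    rewrite Num.Theory.ler0n.
exfalso; move: h; rewrite /d_p /dgen (_ : [set ((size s)%:R)%:E | s in _] = set0).
  by rewrite ereal_inf0 leye_eq.
by apply/seteqP; split=> // t [s gs _]; apply: nfg; exists s.
Qed.

Section NsBig.
Variables (G : topGroupType) (L : seq nat) (M : nat -> normalSubgroup G).

Definition nsbig : normalSubgroup G.
Proof.
unshelve refine (@NormalSubgroup _ (@Subgroup _
  [set x | forall l, l \in L -> sgval (M l) x] _ _ _) _) => /=.
- by move=> l _; apply: sg1.
- by move=> x y hx hy l Ll; apply: sgM; [apply: hx|apply: hy].
- by move=> x hx l Ll; apply: sgV; apply: hx.
- by move=> x y /= hx l Ll; apply: nsJ; apply: hx.
Defined.

Lemma nsbig_closed : (forall l, l \in L -> closed (M l : set G)) -> closed (nsbig : set G).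
Proof.
move=> clM x clx l Ll; apply: (clM l Ll); apply: closure_subset clx => y; exact.
Qed.

End NsBig.

Lemma nsbig_open (G : topGroupType) (L : seq nat) (M : nat -> normalSubgroup G) :
  (forall l, l \in L -> open (M l : set G)) -> open (nsbig L M : set G).
Proof.
elim: L => [|l L IH] oM.
  have -> : (nsbig [::] M : set G) = setT by apply/seteqP; split.
  exact: openT.
have -> : (nsbig (l :: L) M : set G) = M l `&` nsbig L M.
  apply/seteqP; split=> x.
    by move=> hx; split=> [|k Lk]; apply: hx; rewrite inE ?eqxx // Lk orbT.
  by move=> [Mx hx] k; rewrite inE => /orP[/eqP -> //|/hx].
apply: openI; first by apply: oM; rewrite inE eqxx.
by apply: IH => k Lk; apply: oM; rewrite inE Lk orbT.
Qed.

(** * Lower central series of subgroups of the intersection of the [M_l] *)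

Section LowerCentral.
Variables (G : topGroupType) (L : seq nat) (m : nat -> nat) (M A : nat -> normalSubgroup G).
Variable X : subgroup G.
Hypotheses (pG : profinite G) (clX : closed (X : set G)).
Hypothesis MA : forall l, l \in L -> pnil_pair l (m l) (M l) (A l).
Hypothesis sXM : X `<=` nsbig L M.

Let B := sgI X (nsbig L A).

Let clB : closed (B : set G).
Proof. by apply: closedI => //; apply: nsbig_closed => l /MA[]. Qed.

(** The image of an intersection can be smaller than the intersection of the images; compactness
    shows that testing in a fine enough quotient [h] corrects this at the level of [f]. *)
Lemma exists_finer_cap (F : finGroupType) (f : fhom G F) :
  exists (F' : finGroupType) (h : fhom G F'), finer h f /\
    forall x, sgval X x -> (forall l, l \in L -> h x \in imf h (A l)) -> f x \in imf f B.
Proof.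
apply: contrapT => noh.
pose E (F' : finGroupType) (h : fhom G F') := [set x | [/\ sgval X x,
   forall l, l \in L -> h x \in imf h (A l) & f x \notin imf f B]].
have [|||x hx] := @fhom_compact G pG E.
- move=> F' h.
  have -> : E F' h = X `&` (h @^-1` [set z | forall l, l \in L -> z \in imf h (A l)] `&`
      f @^-1` [set z | z \notin imf f B]).
    by apply/seteqP; split=> x [] // ? [].
  by apply: closedI => //; apply: closedI; apply: fh_pre_closed.
- move=> F' h; apply: contrapT => E0; apply: noh.
  exists _, (fpair f h); split; first exact: finer_pairl.
  move=> x Xx hx; apply: contrapT => /negP nfx; apply: E0; exists x; split=> // l Ll.
  have /imfP[a Aa [_ <-]] := hx l Ll; exact: mem_imf.
- move=> F1 F2 h1 h2 h12 x [Xx hx nfx]; split=> // l Ll.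
  have /imfP[a Aa ax] := hx l Ll.
  by rewrite -(finer_eq h12 ax); apply: mem_imf.
have [Xx _ /negP] := hx _ f; apply; apply: mem_imf; split=> // l Ll.
apply: (closed_imf pG (pnil_closed (MA Ll))) => F' h.
by have [_ /(_ l Ll)] := hx _ h.
Qed.

(** Modulo [B], [X] embeds in the product of the pro-l groups [M_l / A_l], [l] in [L]. In a finite
    quotient each prime gives a lower central index, and the largest one works. *)
Lemma lcn_imf_sub (F : finGroupType) (f : fhom G F) :
  exists k, 'L_k.+1(imf f X) \subset imf f B.
Proof.
have [F' [h [hf hB]]] := exists_finer_cap f.
have [k hk] : exists k, forall l, l \in L -> 'L_k.+1(imf h X) \subset imf h (A l).
  have : {subset L <= L} by [].
  elim: {1 3}L => [|l L' IH] sL; first by exists 0.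
  have [k hk] := IH (fun i Li => sL i (@mem_behead _ (l :: L') i Li)).
  have Ll : l \in L by apply: sL; rewrite inE eqxx.
  have nA : imf h (M l) \subset 'N(imf h (A l)).
    apply: fintype.subset_trans (normal_norm (imf_normal h (@nsJ _ (A l)))).
    exact: imfS.
  have sXMl : imf h X \subset imf h (M l) by apply: imfS => x /sXM; apply.
  have [k' hk'] := @pgroup_lcn_sub _ l [group of imf h X] [group of imf h (M l)]
    [group of imf h (A l)] sXMl nA
    (imfS h (pnil_sub (MA Ll))) (pnil_p (MA Ll) h).
  exists (maxn k k') => i; rewrite inE => /orP[/eqP ->|Li].
    by apply: fintype.subset_trans hk'; apply: lcn_sub_leq; rewrite ltnS leq_maxr.
  by apply: fintype.subset_trans (hk i Li); apply: lcn_sub_leq; rewrite ltnS leq_maxl.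
exists k; have [phi [phiE phiX]] := finer_morphim X hf.
rewrite -(phiX X) // -morphim_lcn //.
apply/fintype.subsetP => _ /morphimP[z _ Lz ->].
have /imfP[x Xx xz] := fintype.subsetP (lcn_sub _ _) z Lz.
rewrite -xz phiE //; apply: hB => // l Ll; rewrite xz.
exact: fintype.subsetP (hk l Ll) z Lz.
Qed.

Lemma lcn_imf_cent (F : finGroupType) (f : fhom G F) :
  (forall b x, sgval B b -> sgval X x -> [~ x, b] = 1) -> nilpotent (imf f X).
Proof.
move=> cB; have [k Lk] := lcn_imf_sub f.
apply/(lcnP [group of imf f X]); exists k.+1; rewrite lcnSn; apply/commG1P.
apply: fintype.subset_trans Lk _; apply/centsP => _ /imfP[b Bb <-] _ /imfP[x Xx <-].
apply/esym/commgP; rewrite -fhR cB // fh1; exact: eqxx.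
Qed.

End LowerCentral.

Section Restrict.
Variables (G : topGroupType) (H : subgroup G).

Definition ressg (X : subgroup G) (nX : forall x y, sgval X x -> sgval H y -> sgval X (x ^ y)) :
  normalSubgroup (subgrp H).
Proof.
unshelve refine (@NormalSubgroup _ (@Subgroup _
  [set x : subgrp H | sgval X (val x)] _ _ _) _) => /=.
- exact: sg1.
- by move=> x y Xx Xy; apply: sgM.
- by move=> x Xx; apply: (sgV Xx).
- by move=> x y Xx; apply: nX Xx (set_mem (valP y)).
Defined.

Lemma ressg_closed (X : subgroup G) nX :
  closed (X : set G) -> closed (@ressg X nX : set (subgrp H)).
Proof.
move=> clX; have h : closed ((val : subgrp H -> G) @^-1` X).
  by apply: (preimage_closed _ clX) => x _; apply: subgrp_val_continuous.
exact h.
Qed.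

Lemma imf_ressg (F : finGroupType) (f : fhom G F) (X : subgroup G) nX : X `<=` H ->
  imf (fres H f) (@ressg X nX) = imf f X.
Proof.
move=> sXH; rewrite imf_fres; congr imf; apply/seteqP; split=> [_ [x Xx <-] //|x Xx].
by exists (exist _ x (mem_set (sXH x Xx))).
Qed.

Lemma valsg_closed (N : subgroup (subgrp H)) : profinite G -> closed (H : set G) ->
  closed (N : set (subgrp H)) -> closed (valsg N : set G).
Proof.
move=> [cG hG _] clH clN; apply: compact_closed => //; apply: continuous_compact.
  by apply: continuous_subspaceT; apply: subgrp_val_continuous.
by apply: subclosed_compact clN (subgrp_compact cG clH) _.
Qed.

End Restrict.

Lemma nilpotent_ressg (G : topGroupType) (H X B : subgroup G)
    (nX : forall x y, sgval X x -> sgval H y -> sgval X (x ^ y)) (N : set (subgrp H)) :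
  profinite G -> X `<=` H -> B `<=` X ->
  (forall (x : subgrp H), sgval B (val x) -> N x) ->
  (forall (F : finGroupType) (f : fhom G F), exists k, 'L_k.+1(imf f X) \subset imf f B) ->
  forall (F : finGroupType) (g : fhom (subgrp H) F), (forall y, N y -> g y = 1) ->
    nilpotent (imf g (ressg nX)).
Proof.
move=> pG sXH sBX BN lcnX F g gN; have [F' [f fg]] := fres_lift g pG.
have [phi [phiE phiI]] := finer_morphim (ressg nX) fg.
have [k Lk] := lcnX F' f.
apply/(lcnP [group of imf g (ressg nX)]); exists k.
apply/eqP; rewrite -subG1 /= -(phiI (ressg nX)) // -morphim_lcn //.
apply/fintype.subsetP => _ /morphimP[z _ Lz ->].
rewrite /= imf_ressg // in Lz; have /imfP[b Bb <-] := fintype.subsetP Lk z Lz.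
pose b' : subgrp H := exist _ b (mem_set (sXH b (sBX b Bb))).
have -> : f b = fres H f b' by [].
rewrite phiE; last by apply: sBX Bb.
by rewrite gN ?group1 //; apply: BN.
Qed.

Lemma open_normal_closed (G : topGroupType) (N : normalSubgroup G) :
  compact [set: G] -> open (N : set G) -> closed (N : set G).
Proof.
move=> cG oN; have [F [f fN]] := fhom_of_open_normal cG oN.
have -> : (N : set G) = f @^-1` [set 1]%classic by apply/seteqP; split=> x /fN.
exact: fh_pre_closed.
Qed.

Definition centsg (G : groupType) (H D : subgroup G) : subgroup G.
Proof.
unshelve refine (@Subgroup _ [set h | sgval H h /\ forall d, sgval D d -> h * d = d * h] _ _ _).
- by split=> [|d _]; [apply: sg1|rewrite mul1g mulg1].
- move=> x y [Hx cx] [Hy cy]; split=> [|d Dd]; first exact: sgM.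
  by rewrite -mulgA (cy d Dd) mulgA (cx d Dd) mulgA.
- move=> x [Hx cx]; split=> [|d Dd]; first exact: sgV.
  by apply: (mulgI x); rewrite mulKVg mulgA (cx d Dd) mulgK.
Defined.

Lemma centsg_norm (G : groupType) (H : subgroup G) (D : normalSubgroup G) x y :
  sgval (centsg H D) x -> sgval H y -> sgval (centsg H D) (x ^ y).
Proof.
move=> [Hx cx] Hy; split=> [|d Dd].
  by rewrite conjgE; apply: sgM; [apply: sgV|apply: sgM].
have Dd' : sgval D (d ^ y^-1) by apply: nsJ.
by rewrite -[d](conjgKV y) -!conjMg cx.
Qed.

Lemma centsg_closed (G : topGroupType) (H D : subgroup G) : profinite G ->
  closed (H : set G) -> closed (centsg H D : set G).
Proof.
move=> pG clH x clx; split.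
  by apply: clH; apply: closure_subset clx => y [].
move=> d Dd; apply: (mulgI (d * x)^-1); rewrite mulVg.
apply: (fhom_sep pG) => F f.
have clE : closed (f @^-1` [set z | z * f d = f d * z]) by apply: fh_pre_closed.
have /= e : (f @^-1` [set z | z * f d = f d * z]) x.
  apply: clE; apply: closure_subset clx => y [_ /(_ d Dd) yd] /=.
  by rewrite -!fhM yd.
by rewrite fhM fhV !fhM e mulVg.
Qed.

Section Main.
Variables (G : topGroupType) (n : nat) (m : nat -> nat) (M A : nat -> normalSubgroup G).
Hypothesis pG : profinite G.
Hypothesis cG : forall p, prime p ->
  finitely_generated (subgrp (sylow p G)) /\ cval p (subgrp (sylow p G)) <= n.
Hypothesis MA : forall p, prime p -> pnil_pair p (m p) (M p) (A p).
Variables (H : subgroup G) (N : normalSubgroup (subgrp H)).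
Hypotheses (clH : closed (H : set G)) (clN : closed (N : set (subgrp H))).

Let L0 := [seq p <- iota 0 n.+1 | prime p].
Let A0 := nsbig L0 A.
Let H1 := sgI H A0.

Lemma pdiv_gt_of_sub_A0 (F : finGroupType) (f : fhom G F) (X : subgroup G) p :
  X `<=` A0 -> prime p -> p %| #|imf f X| -> n < p.
Proof.
move=> sXA pr_p pX; rewrite ltnNge; apply/negP => lepn.
have L0p : p \in L0 by rewrite mem_filter pr_p mem_iota.
have : p^'.-group (imf f X).
  apply: pgroupS (pnil_p' (MA pr_p) f); apply: imfS => x /sXA; exact.
by rewrite /pgroup p'natE // pX.
Qed.

Section Centraliser.
Variables (q : nat) (F0 : finGroupType) (f0 : fhom G F0) (y0 : F0) (B : {group F0}).
Hypotheses (pr_q : prime q) (qy0 : q.-elt y0) (y0T : y0 \in (imf f0 H1)^`(1)) (y0B : y0 \notin B).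
Let L1 := q :: primes (m q).
Let D := nsbig L1 A.

Let prL1 l : l \in L1 -> prime l.
Proof. by rewrite inE mem_primes => /orP[/eqP ->|/and3P[]]. Qed.

(** In every finite quotient above [f0], a lift of [y0] that is a [q]-element of the derived
    subgroup of [H1] centralises [D] by [pelt_cent_of_Sylow_cents]; compactness provides one element
    of [H] that does so in all quotients. *)
Lemma exists_centralising : exists h, [/\ sgval H h, f0 h \notin B &
  forall d, sgval D d -> [~ h, d] = 1].
Proof.
pose E (F : finGroupType) (g : fhom G F) := [set h | [/\ sgval H h, f0 h \notin B &
  forall d, sgval D d -> [~ g h, g d] = 1]].
have [|||h hh] := @fhom_compact G pG E.
- move=> F g.
  have -> : E F g = H `&` (f0 @^-1` [set z | z \notin B] `&`
      g @^-1` [set z | forall d, sgval D d -> [~ z, g d] = 1]).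
    by apply/seteqP; split=> h [] // ? [].
  by apply: closedI => //; apply: closedI; apply: fh_pre_closed.
- move=> F g; pose e := fpair f0 g.
  have ef0 : finer e f0 := @finer_pairl _ _ _ f0 g.
  have [phi [phiE phiI]] := finer_morphim (sgT G) ef0.
  have sH1G : imf e H1 \subset imf e (sgT G) by apply: imfS.
  have : y0 \in phi @* (imf e H1)^`(1) by rewrite morphim_der // phiI.
  move=> /morphimP[z _ Tz y0E].
  have zH1 : z \in imf e H1 := fintype.subsetP (der_sub 1 _) z Tz.
  have zG : z \in imf e (sgT G) := fintype.subsetP sH1G z zH1.
  have qT : z.`_q \in (imf e H1)^`(1) by apply: groupX.
  have qH1 : z.`_q \in imf e H1 by apply: groupX.
  (* A lift [z] need not be a [q]-element, but as [y0] is one, the [q]-part of [z] is a lift too. *)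
  have y0q : y0 = phi z.`_q by rewrite morph_constt // -y0E constt_p_elt.
  have cent : z.`_q \in 'C(imf e D).
    apply: (@pelt_cent_of_Sylow_cents _ [group of imf e (sgT G)] [group of imf e (A q)]
      [group of imf e D] q _ pr_q).
    - by apply: imf_normal; apply: nsJ.
    - exact: (pnil_p' (MA pr_q)).
    - by apply: imf_normal; apply: nsJ.
    - exact: fintype.subsetP sH1G _ qH1.
    - exact: p_elt_constt.
    move=> r pr_r rD.
    (* [D] lies in [A l] for each [l] in [L1], so no such [l] divides the order of its image. Hence
       [r] divides neither [q] nor [m q], and the index of [A q] is prime to [r]. *)
    have L1r : r \notin L1.
      apply/negP => L1r; have := pgroupS (imfS e _) (pnil_p' (MA pr_r) e).
      move=> /(_ D (fun x hx => hx r L1r)).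
      by rewrite /pgroup p'natE // rD.
    have [rq rm] : r != q /\ ~~ (r %| m q).
      move: L1r; rewrite inE negb_or => /andP[-> ]; rewrite mem_primes pr_r.
      by rewrite (pnil_gt0 (MA pr_q)).
    have sylS := is_sylow_sylow pr_r pG; have [fgS cS] := cG pr_r.
    exists [group of imf e (sylow r G)].
      exact: ((is_sylowP (sylow r G) pr_r pG).1 sylS).2.
    apply: fintype.subsetP qT.
    apply: (der1_sub_cent_Sylow pr_r pG sylS fgS cS).
    - by apply: imf_normal; apply: nsJ.
    - exact: (pnil_index_p' e (MA pr_q) pr_r rq rm).
    - exact: sH1G.
    - by move=> p pr_p; apply: pdiv_gt_of_sub_A0 => // x [].
  have /imfP[h [Hh _] eh] := qH1.
  exists h; split=> //.
    by move: y0B; rewrite y0q -eh phiE.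
  move=> d Dd; have /centP/(_ (e d)) := cent.
  rewrite -eh => /(_ (mem_imf _ Dd)) /commgP/eqP.
  by rewrite -!fhR => /fpair_ker[_].
- move=> F1 F2 h1 h2 h12 h [Hh Bh hd]; split=> // d Dd.
  by rewrite -fhR; apply: h12; rewrite fhR; apply: hd.
have [Hh Bh _] := hh _ f0.
exists h; split=> // d Dd; apply: (fhom_sep pG) => F g; rewrite fhR.
by have [_ _] := hh _ g; apply.
Qed.

End Centraliser.

Let N0 := valsg N.

Let valN (x : subgrp H) : sgval N0 (val x) -> sgval N x.
Proof. by move=> [y Ny /val_inj <-]. Qed.

(** The common end of the first and last cases: [C] meets the intersection of the [M l] in a
    subgroup of finite index, which becomes pronilpotent modulo [N] because its lower central terms
    fall into [B]. *)
Lemma lcn_absorbed_fitting (L : seq nat) (C B : subgroup G)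
    (nC : forall x y, sgval C x -> sgval H y -> sgval C (x ^ y)) c :
  (forall l, l \in L -> prime l) -> closed (C : set G) -> C `<=` H ->
  B `<=` sgI C (nsbig L M) -> B `<=` N0 ->
  (forall (F : finGroupType) (f : fhom G F),
     exists k, 'L_k.+1(imf f (sgI C (nsbig L M))) \subset imf f B) ->
  sgval C c -> ~ sgval N0 c -> ~ fitting_degenerate (quotgrp N).
Proof.
move=> prL clC sCH sBX sBN lcnX Cc nNc; have [cptG _ _] := pG.
have oM : open (nsbig L M : set G).
  by apply: nsbig_open => l /prL/MA[].
have clM := open_normal_closed cptG oM.
have [F [f fM]] := fhom_of_open_normal cptG oM.
have nX x y : sgval (sgI C (nsbig L M)) x -> sgval H y -> sgval (sgI C (nsbig L M)) (x ^ y).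
  by move=> [Cx Mx] Hy; split; [apply: nC|apply: nsJ].
pose c' : subgrp H := exist _ c (mem_set (sCH c Cc)).
apply: (@virtually_pronilpotent_quotient_fitting _ N (ressg nC) (ressg nX) F (fres H f) c').
- exact: subgrp_profinite.
- exact: clN.
- exact: ressg_closed.
- by apply: ressg_closed; apply: closedI.
- by move=> x Cx /= fx; split=> //; apply/fM.
- move=> F' g; apply: (@nilpotent_ressg G H _ B nX N pG _ sBX _ lcnX).
    by move=> x [/sCH].
  by move=> x /sBN; apply: valN.
- exact: Cc.
- by move=> Nc; apply: nNc; exists c'.
Qed.

Lemma quotient_fitting_nondegenerate (x0 : subgrp H) : ~ sgval N x0 ->
  ~ fitting_degenerate (quotgrp N).
Proof.
move=> nNx0.
have prL0 l : l \in L0 -> prime l by rewrite mem_filter => /andP[].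
have clA0 : closed (A0 : set G) by apply: nsbig_closed => l /prL0/MA[].
have clH1 : closed (H1 : set G) by apply: closedI.
have clN0 : closed (N0 : set G) by apply: valsg_closed.
have nH x y : sgval H x -> sgval H y -> sgval H (x ^ y).
  by move=> Hx Hy; rewrite conjgE; apply: sgM; [apply: sgV|apply: sgM].
have [sH1N|nH1N] := pselect (H1 `<=` N0).
  (* The absorbing subgroup lies in [H1], hence in [N0] in this case. *)
  apply: (@lcn_absorbed_fitting L0 H (sgI (sgI H (nsbig L0 M)) A0) nH (val x0)) => //.
  - by move=> x [].
  - by move=> x [[Hx _] Ax]; apply: sH1N.
  - move=> F f; apply: (lcn_imf_sub pG (m := m)).
    + apply: closedI => //; apply: nsbig_closed => l /prL0/MA[oM _ _ _ _ _ _].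
      by apply: open_normal_closed; case: pG.
    + by move=> l Ll; apply: MA (prL0 l Ll).
    + by move=> x [].
  - exact: set_mem (valP x0).
  - by move=> /valN.
have nH1 x y : sgval H1 x -> sgval H y -> sgval H1 (x ^ y).
  by move=> [Hx Ax] Hy; split; [apply: nH|apply: nsJ].
have [cH1|ncH1] := pselect (forall x y, sgval H1 x -> sgval H1 y -> sgval N0 [~ x, y]).
  have [x [H1x nNx]] : exists x, sgval H1 x /\ ~ sgval N0 x.
    by apply: contrapT => h; apply: nH1N => x H1x; apply: contrapT => nNx; apply: h; exists x.
  pose x' : subgrp H := exist _ x (mem_set H1x.1).
  (* [H1] itself serves as the subgroup of finite index, so any finite quotient will do. *)
  have [F [f _]] := fhom_basis (subgrp_profinite pG clH) (filterT : nbhs 1 setT).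
  apply: (@virtually_pronilpotent_quotient_fitting _ N (ressg nH1) (ressg nH1) F f x') => //.
  - exact: subgrp_profinite.
  - exact: ressg_closed.
  - exact: ressg_closed.
  - move=> F' g gN; apply: (@abelian_nil _ [group of imf g (ressg nH1)]).
    apply/centsP => _ /imfP[a Ha <-] _ /imfP[b Hb <-].
    by apply/commgP; rewrite -fhR gN //; apply: valN; apply: cH1.
  - by move=> Nx; apply: nNx; exists x'.
have [x [y [H1x H1y nNxy]]] : exists x y, [/\ sgval H1 x, sgval H1 y & ~ sgval N0 [~ x, y]].
  apply: contrapT => h; apply: ncH1 => x y H1x H1y; apply: contrapT => nNxy.
  by apply: h; exists x, y.
have [F0 [f0 nf0]] : exists (F0 : finGroupType) (f0 : fhom G F0), f0 [~ x, y] \notin imf f0 N0.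
  apply: contrapT => h; apply: nNxy; apply: (closed_imf pG clN0) => F f.
  by apply: contrapT => /negP nf; apply: h; exists F, f.
have T0 : f0 [~ x, y] \in (imf f0 H1)^`(1).
  by rewrite fhR; apply: mem_commg; apply: mem_imf.
set t := f0 [~ x, y] in nf0 T0.
(* [t] is the product of its [q]-parts, so they do not all lie in the image of [N]. *)
have [q nq] : exists q : nat, t.`_q \notin imf f0 N0.
  apply: contrapT => h; move/negP: nf0; apply; rewrite -(prod_constt t).
  apply: (@group_prod _ [group of imf f0 N0]) => q _.
  by apply: contrapT => /negP nq; apply: h; exists q.
have pr_q : prime q.
  apply: contrapT => npr; move/negP: nq; apply.
  have -> : t.`_q = 1; last exact: group1.
  apply/constt1P; apply/pnatP => [|p pr_p _]; first exact: order_gt0.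
  by rewrite !inE; apply: contraPneq npr => <-.
have [h [Hh nBh ch]] := exists_centralising (B := [group of imf f0 N0]) pr_q
  (p_elt_constt q t) (groupX _ T0) nq.
set L1 := q :: primes (m q) in ch.
have prL1 l : l \in L1 -> prime l.
  by rewrite inE mem_primes => /orP[/eqP ->|/and3P[]].
set D := nsbig L1 A in ch.
(* Nothing needs absorbing here: elements of the centraliser of [D] that lie in [D] are central in
   it, so its intersection with the [M l] already has nilpotent finite images. *)
apply: (@lcn_absorbed_fitting L1 (centsg H D) (trivsg G) (@centsg_norm G H D) h) => //.
- exact: centsg_closed.
- by move=> z [].
- by move=> z ->; apply: sg1.
- by move=> z ->; apply: sg1.
- move=> F f; have : nilpotent (imf f (sgI (centsg H D) (nsbig L1 M))).
    apply: (lcn_imf_cent pG (m := m) (L := L1) (M := M) (A := A)).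
    + apply: closedI; first exact: centsg_closed.
      apply: nsbig_closed => l /prL1/MA[oM _ _ _ _ _ _].
      by apply: open_normal_closed; case: pG.
    + by move=> l Ll; apply: MA (prL1 l Ll).
    + by move=> z [].
    + move=> b z [_ Db] [[_ cz] _].
      by rewrite commgEl conjgE (cz b Db) mulKg mulVg.
  move=> /(lcnP [group of imf f (sgI (centsg H D) (nsbig L1 M))])[k Lk].
  exists k; have /eqP := Lk; rewrite -subG1 => /fintype.subset_trans; apply.
  exact: (sub1G [group of imf f (trivsg G)]).
- split=> // d Dd.
  by rewrite commgC ch // mulg1.
- move=> Nh; case/negP: nBh; exact: mem_imf.
Qed.

End Main.

Theorem mainTheorem4 (R : realType) (G : topGroupType) (H : subgroup G) :
  profinite G -> c_star R G \is a fin_num -> closed H ->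
  fitting_regular (subgrp H).
Proof.
move=> pG cfin clH N clN ntQ.
have [n cG] := c_star_fin_num cfin.
have /choice[t tP] : forall p, exists u : nat * normalSubgroup G * normalSubgroup G,
    prime p -> pnil_pair p u.1.1 u.1.2 u.2.
  move=> p; have [pr_p|] := boolP (prime p); last first.
    (* A dummy triple for [p] not prime, so that a choice function can be defined on all of
       [nat]. *)
    have [F [f _]] := fhom_basis pG (filterT : nbhs (1 : G) setT).
    by exists (0, kerf f, kerf f).
  have [m [M [A MA]]] := virtually_pnilpotent pr_p pG (is_sylow_sylow pr_p pG) (cG p pr_p).1.
  by exists (m, M, A).
have [x nNx] : exists x, ~ sgval N x.
  apply: contrapT => h; apply: ntQ; apply/seteqP; split=> // a _.
  elim/coset_ind: a => x; apply/coset_eq1; apply: contrapT => nNx; apply: h; by exists x.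
exact: (quotient_fitting_nondegenerate pG cG tP clH clN nNx).
Qed.
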